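(* If $\mathcal{R}$ is a polynomially bounded o-minimal expansion of the real field with $C^\infty$-uniformization, then $\mathcal{R}$ is definably equivalent to $\mathbb{R}_{\mathcal{C}}$ for some quasianalytic IF-system $\mathcal{C}$.
   Context: $\mathbb{Q}_+=\mathbb{Q}\cap(0,\infty)$, $\mathbb{Q}_+^0=\{0\}$; for $r\in\mathbb{Q}_+^n$, $[-r,r]=\prod_i[-r_i,r_i]$ (and $[-0,0]=\{0\}$; functions on $\{0\}$ are identified with reals). For $C^1$ $f:[-r,r]\times[-s,s]\to\mathbb{R}$ with $r\in\mathbb{Q}_+^m$, $s\in\mathbb{Q}_+$, $\mathrm{IF}(f;r,s)$ means there is $\sigma\in\{-1,1\}$ with $\sigma\,\partial f/\partial y>0$ on the box and $\sigma f(x,-s)<0<\sigma f(x,s)$ for all $x\in[-r,r]$. An IF-system is a collection $\mathcal{C}=\bigcup_{n\in\mathbb{N},r\in\mathbb{Q}_+^n}\mathcal{C}_r$, $\mathcal{C}_r$ a set of $C^\infty$ functions $[-r,r]\to\mathbb{R}$ (so $\mathcal{C}_0\subseteq\mathbb{R}$), such that: (1) $\mathcal{C}_0$ is a field; (2) for $n>0$, $r\in\mathbb{Q}_+^n$, $\mathcal{C}_r$ is a ring containing the coordinate functions, and each $f\in\mathcal{C}_r$ is the restriction of some $g\in\mathcal{C}_s$ with $s>r$ (componentwise); (3) for $r\in\mathbb{Q}_+^m$, $s\in\mathbb{Q}_+^n$: (a) if $g\in\mathcal{C}_r^n$, $g([-r,r])\subseteq[-s,s]$, $f\in\mathcal{C}_s$,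 then $f\circ g\in\mathcal{C}_r$; (b) if $f\in\mathcal{C}_r$ and $f(x_1,\dots,x_{m-1},0)=0$ identically, then $f=x_mg$ with $g\in\mathcal{C}_r$; (c) if $n=1$, $f\in\mathcal{C}_{(r,s)}$ and $\mathrm{IF}(f;r,s)$ holds, then the function $g:[-r,r]\to(-s,s)$ with $f(x,g(x))=0$ is in $\mathcal{C}_r$. $\mathcal{C}$ is quasianalytic if for all $n>0$, $r\in\mathbb{Q}_+^n$, $a\in[-r,r]$, the map sending $f\in\mathcal{C}_r$ to its Taylor series at $a$ is injective. $\mathbb{R}_{\mathcal{C}}$ is the expansion of the real ordered field by the functions $\widehat{f}:\mathbb{R}^n\to\mathbb{R}$, for $f:[-r,r]\to\mathbb{R}$ in $\mathcal{C}$, where $\widehat f=f$ on $[-r,r]$ and $\widehat f=0$ elsewhere. ''Definable'' means first-order definable with parameters, ''$0$-definable'' means definable without parameters. Two structures with the same universe (possibly different signatures) are definably equivalent if they have the same $0$-definable sets. An expansion $\mathcal{R}$ of the real field is polynomially bounded if for every definable $f:\mathbb{R}\to\mathbb{R}$ there are $M,N>0$ with $|f(t)|\le t^N$ for all $t>M$. It has $C^\infty$-uniformization if for every compact $0$-definable $K\subseteq\mathbb{R}^m$ there is a $0$-definable surjective $C^\infty$ map $f:M\to K$, where $M\subseteq\mathbb{R}^n$ is a compact $C^\infty$ manifold of the same dimension as $K$. *)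

(* Defs.v *)
From mathcomp Require Export all_boot all_order all_algebra.
From mathcomp Require Export all_classical all_reals all_analysis.
Export numFieldNormedType.Exports.

Set Implicit Arguments.
Unset Strict Implicit.
Unset Printing Implicit Defensive.
Import Order.TTheory GRing.Theory Num.Theory.

Local Open Scope classical_set_scope.
Local Open Scope ring_scope.

(** The row vector (v, y); appending is done at the end, so [ord_max] is the
    index of the appended coordinate. *)
Definition snoc (T : Type) (n : nat) (v : 'rV[T]_n) (y : T) : 'rV[T]_n.+1 :=
  \row_i (if unlift ord_max i is Some j then v 0 j else y).

(** * First-order logic over expansions of the real ordered field *)

(** Only the symbols added to the language {0, 1, +, -, *, <} of ordered rings
    are listed; constant symbols are function symbols of arity 0. *)
Record signature := Signature {
  fsym : Type;
  farity : fsym -> nat;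
  rsym : Type;
  rarity : rsym -> nat }.

Record expansion (R : realType) := Expansion {
  esig :> signature;
  finterp : forall f : fsym esig, 'rV[R]_(farity f) -> R;
  rinterp : forall p : rsym esig, set 'rV[R]_(rarity p) }.

(** Terms and formulas whose free variables are among x_0, ..., x_(n-1).
    In [Ex phi] the bound variable of [phi] is the last one, x_n. *)
Inductive term (L : signature) (n : nat) : Type :=
| Var of 'I_n
| Zero
| One
| Opp of term L n
| Add of term L n & term L n
| Mul of term L n & term L n
| App (f : fsym L) of ('I_(farity f) -> term L n).

Inductive formula (L : signature) : nat -> Type :=
| Eq n of term L n & term L n : formula L n
| Lt n of term L n & term L n : formula L n
| Rel n (p : rsym L) of ('I_(rarity p) -> term L n) : formula L n
| Not n of formula L n : formula L n
| And n of formula L n & formula L n : formula L n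
| Ex n of formula L n.+1 : formula L n.

Fixpoint teval (R : realType) (E : expansion R) (n : nat) (v : 'rV[R]_n)
    (t : term E n) : R :=
  match t with
  | Var i => v 0 i
  | Zero => 0
  | One => 1
  | Opp t1 => - teval v t1
  | Add t1 t2 => teval v t1 + teval v t2
  | Mul t1 t2 => teval v t1 * teval v t2
  | App f ts => finterp (\row_i teval v (ts i))
  end.

Fixpoint sat (R : realType) (E : expansion R) (n : nat) (phi : formula E n) :
    'rV[R]_n -> Prop :=
  match phi with
  | Eq _ t1 t2 => fun v => teval v t1 = teval v t2
  | Lt _ t1 t2 => fun v => teval v t1 < teval v t2
  | Rel _ p ts => fun v => rinterp (\row_i teval v (ts i))
  | Not _ psi => fun v => ~ sat psi v
  | And _ psi1 psi2 => fun v => sat psi1 v /\ sat psi2 v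
  | Ex _ psi => fun v => exists y : R, sat psi (snoc v y)
  end.

Definition zero_definable (R : realType) (E : expansion R) (n : nat)
    (A : set 'rV[R]_n) : Prop :=
  exists phi : formula E n, A = [set v | sat phi v].

Definition definable (R : realType) (E : expansion R) (n : nat)
    (A : set 'rV[R]_n) : Prop :=
  exists (k : nat) (c : 'rV[R]_k) (phi : formula E (k + n)),
    A = [set v | sat phi (row_mx c v)].

Definition definably_equivalent (R : realType) (E F : expansion R) : Prop :=
  forall (n : nat) (A : set 'rV[R]_n), zero_definable E A <-> zero_definable F A.

(** The intervals of [interval R] may be open, closed, half-open, unbounded or
    reduced to a point. *)
Definition o_minimal (R : realType) (E : expansion R) : Prop :=
  forall A : set 'rV[R]_1, definable E A ->
    exists s : seq (interval R), A = [set v | has (fun I => v 0 0 \in I) s].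

Definition polynomially_bounded (R : realType) (E : expansion R) : Prop :=
  forall f : R -> R,
    definable E [set v : 'rV[R]_2 | v 0 ord_max = f (v 0 ord0)] ->
    exists M N : R, [/\ 0 < M, 0 < N & forall t, M < t -> `|f t| <= t `^ N].

(** * Dimension of definable sets *)

Definition def_continuous (R : realType) (E : expansion R) (n : nat)
    (B : set 'rV[R]_n) (f : 'rV[R]_n -> R) : Prop :=
  definable E [set snoc x (f x) | x in B] /\ {within B, continuous f}.

(** A boundary function of a band over [B]: a continuous definable real
    function on [B], or the constant [e], which is [-oo] or [+oo] below. *)
Definition band_bound (R : realType) (E : expansion R) (n : nat)
    (B : set 'rV[R]_n) (e : \bar R) (f : 'rV[R]_n -> \bar R) : Prop :=
  f = cst e \/
  exists2 f0 : 'rV[R]_n -> R, def_continuous E B f0 & f = (fun x => (f0 x)%:E).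

(** [cell E d C]: [C] is an (i_1, ..., i_n)-cell with i_1 + ... + i_n = d. *)
Fixpoint cell (R : realType) (E : expansion R) (n : nat) :
    nat -> set 'rV[R]_n -> Prop :=
  match n with
  | 0 => fun d C => d = 0%N /\ C = setT
  | n'.+1 => fun d C =>
    (exists (B : set 'rV[R]_n') (f : 'rV[R]_n' -> R),
      [/\ cell E d B, def_continuous E B f & C = [set snoc x (f x) | x in B]])
    \/
    (exists (d' : nat) (B : set 'rV[R]_n') (f g : 'rV[R]_n' -> \bar R),
      [/\ d = d'.+1, cell E d' B,
          band_bound E B -oo%E f /\ band_bound E B +oo%E g,
          (forall x, B x -> (f x < g x)%E) &
          C = [set z | exists x y,
                 [/\ B x, (f x < y%:E)%E, (y%:E < g x)%E & z = snoc x y]]])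
  end.

(** The empty set has no dimension in this sense (dim = -oo). *)
Definition has_dim (R : realType) (E : expansion R) (n : nat)
    (A : set 'rV[R]_n) (d : nat) : Prop :=
  (exists2 C, cell E d C & C `<=` A) /\
  (forall d' C, cell E d' C -> C `<=` A -> (d' <= d)%N).

(** * Smooth functions and manifolds *)

(** [Ck k U f]: [f] is of class C^k on the open set [U]. *)
Fixpoint Ck (R : realType) (n k : nat) (U : set 'rV[R]_n)
    (f : 'rV[R]_n -> R) : Prop :=
  match k with
  | 0 => forall x, U x -> {for x, continuous f}
  | k'.+1 => forall i : 'I_n,
      (forall x, U x -> derivable f x (delta_mx 0 i)) /\
      Ck k' U (fun x => 'D_(delta_mx 0 i) f x)
  end.

(** Smoothness on an arbitrary subset of R^n, through local extensions. *)
Definition smooth_on (R : realType) (n : nat) (A : set 'rV[R]_n)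
    (f : 'rV[R]_n -> R) : Prop :=
  forall a, A a -> exists (U : set 'rV[R]_n) (g : 'rV[R]_n -> R),
    [/\ open U, U a, (forall k, Ck k U g) & forall x, A x -> U x -> f x = g x].

Definition smooth_map_on (R : realType) (n p : nat) (A : set 'rV[R]_n)
    (f : 'rV[R]_n -> 'rV[R]_p) : Prop :=
  forall j : 'I_p, smooth_on A (fun x => f x 0 j).

(** Boundaryless d-dimensional submanifolds of R^n: locally diffeomorphic to
    open subsets of R^d. *)
Definition smooth_manifold (R : realType) (n d : nat) (M : set 'rV[R]_n) : Prop :=
  forall a, M a ->
    exists (W : set 'rV[R]_n) (U : set 'rV[R]_d)
      (phi : 'rV[R]_d -> 'rV[R]_n) (psi : 'rV[R]_n -> 'rV[R]_d),
    [/\ open W /\ W a, open U, phi @` U = M `&` W,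
        (forall u, U u -> psi (phi u) = u) &
        smooth_map_on U phi /\ smooth_map_on (M `&` W) psi].

(** A map on [M] is 0-definable when its graph is. The quantification over [d]
    requires nothing for K empty, where M empty works. *)
Definition smooth_uniformization (R : realType) (E : expansion R) : Prop :=
  forall (m : nat) (K : set 'rV[R]_m) (d : nat),
    compact K -> zero_definable E K -> has_dim E K d ->
    exists (n : nat) (M : set 'rV[R]_n) (f : 'rV[R]_n -> 'rV[R]_m),
      [/\ compact M, smooth_manifold d M, smooth_map_on M f,
          zero_definable E [set row_mx x (f x) | x in M] & f @` M = K].

(** * IF-systems *)

Definition pos_radius (n : nat) (r : 'rV[rat]_n) : Prop := forall i, 0 < r 0 i.

Definition box (R : realType) (n : nat) (r : 'rV[rat]_n) : set 'rV[R]_n :=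
  [set x | forall i, `|x 0 i| <= ratr (r 0 i)].
Arguments box {R n} r.

(** The i-th partial derivative of [f] as a function on the closed box:
    increments leaving the box are excluded, so that only the values of [f]
    on the box matter and derivatives are one-sided on the faces. *)
Definition pderiv (R : realType) (n : nat) (r : 'rV[rat]_n) (i : 'I_n)
    (f : 'rV[R]_n -> R) (x : 'rV[R]_n) : R :=
  lim ((fun h : R => h^-1 * (f (h *: delta_mx 0 i + x) - f x)) @
       within [set h : R | box r (h *: delta_mx 0 i + x)] (0 : R)^').

Definition mpderiv (R : realType) (n : nat) (r : 'rV[rat]_n)
    (alpha : 'I_n -> nat) (f : 'rV[R]_n -> R) : 'rV[R]_n -> R :=
  foldr (fun i g => iter (alpha i) (pderiv r i) g) f (enum 'I_n).

(** The Taylor series at [a] of a function on the box, as the family of its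
    coefficients indexed by multi-indices. *)
Definition taylor (R : realType) (n : nat) (r : 'rV[rat]_n)
    (f : 'rV[R]_n -> R) (a : 'rV[R]_n) : ('I_n -> nat) -> R :=
  fun alpha => mpderiv r alpha f a / (\prod_i (alpha i)`!)%N%:R.

Definition IF_condition (R : realType) (m : nat) (r : 'rV[rat]_m) (s : rat)
    (f : 'rV[R]_m.+1 -> R) : Prop :=
  exists2 sigma : R, sigma = 1 \/ sigma = -1 &
    (forall z, box (snoc r s) z -> 0 < sigma * pderiv (snoc r s) ord_max f z) /\
    (forall x, box r x ->
       sigma * f (snoc x (- ratr s)) < 0 /\ 0 < sigma * f (snoc x (ratr s))).

(** A function on [-r,r] is represented by any total function with the same
    values on [-r,r]; [C n r] is saturated for this ([ifs_ext]). Only its values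
    at r with [pos_radius r] are meaningful. *)
Definition fun_collection (R : realType) :=
  forall n : nat, 'rV[rat]_n -> set ('rV[R]_n -> R).

Record if_system (R : realType) (C : fun_collection R) : Prop := IFSystem {
  ifs_ext : forall n (r : 'rV[rat]_n) f g, pos_radius r ->
    (forall x, box r x -> f x = g x) -> C n r f -> C n r g;
  ifs_smooth : forall n (r : 'rV[rat]_n) f, pos_radius r ->
    C n r f -> smooth_on (box r) f;
  ifs_field : GRing.divring_closed [pred c : R | cst c \in C 0%N 0];
  ifs_ring : forall n (r : 'rV[rat]_n), (0 < n)%N -> pos_radius r ->
    [/\ C n r (cst 1),
        (forall f g, C n r f -> C n r g -> C n r (f \- g)) &
        (forall f g, C n r f -> C n r g -> C n r (f \* g))];
  ifs_coord : forall n (r : 'rV[rat]_n) (i : 'I_n), (0 < n)%N -> pos_radius r ->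
    C n r (fun x => x 0 i);
  ifs_extend : forall n (r : 'rV[rat]_n) f, (0 < n)%N -> pos_radius r ->
    C n r f ->
    exists (s : 'rV[rat]_n) (g : 'rV[R]_n -> R),
      [/\ forall i, r 0 i < s 0 i, C n s g & forall x, box r x -> f x = g x];
  ifs_comp : forall m n (r : 'rV[rat]_m) (s : 'rV[rat]_n)
      (g : 'I_n -> 'rV[R]_m -> R) (f : 'rV[R]_n -> R),
    pos_radius r -> pos_radius s ->
    (forall i, C m r (g i)) ->
    (forall x, box r x -> box s (\row_i g i x)) ->
    C n s f -> C m r (fun x => f (\row_i g i x));
  ifs_div : forall m (r : 'rV[rat]_m.+1) (f : 'rV[R]_m.+1 -> R),
    pos_radius r -> C m.+1 r f ->
    (forall x, box r x -> x 0 ord_max = 0 -> f x = 0) ->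
    exists2 g, C m.+1 r g & forall x, box r x -> f x = x 0 ord_max * g x;
  ifs_implicit : forall m (r : 'rV[rat]_m) (s : rat) (f : 'rV[R]_m.+1 -> R)
      (g : 'rV[R]_m -> R),
    pos_radius r -> 0 < s -> C m.+1 (snoc r s) f -> IF_condition r s f ->
    (forall x, box r x -> - ratr s < g x < ratr s /\ f (snoc x (g x)) = 0) ->
    C m r g }.

Definition quasianalytic (R : realType) (C : fun_collection R) : Prop :=
  forall n (r : 'rV[rat]_n) (a : 'rV[R]_n), (0 < n)%N -> pos_radius r -> box r a ->
  forall f g, C n r f -> C n r g -> taylor r f a = taylor r g a ->
  forall x, box r x -> f x = g x.

Record ifs_symbol (R : realType) (C : fun_collection R) := IfsSymbol {
  sym_dim : nat;
  sym_radius : 'rV[rat]_sym_dim;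
  sym_fun : 'rV[R]_sym_dim -> R;
  sym_pos : pos_radius sym_radius;
  sym_mem : C sym_dim sym_radius sym_fun }.

Definition ifs_signature (R : realType) (C : fun_collection R) : signature :=
  @Signature (ifs_symbol C) (@sym_dim R C) void (fun p => match p with end).

(** R_C: the symbol of f is interpreted by f on its box and by 0 elsewhere. *)
Definition ifs_expansion (R : realType) (C : fun_collection R) : expansion R :=
  @Expansion R (ifs_signature C)
    (fun f : ifs_symbol C => @sym_fun R C f \_ (box (@sym_radius R C f)))
    (fun p : void => match p with end).

(* Main.v *)
Require Import Defs.
From HB Require Import structures.
From mathcomp Require Import ring lra.
From mathcomp Require finmap.
Set Implicit Arguments.
Unset Strict Implicit.
Unset Printing Implicit Defensive.
Import Order.TTheory GRing.Theory Num.Theory.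
Local Open Scope classical_set_scope.
Local Open Scope ring_scope.

(** The IF-system [Csys E] consists of the functions on [-r, r] that extend to
    a function 0-definable in [E] and smooth on a larger open rational box.

    It is an IF-system ([Csys_if_system]).  Each operation is carried out on
    the extensions, on an open set containing the compact box [-r, r]; by
    compactness this open set contains a larger rational box ([box_thicken]).
    Implicit functions are monotone roots, and their derivatives are given by
    the usual quotient ([implicit_smooth]).  Division by the last coordinate
    is Hadamard's formula
      f(x, y) = y * int_0^1 (D_y f)(x, t y) dt   if f(x, 0) = 0
    ([hadamard]).

    It is quasianalytic ([Csys_quasianalytic]).  A definable function u of one
    variable that is flat at 0 vanishes on some (0, e): otherwise o-minimality
    gives an interval (0, e) without zeros of u, and 1 / |u(1/t)| is definable
    and grows faster than every power of t ([flat_zero]).  Being flat is thus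
    an open and closed condition along a segment ([line_propagation]).  In
    several variables the coordinates are released one at a time: the
    derivatives along the first coordinate are the outermost ones in
    [mpderiv], so if all Taylor coefficients at a vanish, then all derivatives
    in the other variables vanish on the line through a along the first
    coordinate, and one continues with the second coordinate ([peel]).

    It has the same 0-definable sets as [E].  The symbols of R_C are clearly
    0-definable in [E].  For the converse, let A be a subset of R^m that is
    0-definable in [E]; one argues by strong induction on m
    ([definable_ifs]).  The map t / (1 + |t|) reduces to A bounded.  Then the
    closure of A and the boundary K of A are compact, and A is the union of
    A /\ K and of the complement of K in the closure.  By uniformization,
    every compact 0-definable set is the image of a compact d-dimensional
    manifold M under a smooth map f.  Near each of its points M is the graph
    of a smooth function of d of the coordinates ([graph_chart]), and over a
    rational box this function is 0-definable, since M is; so f(M) is a finite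
    union of images of rational boxes of dimension d under maps with
    components in C ([cover_image]).  Hence compact 0-definable sets are
    0-definable in R_C.  Finally K contains no cube: each fibre of A in the
    last variable is constant on a short rational interval, and by the Baire
    property the same interval works on a whole cube of parameters
    ([zdef_subcube]).  As m-cells have interior, d < m for K, and A /\ K is
    the image of 0-definable subsets of boxes in R^d, to which the induction
    hypothesis applies. *)

(** * Mean value theorem and chain rule in several variables *)

Section RowSpace.
Variable R : realType.

Lemma row_nbhsP n (x : 'rV[R]_n) (A : set 'rV[R]_n) :
  nbhs x A <-> exists2 e : R, 0 < e &
    forall y : 'rV[R]_n, (forall i, `|y 0 i - x 0 i| < e) -> A y.
Proof.
split.
- move/nbhs_ballP => [e /= e0 xA]; exists e => // y yx; apply: xA.
  split => // i j; rewrite ord1 /ball /= distrC; exact: yx.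
- move=> [e e0 xA]; apply/nbhs_ballP; exists e => //= y [_ yx]; apply: xA => i.
  by have := yx 0 i; rewrite /ball /= distrC.
Qed.

Lemma row_openP n (U : set 'rV[R]_n) :
  open U <-> forall x, U x -> exists2 e : R, 0 < e &
    forall y : 'rV[R]_n, (forall i, `|y 0 i - x 0 i| < e) -> U y.
Proof.
by rewrite openE; split => oU x Ux; have := oU x Ux; rewrite /interior /= row_nbhsP.
Qed.

Lemma row_contP n (f : 'rV[R]_n -> R) x : {for x, continuous f} <->
  forall e : R, 0 < e -> exists2 d : R, 0 < d &
    forall y : 'rV[R]_n, (forall i, `|y 0 i - x 0 i| < d) -> `|f y - f x| < e.
Proof.
rewrite /prop_for /continuous_at; split.
- move=> /cvgrPdist_lt fx e e0; have /row_nbhsP[d d0 dP] := fx _ e0.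
  by exists d => // y yx; rewrite distrC; exact: dP.
- move=> fx; apply: (iffRL (@cvgrPdist_lt _ _ _ (nbhs x) _ _ _)) => e e0; have [d d0 dP] := fx _ e0.
  by apply/row_nbhsP; exists d => // y yx; rewrite distrC; exact: dP.
Qed.

Lemma is_derive_line (V : normedModType R) (f : V -> R) (p v : V) (t : R) :
  derivable f (t *: v + p) v ->
  is_derive t 1 (fun s : R => f (s *: v + p)) ('D_v f (t *: v + p)).
Proof.
move=> df.
have E : (fun h : R => h^-1 *: (f ((h *: (1 : R) + t) *: v + p) - f (t *: v + p))) =
         (fun h : R => h^-1 *: (f (h *: v + (t *: v + p)) - f (t *: v + p))).
  apply/funext => h; congr (_ *: (f _ - _)).
  by rewrite scaler1 scalerDl addrA.
by split; rewrite /derivable /derive /shift /= /comp /= E.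
Qed.

(** The intermediate point is located between the end points, because in the
    applications differentiability is only known there. *)
Lemma line_mvt (V : normedModType R) (f : V -> R) (p v : V) (c : R) :
  (forall s : R, Num.min 0 c <= s <= Num.max 0 c -> derivable f (s *: v + p) v) ->
  exists2 s : R, Num.min 0 c <= s <= Num.max 0 c &
    f (c *: v + p) - f p = 'D_v f (s *: v + p) * c.
Proof.
set a := Num.min 0 c; set b := Num.max 0 c => df.
set phi := fun s : R => f (s *: v + p).
have dphi (s : R) : a <= s <= b -> is_derive s (1 : R) phi ('D_v f (s *: v + p)).
  by move=> sc; apply: is_derive_line; exact: df.
have cphi : {within `[a, b], continuous phi}.
  apply: derivable_within_continuous => s; rewrite in_itv /= => /dphi H.
  exact: ex_derive.
have ab : a <= b by rewrite /a /b; case: (ltgtP 0 c) => // /ltW.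
have [s|s sab E] := @MVT_segment _ phi (fun s => 'D_v f (s *: v + p)) a b ab _ cphi.
  by rewrite in_itv /= => /andP[as_ sb]; apply: dphi; rewrite !ltW.
have phi0 : phi 0 = f p by rewrite /phi scale0r add0r.
exists s; first by move: sab; rewrite in_itv.
move: E; rewrite /a /b; case: (ltgtP 0 c) => c0 E.
- by rewrite phi0 subr0 in E.
- by rewrite phi0 sub0r mulrN in E; rewrite -[RHS]opprK -E opprB.
- by rewrite -c0 mulr0 scale0r add0r subrr.
Qed.

(** One moves from x to y by changing one coordinate at a time, and applies
    the one-variable theorem to each step; all the steps take place in the box
    spanned by x and y.  This is the only form of differentiability used for
    functions of several variables. *)
Lemma partial_mvt n (f : 'rV[R]_n -> R) (x y : 'rV[R]_n) :
  (forall z : 'rV[R]_n, (forall i, `|z 0 i - x 0 i| <= `|y 0 i - x 0 i|) ->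
     forall i, derivable f z ('e_i)) ->
  exists2 xi : 'I_n -> 'rV[R]_n,
    (forall i k, `|xi i 0 k - x 0 k| <= `|y 0 k - x 0 k|) &
    f y - f x = \sum_i 'D_('e_i) f (xi i) * (y 0 i - x 0 i).
Proof.
move=> df.
pose p (k : nat) : 'rV[R]_n := \row_i (if (i < k)%N then y 0 i else x 0 i).
have step (k : 'I_n) : exists2 z : 'rV[R]_n, (forall i, `|z 0 i - x 0 i| <= `|y 0 i - x 0 i|) &
    f (p k.+1) - f (p k) = 'D_('e_k) f z * (y 0 k - x 0 k).
  have pk (s : R) : Num.min 0 (y 0 k - x 0 k) <= s <= Num.max 0 (y 0 k - x 0 k) ->
    forall i, `|(s *: 'e_k + p k) 0 i - x 0 i| <= `|y 0 i - x 0 i|.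
    move=> sy i; rewrite !mxE eqxx /=; have [->|ik] := eqVneq i k.
      rewrite ltnn mulr1 addrK; move: sy; case: (leP 0 (y 0 k - x 0 k)) => yx /andP[s1 s2].
        by rewrite !ger0_norm.
      by rewrite !ler0_norm ?lerN2// ltW.
    by rewrite mulr0 add0r; case: ifP => // _; rewrite subrr normr0.
  have -> : p k.+1 = (y 0 k - x 0 k) *: 'e_k + p k.
    apply/rowP => i; rewrite !mxE eqxx /= ltnS leq_eqVlt.
    have [->|ik] := eqVneq i k; first by rewrite eqxx ltnn mulr1 subrK.
    by rewrite mulr0 add0r (_ : _ == _ = false)//; apply/negbTE.
  have [|s sy E] := @line_mvt _ f (p k) ('e_k) (y 0 k - x 0 k).
    by move=> s sy; apply: df; exact: pk.
  by exists (s *: 'e_k + p k) => //; exact: pk.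
have [xi xiP] := choice (fun k => let: ex_intro2 z a b := step k in ex_intro
  (fun z : 'rV[R]_n => (forall i, `|z 0 i - x 0 i| <= `|y 0 i - x 0 i|) /\
    f (p k.+1) - f (p k) = 'D_('e_k) f z * (y 0 k - x 0 k)) z (conj a b)).
exists xi; first by move=> i k; have [+ _] := xiP i; exact.
have yE : y = p n by apply/rowP => i; rewrite mxE ltn_ord.
have xE : x = p 0%N by apply/rowP => i; rewrite mxE.
have := telescope_sumr (fun k => f (p k)) (leq0n n).
rewrite -yE -xE big_mkord => <-; apply: eq_bigr => i _.
by have [_ ->] := xiP i.
Qed.

Lemma derivable_cvg (V : normedModType R) (f : V -> R) x v :
  derivable f x v -> f (h *: v + x) @[h --> (0 : R)^'] --> f x.
Proof.
move=> df.
have H : (h : R) * (h^-1 *: (f (h *: v + x) - f x)) @[h --> (0 : R)^'] --> 0 * 'D_v f x.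
  by apply: cvgM df; apply: cvg_within; exact: cvg_id.
rewrite mul0r in H.
have H2 : (h : R) * (h^-1 *: (f (h *: v + x) - f x)) + f x @[h --> (0 : R)^'] --> 0 + f x.
  by apply: cvgD H _; exact: cvg_cst.
rewrite add0r in H2.
apply: cvg_trans H2; apply: near_eq_cvg; near=> h.
have h0 : h != 0 by near: h; exact: nbhs_dnbhs_neq.
by rewrite /GRing.scale /= mulrA mulfV// mul1r subrK.
Unshelve. all: by end_near.
Qed.

(** By [partial_mvt] the increment of f o g is a combination of the increments
    of the components of g, whose coefficients are partial derivatives of f at
    points converging to g x. *)
Lemma chain_rule (V : normedModType R) n (f : 'rV[R]_n -> R) (g : V -> 'rV[R]_n)
    (x v : V) (l : 'I_n -> R) :
  (\forall z \near g x, forall i, derivable f z ('e_i)) ->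
  (forall i, {for g x, continuous ('D_('e_i) f)}) ->
  (forall i, is_derive x v (fun z => g z 0 i) (l i)) ->
  is_derive x v (fun z => f (g z)) (\sum_i 'D_('e_i) f (g x) * l i).
Proof.
move=> /row_nbhsP[e e0 df] cf dg.
have gc i : g (h *: v + x) 0 i @[h --> (0 : R)^'] --> g x 0 i.
  by apply: (derivable_cvg (f := fun z => g z 0 i)); exact: ex_derive.
have gnear : \forall h \near (0 : R)^', forall i, `|g (h *: v + x) 0 i - g x 0 i| < e.
  apply: filter_forall => i.
  by have /cvgrPdist_lt/(_ _ e0) := gc i; apply: filterS => h /=; rewrite distrC.
have ex h : exists xi : 'I_n -> 'rV[R]_n,
    (forall i, `|g (h *: v + x) 0 i - g x 0 i| < e) ->
    (forall i k, `|xi i 0 k - g x 0 k| <= `|g (h *: v + x) 0 k - g x 0 k|) /\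
    f (g (h *: v + x)) - f (g x) =
      \sum_i 'D_('e_i) f (xi i) * (g (h *: v + x) 0 i - g x 0 i).
  have [H|] := pselect (forall i, `|g (h *: v + x) 0 i - g x 0 i| < e); last first.
    by move=> nH; exists (fun _ => 0) => /nH.
  have [z zP i|xi xi1 xi2] := @partial_mvt n f (g x) (g (h *: v + x)).
    by apply: df => k; apply: le_lt_trans (zP k) _.
  by exists xi.
have [xi xiP] := choice ex.
have main : h^-1 *: (f (g (h *: v + x)) - f (g x)) @[h --> (0 : R)^'] -->
    \sum_i 'D_('e_i) f (g x) * l i.
  have H : (\sum_i 'D_('e_i) f (xi h i) *
              (h^-1 *: (g (h *: v + x) 0 i - g x 0 i))) @[h --> (0 : R)^'] -->
    \sum_i 'D_('e_i) f (g x) * l i.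
    apply: cvg_big => [|i _]; first exact: add_continuous.
    apply: cvgM; last first.
      have [d1 d2] := dg i; rewrite -d2; exact: d1.
    apply/cvgrPdist_lt => r r0.
    have /row_contP/(_ _ r0)[d d0 dP] := cf i.
    have gd : \forall h \near (0 : R)^', forall i, `|g (h *: v + x) 0 i - g x 0 i| < d.
      apply: filter_forall => j.
      by have /cvgrPdist_lt/(_ _ d0) := gc j; apply: filterS => h /=; rewrite distrC.
    near=> h.
    have he : forall i, `|g (h *: v + x) 0 i - g x 0 i| < e by near: h.
    have hd : forall i, `|g (h *: v + x) 0 i - g x 0 i| < d by near: h.
    have [xi1 _] := xiP h he.
    by rewrite distrC; apply: dP => k; apply: le_lt_trans (xi1 i k) _.
  apply: cvg_trans H; apply: near_eq_cvg; near=> h.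
  have he : forall i, `|g (h *: v + x) 0 i - g x 0 i| < e by near: h.
  have [_ ->] := xiP h he.
  rewrite scaler_sumr; apply: eq_bigr => i _.
  by rewrite /GRing.scale /= mulrCA.
split; first by apply/cvg_ex; eexists; exact: main.
by apply/cvg_lim => //; exact: main.
Unshelve. all: by end_near.
Qed.

End RowSpace.

(** * Functions of class C^k on open sets *)

Section Smooth.
Variable R : realType.

Lemma open_near (T : topologicalType) (U : set T) (P : T -> Prop) x :
  open U -> U x -> (forall z, U z -> P z) -> \forall z \near x, P z.
Proof.
by move=> oU Ux UP; exact: (filterS UP (open_nbhs_nbhs (conj oU Ux))).
Qed.

Lemma near_row_forall n (I : finType) (x : 'rV[R]_n) (P : I -> 'rV[R]_n -> Prop) :
  (forall i, exists2 e : R, 0 < e & forall y : 'rV[R]_n, (forall k, `|y 0 k - x 0 k| < e) -> P i y) ->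
  exists2 e : R, 0 < e & forall y : 'rV[R]_n, (forall k, `|y 0 k - x 0 k| < e) -> forall i, P i y.
Proof.
move=> H; apply/(row_nbhsP x [set y | forall i, P i y]).
by apply: (@filter_forall _ _ P (nbhs x) _) => i; apply/(row_nbhsP x (P i)).
Qed.

Definition cube n (x : 'rV[R]_n) (e : R) : set 'rV[R]_n := [set y | forall i, `|y 0 i - x 0 i| < e].

Lemma cube_open n (x : 'rV[R]_n) e : open (cube x e).
Proof.
apply/row_openP => y ye.
apply: (near_row_forall (P := fun i (z : 'rV[R]_n) => `|z 0 i - x 0 i| < e)) => i.
exists (e - `|y 0 i - x 0 i|); first by rewrite subr_gt0; exact: ye.
move=> z /(_ i); rewrite ltrBrDr; apply: le_lt_trans.
by rewrite -(subrKA (y 0 i)) ler_normD.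
Qed.

Lemma cube_center n (x : 'rV[R]_n) e : 0 < e -> cube x e x.
Proof. by move=> e0 i; rewrite subrr normr0. Qed.

Lemma cube_sub n (x : 'rV[R]_n) e d : d <= e -> cube x d `<=` cube x e.
Proof. by move=> de y yx i; apply: lt_le_trans (yx i) de. Qed.

Lemma Ck_subset n k (U V : set 'rV[R]_n) f : V `<=` U -> Ck k U f -> Ck k V f.
Proof.
elim: k f => [|k IH] f VU /=; first by move=> cf x /VU /cf.
by move=> cf i; have [df ck] := cf i; split; [move=> x /VU /df|exact: IH].
Qed.

Lemma Ck_ext n k (U : set 'rV[R]_n) f g : open U ->
  (forall x, U x -> f x = g x) -> Ck k U f -> Ck k U g.
Proof.
move=> oU; elim: k f g => [|k IH] f g fg /=.
  move=> cf x Ux; apply/row_contP => e e0.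
  have /row_contP/(_ _ e0)[d d0 dP] := cf x Ux.
  have [r r0 rU] := (row_openP U).1 oU x Ux.
  exists (Num.min d r); first by rewrite lt_min d0.
  move=> y yx; rewrite -!fg//; last first.
    by apply: rU => i; have := yx i; rewrite lt_min => /andP[].
  by apply: dP => i; have := yx i; rewrite lt_min => /andP[].
move=> cf i; have [df ck] := cf i.
have nfg x : U x -> \forall z \near x, f z = g z.
  by move=> Ux; apply: (open_near oU Ux) => z /fg.
split=> [x Ux|]; first by apply: near_eq_derivable (df x Ux); exact: nfg.
by apply: IH ck => x Ux; apply: near_eq_derive; exact: nfg.
Qed.

Lemma Ck_local n k (U : set 'rV[R]_n) f :
  (forall x, U x -> exists V, [/\ open V, V x & Ck k V f]) -> Ck k U f.
Proof.
elim: k f => [|k IH] f H /=.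
  by move=> x Ux; have [V [_ Vx]] := H x Ux; exact.
move=> i; split=> [x Ux|].
  by have [V [_ Vx /(_ i)[+ _]]] := H x Ux; exact.
by apply: IH => x Ux; have [V [oV Vx /(_ i)[_ ?]]] := H x Ux; exists V.
Qed.

(** The closure properties of C^k below are inductions on k through this
    lemma: it suffices to exhibit the partial derivatives as C^k functions. *)
Lemma CkS_intro n k (U : set 'rV[R]_n) f (D : 'I_n -> 'rV[R]_n -> R) : open U ->
  (forall i x, U x -> is_derive x ('e_i) f (D i x)) ->
  (forall i, Ck k U (D i)) -> Ck k.+1 U f.
Proof.
move=> oU df cD i; split=> [x /(df i)[]//|].
by apply: Ck_ext (cD i) => // x /(df i) [_ ->].
Qed.

(** The partial derivatives are bounded near x, so f is Lipschitz there by
    [partial_mvt]. *)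
Lemma C1_continuous n (U : set 'rV[R]_n) (f : 'rV[R]_n -> R) x : open U -> U x ->
  (forall i (z : 'rV[R]_n), U z -> derivable f z ('e_i)) ->
  (forall i, {for x, continuous ('D_('e_i) f)}) -> {for x, continuous f}.
Proof.
move=> /row_openP oU Ux df cD; have [d d0 dU] := oU x Ux.
have [r r0 rP] : exists2 r : R, 0 < r & forall z : 'rV[R]_n, (forall k, `|z 0 k - x 0 k| < r) ->
    forall i, `|'D_('e_i) f z| < `|'D_('e_i) f x| + 1.
  apply: near_row_forall => i; have /row_contP/(_ _ ltr01)[r r0 rP] := cD i.
  exists r => // z /rP H.
  by rewrite -ltrBlDl; apply: le_lt_trans H; exact: lerB_dist.
pose S := \sum_i (`|'D_('e_i) f x| + 1) + 1.
have S0 : 0 < S by apply: ltr_wpDl => //; apply: sumr_ge0 => i _; apply: addr_ge0.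
(* S bounds the sum of the partial derivatives near x *)
apply/row_contP => e e0; exists (Num.min d (Num.min r (e / S))).
  by rewrite !lt_min d0 r0 divr_gt0.
move=> y yx; have yd i : `|y 0 i - x 0 i| < d.
  by have := yx i; rewrite !lt_min => /and3P[].
have [z zP i|xi xi1 ->] := @partial_mvt _ _ f x y.
  by apply: df; apply: dU => k; apply: le_lt_trans (zP k) _.
apply: le_lt_trans (ler_norm_sum _ _ _) _.
have yS i : `|y 0 i - x 0 i| <= e / S.
  by have := yx i; rewrite !lt_min => /and3P[_ _ /ltW].
apply: (@le_lt_trans _ _ (\sum_i (`|'D_('e_i) f x| + 1) * (e / S))).
  apply: ler_sum => i _; rewrite normrM; apply: ler_pM => //; apply: ltW; apply: rP => k.
  by apply: le_lt_trans (xi1 i k) _; have := yx k; rewrite !lt_min => /and3P[].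
rewrite -mulr_suml mulrA ltr_pdivrMr// mulrC ltr_pM2l// /S ltrDl.
exact: ltr01.
Qed.

Lemma CkS n k (U : set 'rV[R]_n) f : open U -> Ck k.+1 U f -> Ck k U f.
Proof.
move=> oU; elim: k f => [|k IH] f cf.
  move=> x Ux; apply: (C1_continuous oU Ux).
    by move=> i z Uz; have [+ _] := cf i; exact.
  by move=> i; have [_ +] := cf i; exact.
by move=> i; have [df ck] := cf i; split => //; exact: IH.
Qed.

Lemma Ck_continuous n k (U : set 'rV[R]_n) f x : open U -> Ck k U f -> U x ->
  {for x, continuous f}.
Proof.
move=> oU; elim: k f => [|k IH] f; first by move=> + Ux => /(_ x Ux).
by move=> /(CkS oU) /IH; exact.
Qed.

Lemma Ck_cst n k (U : set 'rV[R]_n) (c : R) : Ck k U (cst c).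
Proof.
elim: k c => [|k IH] c /=; first by move=> x _; exact: cst_continuous.
move=> i; split=> [x _|]; first exact: derivable_cst.
have -> : (fun x => 'D_('e_i) (cst c) x) = cst 0 :> ('rV[R]_n -> R).
  by apply/funext => x; rewrite derive_cst.
exact: IH.
Qed.

Lemma is_derive_coord n (i : 'I_n) (x v : 'rV[R]_n) :
  is_derive x v (fun z : 'rV[R]_n => z 0 i) (v 0 i).
Proof.
have H : (h : R)^-1 *: ((fun z : 'rV[R]_n => z 0 i) (h *: v + x) - x 0 i) @[h --> 0^'] --> v 0 i.
  have : v 0 i @[h --> (0 : R)^'] --> v 0 i by exact: cvg_cst.
  apply: cvg_trans; apply: near_eq_cvg; near=> h.
  have h0 : h != 0 by near: h; exact: nbhs_dnbhs_neq.
  by rewrite !mxE addrK /GRing.scale /= mulKf.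
split; first by apply/cvg_ex; eexists; exact: H.
by apply/cvg_lim => //; exact: H.
Unshelve. all: by end_near.
Qed.

Lemma Ck_coord n k (U : set 'rV[R]_n) (i : 'I_n) : open U -> Ck k U (fun x => x 0 i).
Proof.
case: k => [|k] oU; first by move=> x _; exact: coord_continuous.
apply: (CkS_intro (D := fun j => cst (('e_j : 'rV[R]_n) 0 i))) => // [j x _|j].
  exact: is_derive_coord.
exact: Ck_cst.
Qed.

Lemma Ck_add n k (U : set 'rV[R]_n) f g : open U ->
  Ck k U f -> Ck k U g -> Ck k U (fun x => f x + g x).
Proof.
move=> oU; elim: k f g => [|k IH] f g cf cg.
  by move=> x Ux; exact: continuousD (cf x Ux) (cg x Ux).
apply: (CkS_intro (D := fun i x => 'D_('e_i) f x + 'D_('e_i) g x)) => // [i x Ux|i].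
  have [/(_ x Ux) df _] := cf i; have [/(_ x Ux) dg _] := cg i.
  by split; [exact: derivableD|exact: deriveD].
by have [_ ?] := cf i; have [_ ?] := cg i; exact: IH.
Qed.

Lemma Ck_opp n k (U : set 'rV[R]_n) f : open U ->
  Ck k U f -> Ck k U (fun x => - f x).
Proof.
move=> oU; elim: k f => [|k IH] f cf.
  by move=> x Ux; exact: continuousN (cf x Ux).
apply: (CkS_intro (D := fun i x => - 'D_('e_i) f x)) => // [i x Ux|i].
  have [/(_ x Ux) df _] := cf i.
  by split; [exact: derivableN|exact: deriveN].
by have [_ ?] := cf i; exact: IH.
Qed.

Lemma Ck_sub n k (U : set 'rV[R]_n) f g : open U ->
  Ck k U f -> Ck k U g -> Ck k U (fun x => f x - g x).
Proof. by move=> oU cf cg; apply: Ck_add => //; exact: Ck_opp. Qed.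

Lemma Ck_mul n k (U : set 'rV[R]_n) f g : open U ->
  Ck k U f -> Ck k U g -> Ck k U (fun x => f x * g x).
Proof.
move=> oU; elim: k f g => [|k IH] f g cf cg.
  by move=> x Ux; exact: continuousM (cf x Ux) (cg x Ux).
apply: (CkS_intro (D := fun i x => f x * 'D_('e_i) g x + g x * 'D_('e_i) f x)) => // [i x Ux|i].
  have [/(_ x Ux) df _] := cf i; have [/(_ x Ux) dg _] := cg i.
  by split; [exact: (derivableM df dg)|exact: (deriveM df dg)].
have [_ ?] := cf i; have [_ ?] := cg i.
by apply: Ck_add => //; apply: IH => //; exact: CkS.
Qed.

Lemma Ck_inv n k (U : set 'rV[R]_n) f : open U -> (forall x, U x -> f x != 0) ->
  Ck k U f -> Ck k U (fun x => (f x)^-1).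
Proof.
move=> oU f0; elim: k => [|k IH] cf.
  by move=> x Ux; exact: continuousV (f0 x Ux) (cf x Ux).
apply: (CkS_intro (D := fun i x => - ((f x)^-1 * (f x)^-1) * 'D_('e_i) f x)) => // [i x Ux|i].
  have [/(_ x Ux) df _] := cf i.
  split; first by apply: derivableV => //; exact: f0.
  by rewrite deriveV// ?f0// expr2 invfM.
have [_ ?] := cf i.
have IHf := IH (CkS oU cf).
by apply: Ck_mul => //; apply: Ck_opp => //; exact: Ck_mul.
Qed.

Lemma Ck_sum n k (U : set 'rV[R]_n) m (f : 'I_m -> 'rV[R]_n -> R) : open U ->
  (forall i, Ck k U (f i)) -> Ck k U (fun x => \sum_i f i x).
Proof.
move=> oU; elim: m f => [|m IH] f cf.
  apply: (Ck_ext (f := cst 0)) => // [x _|]; first by rewrite big_ord0.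
  exact: Ck_cst.
apply: (Ck_ext (f := fun x => (\sum_(i < m) f (widen_ord (leqnSn m) i) x) + f ord_max x)) => //.
  by move=> x _; rewrite big_ord_recr.
by apply: Ck_add => //; exact: IH.
Qed.

Lemma Ck_comp n m k (U : set 'rV[R]_m) (V : set 'rV[R]_n) f (g : 'I_n -> 'rV[R]_m -> R) :
  open U -> open V -> (forall x, U x -> V (\row_i g i x)) ->
  Ck k V f -> (forall i, Ck k U (g i)) -> Ck k U (fun x => f (\row_i g i x)).
Proof.
move=> oU oV gUV; elim: k f => [|k IH] f cf cg.
  move=> x Ux; apply/row_contP => e e0.
  have /row_contP/(_ _ e0)[d d0 dP] := cf _ (gUV x Ux).
  have [r r0 rP] : exists2 r : R, 0 < r & forall z : 'rV[R]_m, (forall k, `|z 0 k - x 0 k| < r) ->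
    forall i, `|g i z - g i x| < d.
    by apply: near_row_forall => i; have /row_contP/(_ _ d0) := cg i x Ux.
  exists r => // y /rP H; apply: dP => i.
  by rewrite !mxE; exact: H.
have gE i : (fun z => (\row_i g i z) 0 i) = g i by apply/funext => z; rewrite mxE.
apply: (CkS_intro (D := fun j x => \sum_i 'D_('e_i) f (\row_i g i x) * 'D_('e_j) (g i) x)) => // [j x Ux|j].
  apply: chain_rule.
  - apply: (open_near oV (gUV x Ux)) => z Vz i.
    by have [+ _] := cf i; exact.
  - move=> i; have [_ ck] := cf i; apply: (Ck_continuous oV ck); exact: gUV.
  - by move=> i; rewrite gE; apply/derivableP; have [+ _] := cg i j; exact.
apply: Ck_sum => // i; apply: Ck_mul => //.
  by apply: (IH (fun x => 'D_('e_i) f x)) => [|l]; [have [_ +] := cf i|exact: CkS].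
by have [_ +] := cg i j.
Qed.

Definition smooth n (U : set 'rV[R]_n) f := forall k, Ck k U f.

Lemma smooth_derive n (U : set 'rV[R]_n) f i : smooth U f -> smooth U ('D_('e_i) f).
Proof. by move=> sf k; have [_ +] := sf k.+1 i. Qed.

Lemma smooth_derivable n (U : set 'rV[R]_n) (f : 'rV[R]_n -> R) i x : smooth U f -> U x ->
  derivable f x ('e_i).
Proof. by move=> sf; have [+ _] := sf 1%N i; exact. Qed.

Lemma smooth_continuous n (U : set 'rV[R]_n) f x : open U -> smooth U f -> U x ->
  {for x, continuous f}.
Proof. by move=> oU sf; exact: (Ck_continuous oU (sf 0%N)). Qed.

Lemma row_cont_open n (U : set 'rV[R]_n) m (g : 'rV[R]_n -> 'rV[R]_m) (V : set 'rV[R]_m) :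
  open U -> open V -> (forall i x, U x -> {for x, continuous (fun z => g z 0 i)}) ->
  open [set x | U x /\ V (g x)].
Proof.
move=> oU oV cg; rewrite openE => x [Ux Vx].
move/row_openP: oV => /(_ _ Vx)[d d0 dV].
have [r r0 rP] : exists2 r : R, 0 < r & forall z : 'rV[R]_n, (forall k, `|z 0 k - x 0 k| < r) ->
    forall i, `|g z 0 i - g x 0 i| < d.
  by apply: near_row_forall => i; have /row_contP/(_ _ d0) := cg i x Ux.
have H : nbhs x [set z | V (g z)].
  by apply/row_nbhsP; exists r => // z /rP H; exact: dV.
by apply: filterS2 H (open_nbhs_nbhs (conj oU Ux)).
Qed.

Lemma real_cont_open n (U : set 'rV[R]_n) (g : 'rV[R]_n -> R) (a b : R) :
  open U -> (forall x, U x -> {for x, continuous g}) ->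
  open [set x | U x /\ a < g x < b].
Proof.
move=> oU cg; rewrite openE => x [Ux /andP[ax xb]].
have e0 : 0 < Num.min (g x - a) (b - g x) by rewrite lt_min !subr_gt0 ax xb.
have /row_contP/(_ _ e0)[r r0 rP] := cg x Ux.
have H : nbhs x [set z | a < g z < b].
  apply/row_nbhsP; exists r => // z /rP; rewrite lt_min /= !ltr_norml.
  by move=> /andP[/andP[]]; lra.
by move: H (open_nbhs_nbhs (conj oU Ux)); apply: filterS2 => z H Uz.
Qed.

(** Stated relatively to U since the functions are total, but only meaningful
    on U. *)
Lemma real_cont_open_gt n (U : set 'rV[R]_n) (g : 'rV[R]_n -> R) (a : R) :
  open U -> (forall x, U x -> {for x, continuous g}) ->
  open [set x | U x /\ a < g x].
Proof.
move=> oU cg; rewrite openE => x [Ux ax].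
have e0 : 0 < g x - a by rewrite subr_gt0 ax.
have /row_contP/(_ _ e0)[r r0 rP] := cg x Ux.
have H : nbhs x [set z | a < g z].
  by apply/row_nbhsP; exists r => // z /rP; rewrite /= ltr_norml; lra.
by move: H (open_nbhs_nbhs (conj oU Ux)); apply: filterS2 => z H Uz.
Qed.

End Smooth.

(** * Implicit functions of one real variable with parameters *)

Section Snoc.
Variable T : Type.

Lemma snoc_last n (v : 'rV[T]_n) y : snoc v y 0 ord_max = y.
Proof. by rewrite mxE unlift_none. Qed.

Lemma snoc_lift n (v : 'rV[T]_n) y j : snoc v y 0 (lift ord_max j) = v 0 j.
Proof. by rewrite mxE liftK. Qed.

(** Together with the last coordinate, the inverse of [snoc]. *)
Definition rinit n (z : 'rV[T]_n.+1) : 'rV[T]_n := \row_j z 0 (lift ord_max j).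

Lemma rinitK n (z : 'rV[T]_n.+1) : snoc (rinit z) (z 0 ord_max) = z.
Proof. by apply/rowP => i; rewrite mxE; case: unliftP => [j|] ->//; rewrite mxE. Qed.

Lemma rinit_snoc n (v : 'rV[T]_n) y : rinit (snoc v y) = v.
Proof. by apply/rowP => i; rewrite mxE snoc_lift. Qed.

Lemma ord_snocP n (P : 'I_n.+1 -> Prop) :
  P ord_max -> (forall j, P (lift ord_max j)) -> forall i, P i.
Proof. by move=> Pm Pl i; case: (unliftP ord_max i) => [j ->|->]. Qed.

End Snoc.

Section Implicit.
Variable R : realType.

Lemma sum_snoc n (F : 'I_n.+1 -> R) :
  \sum_i F i = \sum_j F (lift ord_max j) + F ord_max.
Proof.
rewrite big_ord_recr; congr (_ + _); apply: eq_bigr => i _; congr F.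
by apply: val_inj; rewrite /= /bump leqNgt ltn_ord.
Qed.

Lemma snoc_addlast n (x : 'rV[R]_n) (a b : R) :
  snoc x b = (b - a) *: 'e_ord_max + snoc x a.
Proof.
apply/rowP; apply: ord_snocP => [|j].
  by rewrite !mxE unlift_none !eqxx mulr1 subrK.
by rewrite !mxE liftK eqxx /= eq_sym (negbTE (neq_lift _ _)) mulr0 add0r.
Qed.

Lemma snoc_row n m (g : 'rV[R]_m -> 'rV[R]_n) (h : 'rV[R]_m -> R) x :
  snoc (g x) (h x) =
  \row_i (fun i z => if unlift ord_max i is Some j then g z 0 j else h z) i x.
Proof. by apply/rowP => i; rewrite !mxE; case: unlift. Qed.

Lemma Ck_snoc n m k (U : set 'rV[R]_m) (V : set 'rV[R]_n.+1) f
    (g : 'rV[R]_m -> 'rV[R]_n) (h : 'rV[R]_m -> R) :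
  open U -> open V -> (forall x, U x -> V (snoc (g x) (h x))) -> Ck k V f ->
  (forall i, Ck k U (fun z => g z 0 i)) -> Ck k U h ->
  Ck k U (fun x => f (snoc (g x) (h x))).
Proof.
move=> oU oV UV cf cg ch.
pose G i z := if @unlift n.+1 ord_max i is Some j then g z 0 j else h z.
have GE x : snoc (g x) (h x) = \row_i G i x by exact: snoc_row.
apply: (Ck_ext (f := fun x => f (\row_i G i x))) => //.
apply: (Ck_comp oU oV) => // i.
by rewrite /G; case: unlift.
Qed.

Section ImplicitCore.
Variables (n : nat) (V : set 'rV[R]_n) (O : set 'rV[R]_n.+1)
  (F : 'rV[R]_n.+1 -> R) (c d : R).
Hypotheses (oV : open V) (oO : open O) (sF : smooth O F) (cd : c < d).
Hypothesis VO : forall x y, V x -> c <= y <= d -> O (snoc x y).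
Hypothesis dF : forall x y, V x -> c <= y <= d -> 0 < 'D_('e_ord_max) F (snoc x y).
Hypothesis Fcd : forall x, V x -> F (snoc x c) < 0 < F (snoc x d).

Lemma implicit_mono x y1 y2 : V x -> c <= y1 -> y1 < y2 -> y2 <= d ->
  F (snoc x y1) < F (snoc x y2).
Proof.
move=> Vx cy y12 yd.
have bet s : Num.min 0 (y2 - y1) <= s <= Num.max 0 (y2 - y1) -> c <= s + y1 <= d.
  have y0 : 0 <= y2 - y1 by lra.
  by rewrite min_l// max_r// => /andP[s1 s2]; lra.
have E s : s *: 'e_ord_max + snoc x y1 = snoc x (s + y1).
  by rewrite (snoc_addlast x y1 (s + y1)) addrK.
have [s /bet sy|s sy] := @line_mvt _ _ F (snoc x y1) ('e_ord_max) (y2 - y1).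
  by rewrite E; apply: smooth_derivable sF _; exact: VO.
rewrite -snoc_addlast E => H; rewrite -subr_gt0 H mulr_gt0 ?subr_gt0//.
by apply: dF => //; exact: bet.
Qed.

Lemma implicit_inj x y1 y2 : V x -> c <= y1 <= d -> c <= y2 <= d ->
  F (snoc x y1) = F (snoc x y2) -> y1 = y2.
Proof.
move=> Vx /andP[cy1 y1d] /andP[cy2 y2d] E; case: (ltgtP y1 y2) => // yy.
  by have := implicit_mono Vx cy1 yy y2d; rewrite E ltxx.
by have := implicit_mono Vx cy2 yy y1d; rewrite E ltxx.
Qed.

Lemma implicit_exists x : V x -> exists2 y, c < y < d & F (snoc x y) = 0.
Proof.
move=> Vx; have cphi : {within `[c, d], continuous (fun y => F (snoc x y))}.
  have E : (fun y => F (snoc x y)) =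
    (fun s : R => F (s *: 'e_ord_max + snoc x 0)).
    by apply/funext => s; rewrite (snoc_addlast x 0 s) subr0.
  rewrite E; apply: derivable_within_continuous => s; rewrite in_itv /= => sx.
  apply: ex_derive; apply: is_derive_line.
  rewrite -{1}[s]subr0 -snoc_addlast.
  by apply: smooth_derivable sF _; exact: VO.
have /andP[Fc Fd] := Fcd Vx.
have := @IVT _ (fun y => F (snoc x y)) c d 0 (ltW cd) cphi.
case=> [|y]; first by rewrite ge_min le_max (ltW Fc) (ltW Fd) orbT.
rewrite in_itv /= => /andP[cy yd] Fy; exists y => //.
rewrite !lt_neqAle cy yd !andbT; apply/andP; split.
  by apply: contraTneq Fc => ->; rewrite Fy ltxx.
by apply: contraTneq Fd => <-; rewrite Fy ltxx.
Qed.

Variable g : 'rV[R]_n -> R.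
Hypothesis gcd : forall x, V x -> c <= g x <= d.
Hypothesis Fg : forall x, V x -> F (snoc x (g x)) = 0.

Lemma implicit_strict x : V x -> c < g x < d.
Proof.
move=> Vx; have [y ycd Fy] := implicit_exists Vx.
rewrite (@implicit_inj x (g x) y) ?gcd//; first by case/andP: ycd => *; rewrite !ltW.
by rewrite Fg// Fy.
Qed.

Lemma snoc_continuous x y : {for x, continuous (fun z : 'rV[R]_n => snoc z y)}.
Proof.
move=> A /row_nbhsP[e e0 eA]; apply/row_nbhsP; exists e => // z zx; apply: eA.
by apply: ord_snocP => [|j]; rewrite ?snoc_last ?subrr ?normr0// !snoc_lift.
Qed.

(** F changes sign between g x - r and g x + r; it still does so over points z
    close to x, which traps g z. *)
Lemma implicit_continuous x : V x -> {for x, continuous g}.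
Proof.
move=> Vx; apply/row_contP => e e0.
have /andP[cg gd] := implicit_strict Vx.
pose r := Num.min e (Num.min (g x - c) (d - g x)) / 2.
have r0 : 0 < r by rewrite divr_gt0// !lt_min e0 !subr_gt0 cg gd.
have re : r < e.
  rewrite ltr_pdivrMr//; apply: (@le_lt_trans _ _ e); first by rewrite ge_min lexx.
  by rewrite ltr_pMr// ltr1n.
have r2 : r * 2 = Num.min e (Num.min (g x - c) (d - g x)) by rewrite divfK.
have rc : r * 2 <= g x - c by rewrite r2 !ge_min lexx orbT.
have rd : r * 2 <= d - g x by rewrite r2 !ge_min lexx !orbT.
have Fm : F (snoc x (g x - r)) < 0.
  by rewrite -(Fg Vx); apply: implicit_mono => //; lra.
have Fp : 0 < F (snoc x (g x + r)).
  by rewrite -(Fg Vx); apply: implicit_mono => //; lra.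
have cF y : c <= y <= d -> {for x, continuous (fun z => F (snoc z y))}.
  move=> ycd; apply: continuous_comp; first exact: snoc_continuous.
  by apply: (smooth_continuous oO sF); exact: VO.
have Nm : 0 < - F (snoc x (g x - r)) by rewrite oppr_gt0.
have /cF/row_contP/(_ _ Nm)[d1 d10 d1P] : c <= g x - r <= d by lra.
have /cF/row_contP/(_ _ Fp)[d2 d20 d2P] : c <= g x + r <= d by lra.
have [d3 d30 d3P] := (row_openP V).1 oV x Vx.
exists (Num.min d1 (Num.min d2 d3)); first by rewrite !lt_min d10 d20.
move=> z zx.
have Vz : V z by apply: d3P => i; have := zx i; rewrite !lt_min => /and3P[].
have /ltr_normlP[_ Hm] : `|F (snoc z (g x - r)) - F (snoc x (g x - r))| < - F (snoc x (g x - r)).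
  by apply: d1P => i; have := zx i; rewrite !lt_min => /and3P[].
have /ltr_normlP[Hp _] : `|F (snoc z (g x + r)) - F (snoc x (g x + r))| < F (snoc x (g x + r)).
  by apply: d2P => i; have := zx i; rewrite !lt_min => /and3P[].
have /andP[gz1 gz2] := gcd Vz.
have g1 : g x - r < g z.
  rewrite ltNge; apply/negP; rewrite le_eqVlt => /orP[/eqP E|H].
    by have := Fg Vz; rewrite E; lra.
  have : F (snoc z (g z)) < F (snoc z (g x - r)) by apply: implicit_mono => //; lra.
  by rewrite Fg//; lra.
have g2 : g z < g x + r.
  rewrite ltNge; apply/negP; rewrite le_eqVlt => /orP[/eqP E|H].
    by have := Fg Vz; rewrite -E; lra.
  have : F (snoc z (g x + r)) < F (snoc z (g z)) by apply: implicit_mono => //; lra.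
  by rewrite Fg//; lra.
by rewrite ltr_norml; lra.
Qed.

(** F vanishes at (x, g x) and at (x + h e_i, g (x + h e_i)); expanding the
    difference with [partial_mvt] and solving for the increment of g gives a
    quotient of partial derivatives at points converging to (x, g x). *)
Lemma implicit_is_derive i x : V x ->
  is_derive x ('e_i) g (- 'D_('e_(lift ord_max i)) F (snoc x (g x)) /
     'D_('e_ord_max) F (snoc x (g x))).
Proof.
move=> Vx.
have gx_cd := gcd Vx.
pose z0 := snoc x (g x); have Oz0 : O z0 by exact: VO.
have [e e0 eO] := (row_openP O).1 oO z0 Oz0.
pose Dy := 'D_('e_ord_max) F; pose Di := 'D_('e_(lift ord_max i)) F.
have cDy : {for z0, continuous Dy}.
  by apply: (smooth_continuous oO _ Oz0); exact: smooth_derive.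
have cDi : {for z0, continuous Di}.
  by apply: (smooth_continuous oO _ Oz0); exact: smooth_derive.
pose p (h : R) : 'rV[R]_n := h *: 'e_i + x.
have pE h j : p h 0 j = h * (j == i)%:R + x 0 j by rewrite !mxE eqxx.
have px r : 0 < r -> \forall h \near (0 : R)^', forall j, `|p h 0 j - x 0 j| < r.
  move=> r0; near=> h => j; rewrite pE addrK normrM.
  apply: (@le_lt_trans _ _ `|h|); first by case: eqP => _; rewrite ?normr1 ?normr0 ?mulr1 ?mulr0.
  by near: h; exact: dnbhs0_lt.
have pV : \forall h \near (0 : R)^', V (p h).
  have [r r0 rV] := (row_openP V).1 oV x Vx.
  by apply: filterS (px r r0) => h; exact: rV.
have gp r : 0 < r -> \forall h \near (0 : R)^', `|g (p h) - g x| < r.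
  move=> r0; have /row_contP/(_ _ r0)[s s0 sP] := implicit_continuous Vx.
  by apply: filterS (px s s0) => h; exact: sP.
have Pz r : 0 < r -> \forall h \near (0 : R)^', forall j, `|snoc (p h) (g (p h)) 0 j - z0 0 j| < r.
  move=> r0; apply: filterS2 (px r r0) (gp r r0) => h H1 H2.
  by apply: ord_snocP => [|j]; rewrite /z0 ?snoc_last// !snoc_lift.
have ex h : exists xi : 'I_n.+1 -> 'rV[R]_n.+1,
   (forall j, `|snoc (p h) (g (p h)) 0 j - z0 0 j| < e) -> V (p h) ->
   (forall j k, `|xi j 0 k - z0 0 k| <= `|snoc (p h) (g (p h)) 0 k - z0 0 k|) /\
   0 = Di (xi (lift ord_max i)) * h + Dy (xi ord_max) * (g (p h) - g x).
  have [H|] := pselect (forall j, `|snoc (p h) (g (p h)) 0 j - z0 0 j| < e); last first.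
    by move=> nH; exists (fun _ => 0) => /nH.
  have [VV|] := pselect (V (p h)); last by move=> nH; exists (fun _ => 0) => _ /nH.
  have [z zP j|xi xi1 xi2] := @partial_mvt _ _ F z0 (snoc (p h) (g (p h))).
    apply: smooth_derivable sF _; apply: eO => k; apply: le_lt_trans (zP k) _; exact: H.
  exists xi => _ _; split => //; move: xi2; rewrite !Fg// subrr => ->.
  rewrite sum_snoc /z0 !snoc_last; congr (_ + _).
  rewrite (bigD1 i)//= big1 => [|j ji]; rewrite !snoc_lift pE addrK.
    by rewrite eqxx mulr1 addr0.
  by rewrite (negbTE ji) mulr0 mulr0.
have [xi xiP] := choice ex.
have cxi (D : 'rV[R]_n.+1 -> R) j : {for z0, continuous D} ->
    D (xi h j) @[h --> (0 : R)^'] --> D z0.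
  move=> /row_contP cD; apply/cvgrPdist_lt => r r0.
  have [s s0 sP] := cD _ r0.
  have He := Pz e e0; have Hs := Pz s s0.
  near=> h.
  have he : forall j, `|snoc (p h) (g (p h)) 0 j - z0 0 j| < e by near: h.
  have hs : forall j, `|snoc (p h) (g (p h)) 0 j - z0 0 j| < s by near: h.
  have hV : V (p h) by near: h.
  have [xi1 _] := xiP h he hV.
  by rewrite distrC; apply: sP => k; apply: le_lt_trans (xi1 j k) _.
have Dy0 : Dy z0 != 0 by rewrite gt_eqF// dF.
have main : h^-1 *: (g (h *: 'e_i + x) - g x) @[h --> (0 : R)^'] --> - Di z0 / Dy z0.
  have H : - Di (xi h (lift ord_max i)) / Dy (xi h ord_max) @[h --> (0 : R)^'] --> - Di z0 / Dy z0.
    have cN : - Di (xi h (lift ord_max i)) @[h --> (0 : R)^'] --> - Di z0.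
      exact: cvgN (cxi Di (lift ord_max i) cDi).
    have cV : (Dy (xi h ord_max))^-1 @[h --> (0 : R)^'] --> (Dy z0)^-1.
      exact: cvgV Dy0 (cxi Dy ord_max cDy).
    exact: cvgM cN cV.
  have Hy : \forall h \near (0 : R)^', Dy (xi h ord_max) != 0.
    have Dpos : 0 < `|Dy z0| by rewrite normr_gt0.
    have /cvgrPdist_lt/(_ _ Dpos) := cxi Dy ord_max cDy.
    by apply: filterS => h; apply: contraTneq => ->; rewrite subr0 ltxx.
  apply: cvg_trans H; apply: near_eq_cvg.
  have He := Pz e e0.
  near=> h.
  have he : forall j, `|snoc (p h) (g (p h)) 0 j - z0 0 j| < e by near: h.
  have hV : V (p h) by near: h.
  have hy : Dy (xi h ord_max) != 0 by near: h.
  have h0 : h != 0 by near: h; exact: nbhs_dnbhs_neq.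
  have [_ /esym E] := xiP h he hV.
  rewrite /GRing.scale /= -/(p h).
  have -> : g (p h) - g x = - (Di (xi h (lift ord_max i)) * h) / Dy (xi h ord_max).
    apply: (mulfI hy); rewrite mulrCA mulfV// mulr1.
    by apply/eqP; rewrite -subr_eq0 opprK addrC E.
  by field; rewrite h0 hy.
split; first by apply/cvg_ex; eexists; exact: main.
by apply/cvg_lim => //; exact: main.
Unshelve. all: by end_near.
Qed.

(** The derivatives of g are smooth functions of (x, g x), so that g of class
    C^k implies g of class C^(k+1). *)
Lemma implicit_smooth : smooth V g.
Proof.
elim=> [|k IH]; first by move=> x Vx; exact: implicit_continuous.
apply: (CkS_intro oV (D := fun i x => - 'D_('e_(lift ord_max i)) F (snoc x (g x)) /
     'D_('e_ord_max) F (snoc x (g x)))) => [i x Vx|i].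
  exact: implicit_is_derive.
have H j : Ck k V (fun x => 'D_('e_j) F (snoc x (g x))).
  have VOg x : V x -> O (snoc x (g x)) by move=> Vx; apply: VO => //; exact: gcd.
  apply: (Ck_snoc (f := fun z => 'D_('e_j) F z) (g := fun x => x) oV oO VOg _ _ IH).
    exact: (smooth_derive j sF).
  by move=> l; exact: Ck_coord.
apply: Ck_mul => //; first by apply: Ck_opp => //; exact: H.
apply: Ck_inv => // x Vx.
by rewrite gt_eqF// dF// gcd.
Qed.

End ImplicitCore.
End Implicit.

(** * Local implicit functions, compactness and rational boxes *)

Section ImplicitLocal.
Variable R : realType.

(** On a small cube the derivative in the last variable stays positive, so F
    is negative below and positive above b over a, hence over a neighbourhood
    of a. *)
Lemma implicit_local_pos n (O : set 'rV[R]_n.+1) F a b :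
  open O -> smooth O F -> O (snoc a b) -> F (snoc a b) = 0 ->
  0 < 'D_('e_ord_max) F (snoc a b) ->
  exists (V : set 'rV[R]_n) (c d : R) (g : 'rV[R]_n -> R),
   [/\ open V, V a, c < b < d, smooth V g &
      forall x, V x -> [/\ c < g x < d, F (snoc x (g x)) = 0 &
        forall y, c <= y <= d -> O (snoc x y) /\ (F (snoc x y) = 0 -> y = g x)]].
Proof.
move=> oO sF Oab Fab dF.
pose O' := [set z | O z /\ 0 < 'D_('e_ord_max) F z].
have oO' : open O'.
  apply: real_cont_open_gt => // x Ox.
  by apply: (smooth_continuous oO _ Ox); exact: smooth_derive.
have sF' : smooth O' F by move=> k; apply: Ck_subset (sF k) => z [].
have [e e0 eO] := (row_openP O').1 oO' (snoc a b) (conj Oab dF).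
pose c := b - e / 2; pose d := b + e / 2.
have cd : c < d by rewrite /c /d; lra.
have cb : c < b by rewrite /c; lra.
have bd : b < d by rewrite /d; lra.
pose V0 := cube a e.
have V0O x y : V0 x -> c <= y <= d -> O' (snoc x y).
  move=> Vx /andP[cy yd]; apply: eO; apply: ord_snocP => [|j].
    by rewrite !snoc_last ltr_norml; rewrite /c /d in cy yd; lra.
  by rewrite !snoc_lift; exact: Vx.
have V0d x y : V0 x -> c <= y <= d -> 0 < 'D_('e_ord_max) F (snoc x y).
  by move=> Vx ycd; have [] := V0O x y Vx ycd.
have oV0 : open V0 by exact: cube_open.
have Va : V0 a by exact: cube_center.
have cF (y : R) (x : 'rV[R]_n) : c <= y <= d -> V0 x -> {for x, continuous (fun z => F (snoc z y))}.
  move=> ycd Vx; apply: continuous_comp; first exact: snoc_continuous.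
  by apply: (smooth_continuous oO' sF'); exact: V0O.
pose V1 := [set x | V0 x /\ 0 < F (snoc x d)].
have oV1 : open V1 by apply: real_cont_open_gt => // x Vx; apply: cF => //; lra.
pose V := [set x | V1 x /\ 0 < - F (snoc x c)].
have oV : open V.
  apply: (real_cont_open_gt (g := fun x => - F (snoc x c))) => // x [Vx _].
  by apply: (@continuousN _ R^o); apply: cF => //; lra.
have VV0 x : V x -> V0 x by case=> [[]].
have mono y1 y2 := @implicit_mono R n V0 O' F c d sF' V0O V0d a y1 y2 Va.
have VO x y : V x -> c <= y <= d -> O' (snoc x y) by move=> /VV0; exact: V0O.
have Vd x y : V x -> c <= y <= d -> 0 < 'D_('e_ord_max) F (snoc x y).
  by move=> /VV0; exact: V0d.
have VF x : V x -> F (snoc x c) < 0 < F (snoc x d).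
  by move=> [[_ ->]]; rewrite oppr_gt0 andbT.
have ex x : exists y, V x -> c < y < d /\ F (snoc x y) = 0.
  have [Vx|nV] := pselect (V x); last by exists 0.
  by have [y ycd Fy] := implicit_exists sF' cd VO VF Vx; exists y.
have [g gP] := choice ex.
have gcd' x : V x -> c < g x < d by move=> /gP[].
have gcd x : V x -> c <= g x <= d by move=> /gcd' /andP[? ?]; rewrite !ltW.
have Fg x : V x -> F (snoc x (g x)) = 0 by move=> /gP[].
exists V, c, d, g; split => //.
- split; first split => //; last first.
    by rewrite oppr_gt0 -Fab; apply: mono => //; lra.
  by rewrite -Fab; apply: mono => //; lra.
- by rewrite cb.
- exact: (implicit_smooth oV oO' sF' cd VO Vd VF gcd Fg).
move=> x Vx; split; [exact: gcd'|exact: Fg|move=> y ycd].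
split; first by have [] := VO x y Vx ycd.
move=> Fy; apply: (implicit_inj sF' VO Vd Vx ycd (gcd x Vx)).
by rewrite Fy Fg.
Qed.

Lemma implicit_local n (O : set 'rV[R]_n.+1) F a b :
  open O -> smooth O F -> O (snoc a b) -> F (snoc a b) = 0 ->
  'D_('e_ord_max) F (snoc a b) != 0 ->
  exists (V : set 'rV[R]_n) (c d : R) (g : 'rV[R]_n -> R),
   [/\ open V, V a, c < b < d, smooth V g &
      forall x, V x -> [/\ c < g x < d, F (snoc x (g x)) = 0 &
        forall y, c <= y <= d -> O (snoc x y) /\ (F (snoc x y) = 0 -> y = g x)]].
Proof.
move=> oO sF Oab Fab; rewrite neq_lt => /orP[] dF; last exact: implicit_local_pos.
have [|||V [c [d [g [oV Va cbd sg gP]]]]] := @implicit_local_pos n O (fun z => - F z) a b oO _ Oab.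
- by move=> k; exact: Ck_opp.
- by rewrite Fab oppr0.
- by rewrite deriveN ?oppr_gt0//; exact: smooth_derivable sF Oab.
exists V, c, d, g; split => // x Vx; have [gcd /eqP Fg gy] := gP x Vx.
split => //; first by rewrite oppr_eq0 in Fg; exact/eqP.
by move=> y /gy[Oxy H]; split => // Fxy; apply: H; rewrite Fxy oppr0.
Qed.

End ImplicitLocal.

Section Compactness.
Variable R : realType.

(** A Lebesgue number: local radii can be made uniform on a compact set. *)
Lemma compact_uniform n (K : set 'rV[R]_n) (P : 'rV[R]_n -> 'rV[R]_n -> Prop) :
  compact K ->
  (forall x, K x -> exists2 d : R, 0 < d & forall x' y : 'rV[R]_n,
    (forall i, `|x' 0 i - x 0 i| < d) -> (forall i, `|y 0 i - x 0 i| < d) -> P x' y) ->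
  exists2 d : R, 0 < d & forall x y : 'rV[R]_n, K x -> (forall i, `|y 0 i - x 0 i| < d) -> P x y.
Proof.
move=> /compact_near_coveringP cK locP.
have : \forall d \near (0 : R)^'+, K `<=` (fun x : 'rV[R]_n =>
    forall y : 'rV[R]_n, (forall i, `|y 0 i - x 0 i| < d) -> P x y).
  apply: cK => x /locP[d d0 dP].
  have d2 : 0 < d / 2 by rewrite divr_gt0.
  exists ([set x' : 'rV[R]_n | forall i, `|x' 0 i - x 0 i| < d / 2],
    [set r : R | r < d / 2]); first split => /=.
  - by apply/row_nbhsP; exists (d / 2).
  - exact: nbhs_right_lt.
  move=> [x' r] [/= x'x rd] y yx'; apply: dP => i.
    by apply: lt_le_trans (x'x i) _; lra.
  rewrite -(subrKA (x' 0 i)); apply: le_lt_trans (ler_normD _ _) _.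
  by rewrite [d]splitr ltrD//; apply: lt_trans (yx' i) _.
move=> H; near (0 : R)^'+ => d.
exists d; first by near: d; exact: nbhs_right_gt.
have Hd : K `<=` (fun x : 'rV[R]_n =>
    forall y : 'rV[R]_n, (forall i, `|y 0 i - x 0 i| < d) -> P x y) by near: d.
by move=> x y Kx; exact: Hd.
Unshelve. all: by end_near.
Qed.

Lemma compact_uniform_cont n (W K : set 'rV[R]_n) (h : 'rV[R]_n -> R) : open W -> compact K -> K `<=` W ->
  (forall x, W x -> {for x, continuous h}) -> forall e : R, 0 < e ->
  exists2 d : R, 0 < d & forall x y : 'rV[R]_n, K x -> (forall i, `|y 0 i - x 0 i| < d) ->
    W y /\ `|h y - h x| < e.
Proof.
move=> oW cK KW ch e e0; apply: compact_uniform => // x Kx.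
have [r r0 rW] := (row_openP W).1 oW x (KW x Kx).
have e2 : 0 < e / 2 by rewrite divr_gt0.
have /row_contP/(_ _ e2)[s s0 sP] := ch x (KW x Kx).
exists (Num.min r s); first by rewrite lt_min r0.
move=> x' y xx yx; split.
  by apply: rW => i; have := yx i; rewrite lt_min => /andP[].
have Hx : `|h x' - h x| < e / 2.
  by apply: sP => i; have := xx i; rewrite lt_min => /andP[].
have Hy : `|h y - h x| < e / 2.
  by apply: sP => i; have := yx i; rewrite lt_min => /andP[].
rewrite -(subrKA (h x)) [e]splitr; apply: le_lt_trans (ler_normD _ _) _.
by rewrite ltrD// distrC.
Qed.

Definition obox n (r : 'rV[rat]_n) : set 'rV[R]_n :=
  [set x | forall i, `|x 0 i| < ratr (r 0 i)].

Lemma obox_open n (r : 'rV[rat]_n) : open (obox r).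
Proof.
apply/row_openP => x rx.
apply: (near_row_forall (P := fun i (z : 'rV[R]_n) => `|z 0 i| < ratr (r 0 i))) => i.
exists (ratr (r 0 i) - `|x 0 i|); first by rewrite subr_gt0; exact: rx.
move=> z /(_ i); rewrite ltrBrDr; apply: le_lt_trans.
by apply: le_trans (ler_normD _ _); rewrite subrK.
Qed.

Lemma box_compact n (r : 'rV[rat]_n) : compact (box r : set 'rV[R]_n).
Proof.
have := @rV_compact R n (fun i => `[- ratr (r 0 i), ratr (r 0 i)]%classic) (fun i => @segment_compact _ _ _).
congr compact; apply/seteqP; split => x /= H i; have := H i; rewrite in_itv /= ler_norml //.
Qed.

Lemma box_obox n (r s : 'rV[rat]_n) : (forall i, r 0 i < s 0 i) ->
  (box r : set 'rV[R]_n) `<=` obox s.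
Proof. by move=> rs x rx i; apply: le_lt_trans (rx i) _; rewrite ltr_rat. Qed.

Lemma obox_box n (r : 'rV[rat]_n) : (obox r : set 'rV[R]_n) `<=` box r.
Proof. by move=> x rx i; apply: ltW. Qed.

(** Every property that defines an open set and holds on [-r, r] holds on a
    larger rational box; this is what allows the extensions required from an
    IF-system to be built. *)
Lemma box_thicken n (r : 'rV[rat]_n) (U : set 'rV[R]_n) : pos_radius r ->
  open U -> box r `<=` U ->
  exists s : 'rV[rat]_n, (forall i, r 0 i < s 0 i) /\ (box s : set 'rV[R]_n) `<=` U.
Proof.
move=> r0 oU rU.
have [d d0 dP] : exists2 d : R, 0 < d & forall x y : 'rV[R]_n, box r x ->
    (forall i, `|y 0 i - x 0 i| < d) -> U y.
  apply: (compact_uniform (P := fun _ => U) (@box_compact n r)) => x /rU Ux.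
  by have [e e0 eU] := (row_openP U).1 oU x Ux; exists e => // _ y _; exact: eU.
have [q] := rat_in_itvoo d0; rewrite in_itv /= => /andP[q0 qd].
exists (\row_i (r 0 i + q)); split.
  by move=> i; rewrite mxE ltrDl -(ltr_rat R) rmorph0.
move=> y ys.
pose x : 'rV[R]_n := \row_i Num.max (- ratr (r 0 i)) (Num.min (ratr (r 0 i)) (y 0 i)).
have rp i : 0 < ratr (r 0 i) :> R by rewrite ltr0q.
have yi i : `|y 0 i| <= ratr (r 0 i) + ratr q by have := ys i; rewrite !mxE rmorphD.
have clamp i : `|x 0 i| <= ratr (r 0 i) /\ `|y 0 i - x 0 i| < d.
  have := rp i; have := yi i; rewrite mxE; set a := ratr _; set b := y 0 i.
  rewrite !ler_norml ltr_norml => /andP[b1 b2] a0.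
  have [ab|ba] := leP a b; first by rewrite max_r; [split|]; lra.
  by have [ab'|ba'] := leP (- a) b; split; lra.
by apply: (dP x) => i; have [] := clamp i.
Qed.

End Compactness.

(** * Division of a smooth function by the last coordinate *)

Section Hadamard.
Variable R : realType.

Definition int01 (u : R -> R) : R := \int[lebesgue_measure]_(t in `[0, 1]) u t.

Definition cont01 (u : R -> R) := {within `[0, 1], continuous u}.

Lemma cont01_integrable (u : R -> R) : cont01 u ->
  (lebesgue_measure : measure _ _).-integrable `[0, 1] (EFin \o u).
Proof. by move=> cu; apply: continuous_compact_integrable => //; exact: segment_compact. Qed.

(** The integrands are only continuous at the points of [0, 1]. *)
Lemma cont01P (u : R -> R) : (forall t, 0 <= t <= 1 -> {for t, continuous u}) -> cont01 u.
Proof.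
move=> cu; apply: continuous_in_subspaceT => t.
by rewrite inE /= in_itv /=; exact: cu.
Qed.

Lemma cont01B (u v : R -> R) : cont01 u -> cont01 v -> cont01 (fun t => u t - v t).
Proof. by move=> cu cv t; exact: continuousB (cu t) (cv t). Qed.

Lemma cont01Z (c : R) (u : R -> R) : cont01 u -> cont01 (fun t => c * u t).
Proof.
have cc : cont01 (fun=> c) by apply: cont01P => t _; exact: cst_continuous.
by move=> cu t; exact: continuousM (cc t) (cu t).
Qed.

Lemma int01_bound (u : R -> R) (e : R) : cont01 u ->
  (forall t, 0 <= t <= 1 -> `|u t| <= e) -> `|int01 u| <= e.
Proof.
move=> cu ue; have iu := cont01_integrable cu.
have ce : cont01 (cst e) by apply: cont01P => t _; exact: cst_continuous.
apply: le_trans (le_normr_Rintegral _ iu) _ => //.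
apply: (@le_trans _ _ (int01 (cst e))); last first.
  by rewrite /int01 Rintegral_cst//= lebesgue_measure_itv/= lte_fin ltr01 oppr0 adde0 /= mulr1.
apply: le_Rintegral => //; last exact: cont01_integrable.
apply: (cont01_integrable (u := fun t => `|u t|)).
by move=> t; apply: continuous_comp (cu t) _; exact: norm_continuous.
Qed.

Lemma int01B (u v : R -> R) : cont01 u -> cont01 v ->
  int01 (fun t => u t - v t) = int01 u - int01 v.
Proof. by move=> cu cv; apply: RintegralB => //; exact: cont01_integrable. Qed.

Lemma int01Z (u : R -> R) (c : R) : cont01 u -> int01 (fun t => c * u t) = c * int01 u.
Proof. by move=> cu; apply: RintegralZl => //; exact: cont01_integrable. Qed.

Lemma int01_FTC (F f : R -> R) : cont01 f ->
  (forall t : R, 0 <= t <= 1 -> is_derive t (1 : R) F (f t)) -> int01 f = F 1 - F 0.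
Proof.
move=> cf dF.
have cF t : 0 <= t <= 1 -> {for t, continuous F}.
  move=> /dF[dF' _]; apply: differentiable_continuous; exact/derivable1_diffP.
rewrite /int01 /Rintegral (@continuous_FTC2 _ f F 0 1) //.
- split.
  + move=> t; rewrite in_itv /= => /andP[t0 t1].
    by apply: ex_derive; apply: dF; rewrite !ltW.
  + by apply: cvg_at_right_filter; apply: cF; rewrite lexx ler01.
  + by apply: cvg_at_left_filter; apply: cF; rewrite lexx ler01.
- move=> t; rewrite in_itv /= => /andP[t0 t1].
  by rewrite derive1E; apply: derive_val; apply: dF; rewrite !ltW.
Qed.

Definition lscale n (t : R) (z : 'rV[R]_n.+1) : 'rV[R]_n.+1 :=
  snoc (rinit z) (t * z 0 ord_max).

Lemma lscale_last n t (z : 'rV[R]_n.+1) : lscale t z 0 ord_max = t * z 0 ord_max.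
Proof. by rewrite snoc_last. Qed.

Lemma lscale_lift n t (z : 'rV[R]_n.+1) j : lscale t z 0 (lift ord_max j) = z 0 (lift ord_max j).
Proof. by rewrite snoc_lift mxE. Qed.

Lemma lscale1 n (z : 'rV[R]_n.+1) : lscale 1 z = z.
Proof. by rewrite /lscale mul1r rinitK. Qed.

(** The factor by which [lscale t] multiplies the i-th coordinate. *)
Definition lweight n (t : R) (i : 'I_n.+1) : R := t ^+ (i == ord_max).

Lemma lweightE n t (z : 'rV[R]_n.+1) i : lscale t z 0 i = lweight t i * z 0 i.
Proof.
move: i; apply: ord_snocP => [|j]; first by rewrite lscale_last /lweight eqxx expr1.
by rewrite lscale_lift /lweight eq_sym (negbTE (neq_lift _ _)) expr0 mul1r.
Qed.

Lemma lweight01 n t (i : 'I_n.+1) : 0 <= t <= 1 -> 0 <= lweight t i <= 1.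
Proof.
move=> /andP[t0 t1]; rewrite /lweight; case: eqP => _.
  by rewrite expr1 t0.
by rewrite expr0 lexx ler01.
Qed.

Lemma lscaleD n (t h : R) (i : 'I_n.+1) (z : 'rV[R]_n.+1) :
  lscale t (h *: 'e_i + z) = (lweight t i * h) *: 'e_i + lscale t z.
Proof.
apply/rowP => k; rewrite [LHS]lweightE [RHS]mxE [X in _ = _ + X]lweightE !mxE eqxx /=.
have [->|_] := eqVneq k i; first by rewrite !mulr1 mulrDr.
by rewrite !mulr0 !add0r.
Qed.

Section Mean.
Variables (n : nat) (W : set 'rV[R]_n.+1).
Hypotheses (oW : open W) (starW : forall z (t : R), W z -> 0 <= t <= 1 -> W (lscale t z)).

(** The operator h |-> int_0^1 t^j h(x, t y) dt.  The weights t^j make the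
    family stable under differentiation: each derivative in the last variable
    produces one factor t. *)
Definition mean (j : nat) (h : 'rV[R]_n.+1 -> R) (z : 'rV[R]_n.+1) : R :=
  int01 (fun t => t ^+ j * h (lscale t z)).

Lemma lscale_row_cont (z : 'rV[R]_n.+1) (t : R) : {for t, continuous (fun t => lscale t z)}.
Proof.
move=> A /row_nbhsP[e e0 eA].
have M0 : 0 < `|z 0 ord_max| + 1 by rewrite ltr_wpDl.
rewrite /nbhs /=; apply/nbhs_ballP; exists (e / (`|z 0 ord_max| + 1)); first by rewrite /= divr_gt0.
move=> s; rewrite /ball /= distrC => ts; apply: eA; apply: ord_snocP => [|k].
  rewrite !lscale_last -mulrBl normrM.
  rewrite ltr_pdivlMr// in ts; apply: le_lt_trans ts.
  by rewrite ler_wpM2l// lerDl.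
by rewrite !lscale_lift subrr normr0.
Qed.

Lemma mean_cont01 j h z : (forall x, W x -> {for x, continuous h}) -> W z ->
  cont01 (fun t => t ^+ j * h (lscale t z)).
Proof.
move=> ch Wz; apply: cont01P => t t01.
apply: (@continuousM _ _ (fun t : R => t ^+ j) (fun t => h (lscale t z))).
  exact: exprn_continuous.
by apply: continuous_comp; [exact: lscale_row_cont|apply: ch; exact: starW].
Qed.

Lemma lscale_compact (z : 'rV[R]_n.+1) : compact [set lscale t z | t in `[0, 1]].
Proof.
apply: continuous_compact; last exact: segment_compact.
by apply: continuous_in_subspaceT => t _; exact: lscale_row_cont.
Qed.

(** h is uniformly continuous along the compact segment joining (x, 0) to
    (x, y). *)
Lemma mean_continuous j h z : (forall x, W x -> {for x, continuous h}) -> W z ->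
  {for z, continuous (mean j h)}.
Proof.
move=> ch Wz; apply/row_contP => e e0.
have e2 : 0 < e / 2 by rewrite divr_gt0.
have KW : [set lscale t z | t in `[0, 1]] `<=` W.
  by move=> _ [t t01 <-]; apply: starW => //; rewrite /= in_itv in t01.
have [d d0 dP] := compact_uniform_cont oW (@lscale_compact z) KW ch e2.
have [r r0 rW] := (row_openP W).1 oW z Wz.
exists (Num.min d r); first by rewrite lt_min d0.
move=> y yz.
have Wy : W y by apply: rW => i; have := yz i; rewrite lt_min => /andP[].
rewrite /mean -int01B; [|exact: mean_cont01..].
apply: (@le_lt_trans _ _ (e / 2)); last by lra.
apply: int01_bound.
  by apply: cont01B; exact: mean_cont01.
move=> t /[dup] t01 /andP[t0 t1]; rewrite -mulrBr normrM.
have /ltW H : `|h (lscale t y) - h (lscale t z)| < e / 2.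
  apply: (dP _ _ _ _).2; first by exists t => //=; rewrite in_itv.
  move=> i; rewrite !lweightE -mulrBr normrM.
  have /andP[w0 w1] := lweight01 i t01.
  apply: (@le_lt_trans _ _ `|y 0 i - z 0 i|).
    by rewrite ler_piMl// ger0_norm.
  by have := yz i; rewrite lt_min => /andP[].
apply: le_trans H; rewrite ler_piMl//.
by rewrite normrX ger0_norm// exprn_ile1.
Qed.

(** For every t the difference quotient is, by the mean value theorem, a value
    of D_i h at a point close to the segment of the [lscale t z]; uniform
    continuity along this segment makes the convergence uniform in t. *)
Lemma mean_is_derive j h z i : smooth W h -> W z ->
  is_derive z ('e_i) (mean j h) (mean (j + (i == ord_max)) ('D_('e_i) h) z).
Proof.
move=> sh Wz.
have ch x : W x -> {for x, continuous h} by exact: smooth_continuous.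
pose h' := 'D_('e_i) h.
have ch' x : W x -> {for x, continuous h'}.
  by apply: smooth_continuous => //; exact: smooth_derive.
pose L := mean (j + (i == ord_max)) h' z.
have KW : [set lscale t z | t in `[0, 1]] `<=` W.
  by move=> _ [t t01 <-]; apply: starW => //; rewrite /= in_itv in t01.
have [r r0 rW] := (row_openP W).1 oW z Wz.
have main : u^-1 *: (mean j h (u *: 'e_i + z) - mean j h z) @[u --> (0 : R)^'] --> L.
  apply/cvgrPdist_le => e e0.
  have [d d0 dP] := compact_uniform_cont oW (@lscale_compact z) KW ch' e0.
  near=> u.
  have u0 : u != 0 by near: u; exact: nbhs_dnbhs_neq.
  have ud : `|u| < d by near: u; exact: dnbhs0_lt.
  have ur : `|u| < r by near: u; exact: dnbhs0_lt.
  have Wu : W (u *: 'e_i + z).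
    apply: rW => k; rewrite !mxE addrK eqxx normrM.
    by apply: le_lt_trans ur; rewrite ler_piMr//; case: eqP => _ /=; rewrite ?normr1 ?normr0.
  rewrite distrC /GRing.scale /=.
  pose q (t : R) := u^-1 * (t ^+ j * h (lscale t (u *: 'e_i + z)) - t ^+ j * h (lscale t z)).
  have c1 := mean_cont01 (j := j) ch Wu.
  have c2 := mean_cont01 (j := j) ch Wz.
  have c3 := mean_cont01 (j := j + (i == ord_max)) ch' Wz.
  have c12 : cont01 (fun t => t ^+ j * h (lscale t (u *: 'e_i + z)) - t ^+ j * h (lscale t z)).
    exact: cont01B.
  have cq : cont01 q.
    exact: cont01Z.
  rewrite /L /mean -int01B// -int01Z// -int01B//.
  apply: int01_bound.
    exact: cont01B.
  move=> t /[dup] t01 /andP[t0 t1].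
  have /andP[w0 w1] := lweight01 i t01.
  set w := lweight t i in w0 w1.
  have Kt : [set lscale t z | t in `[0, 1]] (lscale t z) by exists t => //=; rewrite in_itv.
  have near_t (s : R) : `|s| < d -> W (s *: 'e_i + lscale t z) /\
      `|h' (s *: 'e_i + lscale t z) - h' (lscale t z)| < e.
    move=> sd; apply: dP => // k; rewrite mxE addrK !mxE eqxx /= normrM.
    by apply: le_lt_trans sd; rewrite ler_piMr//; case: eqP => _ /=; rewrite ?normr1 ?normr0.
  have bet (s : R) : Num.min 0 (w * u) <= s <= Num.max 0 (w * u) -> `|s| < d.
    move=> H; apply: le_lt_trans ud; apply: (@le_trans _ _ `|w * u|); last first.
      by rewrite normrM ler_piMl// ger0_norm.
    move: H; case: (leP 0 (w * u)) => wu /andP[s1 s2]; first by rewrite !ger0_norm.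
    by rewrite !ler0_norm ?lerN2// ltW.
  have [s /bet sd|s /bet sd E] := @line_mvt _ _ h (lscale t z) ('e_i) (w * u).
    by apply: smooth_derivable sh _; have [] := near_t s sd.
  rewrite /q lscaleD -/w -mulrBr E exprD -/(lweight t i) -/w -/h'.
  have -> : u^-1 * (t ^+ j * (h' (s *: 'e_i + lscale t z) * (w * u))) -
      t ^+ j * w * h' (lscale t z) =
     t ^+ j * w * (h' (s *: 'e_i + lscale t z) - h' (lscale t z)).
    by field.
  rewrite normrM; have [_ /ltW H] := near_t s sd.
  apply: le_trans H; rewrite ler_piMl//.
  rewrite normrM mulr_ile1//; last by rewrite ger0_norm.
  by rewrite normrX ger0_norm// exprn_ile1.
split; first by apply/cvg_ex; eexists; exact: main.
by apply/cvg_lim => //; exact: main.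
Unshelve. all: by end_near.
Qed.

Lemma mean_smooth j h : smooth W h -> smooth W (mean j h).
Proof.
move=> sh k; elim: k j h sh => [|k IH] j h sh.
  move=> z Wz; apply: mean_continuous => // x; exact: smooth_continuous.
apply: (CkS_intro oW (D := fun i => mean (j + (i == ord_max)) ('D_('e_i) h))) => [i z Wz|i].
  exact: mean_is_derive.
by apply: IH; exact: smooth_derive.
Qed.

(** f is the integral over t in [0, 1] of the derivative of
    t |-> f(x, t y), and this derivative is y times (D_y f)(x, t y). *)
Lemma hadamard f : smooth W f -> (forall z, W z -> z 0 ord_max = 0 -> f z = 0) ->
  exists2 g, smooth W g & forall z, W z -> f z = z 0 ord_max * g z.
Proof.
move=> sf f0; have sf' := smooth_derive ord_max sf.
exists (mean 0 ('D_('e_ord_max) f)); first exact: mean_smooth.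
move=> z Wz.
have c1 : cont01 (fun t => t ^+ 0 * ('D_('e_ord_max) f (lscale t z))).
  by apply: (mean_cont01 (j := 0) (h := fun z => 'D_('e_ord_max) f z)) => // x; exact: smooth_continuous.
rewrite /mean -int01Z//.
have dF (t : R) : 0 <= t <= 1 -> is_derive t (1 : R) (fun s => f (lscale s z))
    (z 0 ord_max * (t ^+ 0 * 'D_('e_ord_max) f (lscale t z))).
  move=> t01; rewrite expr0 mul1r.
  have Wt := starW Wz t01.
  have -> : z 0 ord_max * 'D_('e_ord_max) f (lscale t z) =
     \sum_i 'D_('e_i) f (lscale t z) * ((i == ord_max)%:R * z 0 ord_max).
    rewrite (bigD1 ord_max)//= big1 => [|i /negbTE ->]; last by rewrite mul0r mulr0.
    by rewrite eqxx mul1r addr0 mulrC.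
  apply: (chain_rule (V := R) (g := fun s => lscale s z)).
  - by apply: (open_near oW Wt) => x Wx i; exact: smooth_derivable sf Wx.
  - by move=> i; apply: (smooth_continuous oW _ Wt); exact: smooth_derive.
  apply: ord_snocP => [|i].
    have -> : (fun s => lscale s z 0 ord_max) = (fun s => s * z 0 ord_max).
      by apply/funext => s; rewrite lscale_last.
    rewrite eqxx mul1r.
    have -> : (fun s : R => s * z 0 ord_max) = (z 0 ord_max \*: id).
      by apply/funext => s /=; rewrite mulrC.
    by apply: is_derive_eq; rewrite /GRing.scale /= mulr1.
  have -> : (fun s => lscale s z 0 (lift ord_max i)) = cst (z 0 (lift ord_max i)).
    by apply/funext => s; rewrite lscale_lift.
  rewrite eq_sym (negbTE (neq_lift _ _)) mul0r; exact: is_derive_cst.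
have f00 : f (lscale 0 z) = 0.
  by apply: f0; [apply: starW => //; rewrite lexx ler01|rewrite lscale_last mul0r].
by rewrite (int01_FTC (cont01Z (c := z 0 ord_max) c1) dF) lscale1 f00 subr0.
Qed.

End Mean.
End Hadamard.

(** * Calculus of 0-definable sets and functions *)

Section Definability.
Variables (R : realType) (E : expansion R).

Definition zdef n (P : 'rV[R]_n -> Prop) : Prop := @zero_definable R E n P.

Lemma zdef_iff n (P Q : 'rV[R]_n -> Prop) : (forall v, P v <-> Q v) -> zdef P -> zdef Q.
Proof. by move=> PQ [phi Pphi]; exists phi; rewrite -Pphi; apply/seteqP; split => v /PQ. Qed.

Lemma zdef_sat n (phi : formula E n) : zdef (sat phi).
Proof. by exists phi. Qed.

Lemma zdef_not n (P : 'rV[R]_n -> Prop) : zdef P -> zdef (fun v => ~ P v).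
Proof. by move=> [phi ->]; exists (Not phi). Qed.

Lemma zdef_and n (P Q : 'rV[R]_n -> Prop) : zdef P -> zdef Q -> zdef (fun v => P v /\ Q v).
Proof. by move=> [phi ->] [psi ->]; exists (And phi psi). Qed.

Lemma zdef_or n (P Q : 'rV[R]_n -> Prop) : zdef P -> zdef Q -> zdef (fun v => P v \/ Q v).
Proof.
move=> zP zQ; apply: zdef_iff (zdef_not (zdef_and (zdef_not zP) (zdef_not zQ))) => v; split.
  by move=> H; apply: contrapT => nPQ; apply: H; split => ?; apply: nPQ; [left|right].
by case=> ? [? ?].
Qed.

Lemma zdef_imp n (P Q : 'rV[R]_n -> Prop) : zdef P -> zdef Q -> zdef (fun v => P v -> Q v).
Proof.
move=> zP zQ; apply: zdef_iff (zdef_or (zdef_not zP) zQ) => v; split; first by case.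
by move=> PQ; have [/PQ|] := pselect (P v); [right|left].
Qed.

Lemma zdef_true n : zdef (fun _ : 'rV[R]_n => True).
Proof. by apply: zdef_iff (zdef_sat (Eq (Zero _ n) (Zero _ n))) => v; split. Qed.

Lemma zdef_ex n (P : 'rV[R]_n -> R -> Prop) :
  zdef (fun w : 'rV[R]_n.+1 => P (rinit w) (w 0 ord_max)) -> zdef (fun v => exists y, P v y).
Proof.
move=> [phi phiP]; exists (Ex phi); apply/seteqP; split => v /=.
  move=> [y Py]; exists y; have : [set u | sat phi u] (snoc v y).
    by rewrite -phiP rinit_snoc snoc_last.
  by [].
move=> [y phiy]; exists y; have : [set u | sat phi u] (snoc v y) by [].
by rewrite -phiP rinit_snoc snoc_last.
Qed.

Lemma zdef_all n (P : 'rV[R]_n -> R -> Prop) :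
  zdef (fun w : 'rV[R]_n.+1 => P (rinit w) (w 0 ord_max)) -> zdef (fun v => forall y, P v y).
Proof.
move=> /zdef_not zP; apply: zdef_iff (zdef_not (zdef_ex (P := fun v y => ~ P v y) zP)) => v; split.
  by move=> H y; apply: contrapT => nP; apply: H; exists y.
by move=> H [y]; apply.
Qed.

Lemma zdef_all_seq n (I : eqType) (s : seq I) (P : I -> 'rV[R]_n -> Prop) :
  (forall i, zdef (P i)) -> zdef (fun v => forall i, i \in s -> P i v).
Proof.
move=> zP; elim: s => [|j s IH]; first by apply: zdef_iff (zdef_true n) => v.
apply: zdef_iff (zdef_and (zP j) IH) => v; split.
  by move=> [Pj Ps] i; rewrite inE => /predU1P[->|/Ps].
by move=> H; split => [|i si]; apply: H; rewrite inE ?eqxx// si orbT.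
Qed.

Lemma zdef_all_fin n (I : finType) (P : I -> 'rV[R]_n -> Prop) :
  (forall i, zdef (P i)) -> zdef (fun v => forall i, P i v).
Proof.
move=> zP; apply: zdef_iff (zdef_all_seq (enum I) zP) => v; split => H i; last by move=> _.
by apply: H; rewrite mem_enum.
Qed.

Lemma term_rename n k (s : 'I_n -> 'I_k) (t : term E n) :
  exists t' : term E k, forall v, teval v t' = teval (\row_i v 0 (s i)) t.
Proof.
elim: t => [i| | |t [t' IH]|t1 [t1' IH1] t2 [t2' IH2]|t1 [t1' IH1] t2 [t2' IH2]|f ts IH].
- by exists (Var _ (s i)) => v /=; rewrite mxE.
- by exists (Zero _ _).
- by exists (One _ _).
- by exists (Opp t') => v /=; rewrite IH.
- by exists (Add t1' t2') => v /=; rewrite IH1 IH2.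
- by exists (Mul t1' t2') => v /=; rewrite IH1 IH2.
- have [ts' ts'P] := choice IH.
  by exists (App ts') => v /=; congr finterp; apply/rowP => i; rewrite !mxE ts'P.
Qed.

(** Under a quantifier the renaming is extended by fixing the last index,
    which is the bound variable. *)
Lemma formula_rename n (phi : formula E n) :
  forall k (s : 'I_n -> 'I_k), zdef (fun v => sat phi (\row_i v 0 (s i))).
Proof.
elim: phi => {n} [n t1 t2|n t1 t2|n p ts|n phi IH|n phi IH1 psi IH2|n phi IH] k s /=.
- have [t1' E1] := term_rename s t1; have [t2' E2] := term_rename s t2.
  by apply: zdef_iff (zdef_sat (Eq t1' t2')) => v /=; rewrite E1 E2.
- have [t1' E1] := term_rename s t1; have [t2' E2] := term_rename s t2.
  by apply: zdef_iff (zdef_sat (Lt t1' t2')) => v /=; rewrite E1 E2.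
- have [ts' ts'P] := choice (fun i => term_rename s (ts i)).
  apply: zdef_iff (zdef_sat (Rel ts')) => v /=.
  have -> // : \row_i teval v (ts' i) = \row_i teval (\row_i v 0 (s i)) (ts i).
  by apply/rowP => i; rewrite !mxE ts'P.
- exact: zdef_not.
- exact: zdef_and.
- apply: zdef_ex.
  pose s' (i : 'I_n.+1) : 'I_k.+1 := if unlift ord_max i is Some j then lift ord_max (s j) else ord_max.
  apply: zdef_iff (IH _ s') => v.
  have -> // : \row_i v 0 (s' i) = snoc (\row_i rinit v 0 (s i)) (v 0 ord_max).
  by apply/rowP => i; rewrite /s' !mxE; case: unlift => [j|]; rewrite ?mxE.
Qed.

Lemma zdef_rename n k (s : 'I_n -> 'I_k) (P : 'rV[R]_n -> Prop) :
  zdef P -> zdef (fun v => P (\row_i v 0 (s i))).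
Proof. by move=> [phi ->]; exact: formula_rename. Qed.

(** Quantification over a block of variables, eliminated from the last one
    on. *)
Lemma zdef_ex_row k n (P : 'rV[R]_n -> 'rV[R]_k -> Prop) :
  zdef (fun u : 'rV[R]_(n + k) => P (lsubmx u) (rsubmx u)) -> zdef (fun v => exists w, P v w).
Proof.
elim: k P => [|k IH] P zP.
  pose s (i : 'I_(n + 0)) : 'I_n := match fintype.split i with inl j => j | inr j => False_rect _ (notF (ltn_ord j)) end.
  apply: zdef_iff (zdef_rename s zP) => v.
  have -> : lsubmx (\row_i v 0 (s i)) = v.
    apply/rowP => i; rewrite !mxE /s; case: splitP => [j /= ij|[]//].
    by congr (v _ _); apply: val_inj.
  split; first by exists (rsubmx (\row_i v 0 (s i))).
  move=> [w Pw]; have -> // : rsubmx (\row_i v 0 (s i)) = w.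
  by apply/rowP; case.
apply: (@zdef_iff _ (fun v => exists w : 'rV[R]_k, exists y, P v (snoc w y))).
  move=> v; split; first by move=> [w [y Pwy]]; exists (snoc w y).
  by move=> [w Pw]; exists (rinit w), (w 0 ord_max); rewrite rinitK.
apply: IH; apply: (zdef_ex (P := fun u y => P (lsubmx u) (snoc (rsubmx u) y))).
pose s (i : 'I_(n + k.+1)) : 'I_(n + k).+1 := match fintype.split i with
  | inl j => lift ord_max (lshift k j)
  | inr j => if unlift ord_max j is Some j' then lift ord_max (rshift n j') else ord_max
  end.
apply: zdef_iff (zdef_rename s zP) => v.
have -> : lsubmx (\row_i v 0 (s i)) = lsubmx (rinit v).
  apply/rowP => i; rewrite !mxE /s; case: splitP => [j /= ij|j /= ij].
    by have -> : j = i by exact: val_inj.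
  by have := ltn_ord i; rewrite ij ltnNge leq_addr.
have -> // : rsubmx (\row_i v 0 (s i)) = snoc (rsubmx (rinit v)) (v 0 ord_max).
apply/rowP => i; rewrite !mxE /s; case: splitP => [j /= ij|j /= ij].
  by have := ltn_ord j; rewrite -ij ltnNge leq_addr.
have -> : j = i by apply/val_inj/(@addnI n); rewrite /= ij.
by case: unlift => [j'|]; rewrite ?mxE.
Qed.

Definition zdfun n (f : 'rV[R]_n -> R) : Prop :=
  zdef (fun w : 'rV[R]_n.+1 => w 0 ord_max = f (rinit w)).

Definition zdmap n k (G : 'rV[R]_n -> 'rV[R]_k) : Prop := forall i, zdfun (fun v => G v 0 i).

(** Substitution: P (G v) holds when some w equal to G v coordinatewise
    satisfies P. *)
Lemma zdef_app n k (P : 'rV[R]_k -> Prop) (G : 'rV[R]_n -> 'rV[R]_k) :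
  zdef P -> zdmap G -> zdef (fun v => P (G v)).
Proof.
move=> zP dG.
apply: (@zdef_iff _ (fun v => exists w : 'rV[R]_k, (forall i, w 0 i = G v 0 i) /\ P w)).
  move=> v; split; last by exists (G v).
  by move=> [w [/rowP ->]].
apply: (zdef_ex_row (P := fun v w => (forall i, w 0 i = G v 0 i) /\ P w)); apply: zdef_and; last first.
  apply: zdef_iff (zdef_rename (fun i => rshift n i) zP) => u.
  by have -> // : \row_i u 0 (rshift n i) = rsubmx u by apply/rowP => i; rewrite !mxE.
apply: zdef_all_fin => i.
pose s (j : 'I_n.+1) : 'I_(n + k) := if unlift ord_max j is Some j' then lshift k j' else rshift n i.
apply: zdef_iff (zdef_rename s (dG i)) => u.
have -> : rinit (\row_j u 0 (s j)) = lsubmx u.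
  by apply/rowP => j; rewrite !mxE /s liftK.
by rewrite !mxE /s unlift_none.
Qed.

Lemma zdfun_term n (t : term E n) : zdfun (fun v => teval v t).
Proof.
have [t' tE] := term_rename (fun j => lift ord_max j) t.
apply: zdef_iff (zdef_sat (Eq (Var _ ord_max) t')) => w /=.
by rewrite tE.
Qed.

Lemma zdfun_proj n (i : 'I_n) : zdfun (fun v : 'rV[R]_n => v 0 i).
Proof. exact: (zdfun_term (Var _ i)). Qed.

Lemma zdmap_id n : zdmap (fun v : 'rV[R]_n => v).
Proof. by move=> i; exact: zdfun_proj. Qed.

Lemma zdfun_ext n (f g : 'rV[R]_n -> R) : (forall v, f v = g v) -> zdfun f -> zdfun g.
Proof. by move=> fg; rewrite (_ : g = f)//; apply/funext => v; rewrite fg. Qed.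

Lemma zdfun_app n k (f : 'rV[R]_k -> R) (G : 'rV[R]_n -> 'rV[R]_k) :
  zdfun f -> zdmap G -> zdfun (fun v => f (G v)).
Proof.
move=> df dG; rewrite /zdfun.
apply: (@zdef_iff _ (fun w : 'rV[R]_n.+1 => (fun u : 'rV[R]_k.+1 => u 0 ord_max = f (rinit u))
    (snoc (G (rinit w)) (w 0 ord_max)))).
  by move=> w /=; rewrite snoc_last rinit_snoc.
apply: (zdef_app (G := fun w : 'rV[R]_n.+1 => snoc (G (rinit w)) (w 0 ord_max)) df).
apply: ord_snocP => [|j].
  by apply: zdfun_ext (zdfun_proj ord_max) => v; rewrite snoc_last.
rewrite /zdfun.
pose s (i : 'I_n.+1) : 'I_n.+2 := if unlift ord_max i is Some i' then lift ord_max (lift ord_max i') else ord_max.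
apply: zdef_iff (zdef_rename s (dG j)) => w.
have -> : rinit (\row_i w 0 (s i)) = rinit (rinit w).
  by apply/rowP => i; rewrite !mxE /s liftK.
by rewrite mxE /s unlift_none snoc_lift.
Qed.

Lemma zdfun_coord n k (G : 'rV[R]_n -> 'rV[R]_k) i : zdmap G -> zdfun (fun v => G v 0 i).
Proof. by move=> /(_ i). Qed.

Lemma zdmap_row n k (f : 'I_k -> 'rV[R]_n -> R) :
  (forall i, zdfun (f i)) -> zdmap (fun v => \row_i f i v).
Proof. by move=> df i; apply: zdfun_ext (df i) => v; rewrite mxE. Qed.

Lemma zdmap_snoc n k (G : 'rV[R]_n -> 'rV[R]_k) (h : 'rV[R]_n -> R) :
  zdmap G -> zdfun h -> zdmap (fun v => snoc (G v) (h v)).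
Proof.
move=> dG dh; apply: ord_snocP => [|j].
  by apply: zdfun_ext dh => v; rewrite snoc_last.
by apply: zdfun_ext (dG j) => v; rewrite snoc_lift.
Qed.

Lemma zdmap_rinit n k (G : 'rV[R]_n -> 'rV[R]_k.+1) : zdmap G -> zdmap (fun v => rinit (G v)).
Proof. by move=> dG j; apply: zdfun_ext (dG (lift ord_max j)) => v; rewrite mxE. Qed.

Lemma zdmap_lsubmx n k l (G : 'rV[R]_n -> 'rV[R]_(k + l)) : zdmap G -> zdmap (fun v => lsubmx (G v)).
Proof. by move=> dG j; apply: zdfun_ext (dG (lshift l j)) => v; rewrite mxE. Qed.

Lemma zdmap_rsubmx n k l (G : 'rV[R]_n -> 'rV[R]_(k + l)) : zdmap G -> zdmap (fun v => rsubmx (G v)).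
Proof. by move=> dG j; apply: zdfun_ext (dG (rshift k j)) => v; rewrite mxE. Qed.

Lemma zdmap_row_mx n k l (G : 'rV[R]_n -> 'rV[R]_k) (H : 'rV[R]_n -> 'rV[R]_l) :
  zdmap G -> zdmap H -> zdmap (fun v => row_mx (G v) (H v)).
Proof.
move=> dG dH j; have [i|i] := splitP j.
  move=> ji; apply: zdfun_ext (dG i) => v.
  by rewrite (_ : j = lshift l i) ?row_mxEl//; apply: val_inj.
move=> ji; apply: zdfun_ext (dH i) => v.
by rewrite (_ : j = rshift k i) ?row_mxEr//; apply: val_inj.
Qed.

Lemma zdfun2 n (op : R -> R -> R) (f g : 'rV[R]_n -> R) :
  zdfun (fun v : 'rV[R]_2 => op (v 0 0) (v 0 1)) -> zdfun f -> zdfun g ->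
  zdfun (fun v => op (f v) (g v)).
Proof.
move=> dop df dg.
have := zdfun_app (G := fun v => \row_(i < 2) (if i == 0 then f v else g v)) dop.
move=> H; apply: zdfun_ext (H _) => [v|]; first by rewrite !mxE.
by apply: (zdmap_row (f := fun i v => if i == 0 then f v else g v)) => i; case: eqP.
Qed.

Lemma zdfun_add n (f g : 'rV[R]_n -> R) : zdfun f -> zdfun g -> zdfun (fun v => f v + g v).
Proof. by apply: (zdfun2 (op := +%R)); exact: (zdfun_term (Add (Var _ 0) (Var _ 1))). Qed.

Lemma zdfun_mul n (f g : 'rV[R]_n -> R) : zdfun f -> zdfun g -> zdfun (fun v => f v * g v).
Proof. by apply: (zdfun2 (op := *%R)); exact: (zdfun_term (Mul (Var _ 0) (Var _ 1))). Qed.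

Lemma zdfun_opp n (f : 'rV[R]_n -> R) : zdfun f -> zdfun (fun v => - f v).
Proof.
move=> df; have := @zdfun2 n (fun x y => - x) f f; apply => //.
exact: (zdfun_term (Opp (Var _ 0))).
Qed.

Lemma zdfun_sub n (f g : 'rV[R]_n -> R) : zdfun f -> zdfun g -> zdfun (fun v => f v - g v).
Proof. by move=> df dg; apply: zdfun_add => //; exact: zdfun_opp. Qed.

Lemma zdfun0 n : zdfun (fun _ : 'rV[R]_n => 0).
Proof. exact: (zdfun_term (Zero _ _)). Qed.

Lemma zdfun1 n : zdfun (fun _ : 'rV[R]_n => 1).
Proof. exact: (zdfun_term (One _ _)). Qed.

Lemma zdef_rel2 n (op : R -> R -> Prop) (f g : 'rV[R]_n -> R) :
  zdef (fun v : 'rV[R]_2 => op (v 0 0) (v 0 1)) -> zdfun f -> zdfun g ->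
  zdef (fun v => op (f v) (g v)).
Proof.
move=> dop df dg.
have := zdef_app (G := fun v => \row_(i < 2) (if i == 0 then f v else g v)) dop.
move=> H; apply: zdef_iff (H _) => [v|]; first by rewrite !mxE.
by apply: (zdmap_row (f := fun i v => if i == 0 then f v else g v)) => i; case: eqP.
Qed.

Lemma zdef_eq n (f g : 'rV[R]_n -> R) : zdfun f -> zdfun g -> zdef (fun v => f v = g v).
Proof. by apply: (zdef_rel2 (op := fun x y => x = y)); exact: (zdef_sat (Eq (Var _ 0) (Var _ 1))). Qed.

Lemma zdef_lt n (f g : 'rV[R]_n -> R) : zdfun f -> zdfun g -> zdef (fun v => f v < g v).
Proof. by apply: (zdef_rel2 (op := fun x y => x < y)); exact: (zdef_sat (Lt (Var _ 0) (Var _ 1))). Qed.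

Lemma zdef_le n (f g : 'rV[R]_n -> R) : zdfun f -> zdfun g -> zdef (fun v => f v <= g v).
Proof.
move=> df dg; apply: zdef_iff (zdef_not (zdef_lt dg df)) => v.
by rewrite leNgt; split => /negP.
Qed.

Lemma zdfun_if n (P : 'rV[R]_n -> Prop) (f g : 'rV[R]_n -> R) :
  zdef P -> zdfun f -> zdfun g -> zdfun (fun v => if `[< P v >] then f v else g v).
Proof.
move=> zP df dg; rewrite /zdfun.
have dr : zdmap (fun w : 'rV[R]_n.+1 => rinit w) by apply: zdmap_rinit; exact: zdmap_id.
have zP' := zdef_app zP dr.
have zf := zdef_eq (zdfun_proj ord_max) (zdfun_app df dr).
have zg := zdef_eq (zdfun_proj ord_max) (zdfun_app dg dr).
apply: zdef_iff (zdef_and (zdef_imp zP' zf) (zdef_imp (zdef_not zP') zg)) => w.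
case: asboolP => Pw; split; first by case=> + _; exact.
- by move=> H; split.
- by case=> _; exact.
- by move=> H; split.
Qed.

Lemma zdfun_restrict n (A : 'rV[R]_n -> Prop) (f : 'rV[R]_n -> R) :
  zdef A -> zdfun f -> zdfun (f \_ A).
Proof.
move=> zA df; apply: zdfun_ext (zdfun_if zA df (zdfun0 n)) => v.
rewrite patchE; case: asboolP => Av; first by rewrite mem_set.
by rewrite memNset.
Qed.

Lemma zdfun_inv n (f : 'rV[R]_n -> R) : zdfun f -> zdfun (fun v => (f v)^-1).
Proof.
move=> df; rewrite /zdfun.
have dr : zdmap (fun w : 'rV[R]_n.+1 => rinit w) by apply: zdmap_rinit; exact: zdmap_id.
have df' := zdfun_app df dr.
have dl : zdfun (fun w : 'rV[R]_n.+1 => w 0 ord_max) by exact: zdfun_proj.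
have z0 := zdef_eq df' (zdfun0 _).
apply: zdef_iff (zdef_or (zdef_and z0 (zdef_eq dl (zdfun0 _))) (zdef_eq (zdfun_mul dl df') (zdfun1 _))) => w.
split.
  case=> [[-> ->]|H]; first by rewrite invr0.
  have f0 : f (rinit w) != 0.
    by apply/eqP => f0; move: H; rewrite f0 mulr0 => /eqP; rewrite eq_sym oner_eq0.
  by apply: (mulIf f0); rewrite H mulVf.
move=> ->; have [f0|f0] := eqVneq (f (rinit w)) 0; first by left; rewrite f0 invr0.
by right; rewrite mulVf.
Qed.

Lemma zdfun_norm n (f : 'rV[R]_n -> R) : zdfun f -> zdfun (fun v => `|f v|).
Proof.
move=> df; apply: zdfun_ext (zdfun_if (zdef_le (zdfun0 n) df) df (zdfun_opp df)) => v.
by case: asboolP => [/ger0_norm//|/negP]; rewrite -ltNge => /ltr0_norm.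
Qed.

Lemma zdfun_rat n (q : rat) : zdfun (fun _ : 'rV[R]_n => ratr q).
Proof.
have dnat m : zdfun (fun _ : 'rV[R]_n => m%:R).
  elim: m => [|m IH]; first exact: zdfun0.
  by apply: zdfun_ext (zdfun_add (zdfun1 n) IH) => v; rewrite -natr1 addrC.
have dint (m : int) : zdfun (fun _ : 'rV[R]_n => m%:~R).
  case: m => m; first exact: dnat.
  by apply: zdfun_ext (zdfun_opp (dnat m.+1)) => v; rewrite NegzE mulrNz.
by apply: zdfun_ext (zdfun_mul (dint (numq q)) (zdfun_inv (dint (denq q)))) => v.
Qed.

Lemma zdef_box n (r : 'rV[rat]_n) : zdef (box r).
Proof. by apply: zdef_all_fin => i; apply: zdef_le; [apply/zdfun_norm/zdfun_proj|exact: zdfun_rat]. Qed.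

Lemma zdef_obox n (r : 'rV[rat]_n) : zdef (obox r).
Proof. by apply: zdef_all_fin => i; apply: zdef_lt; [apply/zdfun_norm/zdfun_proj|exact: zdfun_rat]. Qed.

Lemma definable_fiber k n (c : 'rV[R]_k) (P : 'rV[R]_(k + n) -> Prop) :
  zdef P -> definable E [set v : 'rV[R]_n | P (row_mx c v)].
Proof. by move=> [phi ->]; exists k, c, phi. Qed.

(** A formula describing the graph over A is enough, since f is replaced by 0
    outside A. *)
Lemma zdfun_graph n (A : 'rV[R]_n -> Prop) (f : 'rV[R]_n -> R) (G : 'rV[R]_n.+1 -> Prop) :
  zdef A -> zdef G -> (forall v y, A v -> G (snoc v y) <-> y = f v) -> zdfun (f \_ A).
Proof.
move=> zA zG Gf; rewrite /zdfun.
have dr : zdmap (fun w : 'rV[R]_n.+1 => rinit w) by apply: zdmap_rinit; exact: zdmap_id.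
have zA' := zdef_app zA dr.
have dl : zdfun (fun w : 'rV[R]_n.+1 => w 0 ord_max) by exact: zdfun_proj.
apply: zdef_iff (zdef_and (zdef_imp zA' zG) (zdef_imp (zdef_not zA') (zdef_eq dl (zdfun0 _)))) => w.
have := rinitK w; set v := rinit w; set y := w 0 ord_max => wE.
have GwE : G w <-> G (snoc v y) by rewrite wE.
rewrite patchE; have [Av|nAv] := pselect (A v).
  rewrite mem_set//; split; first by case=> /(_ Av)/GwE/(Gf _ _ Av).
  by move=> H; split => // _; apply/GwE/Gf.
by rewrite memNset//; split; [case=> _; exact|move=> H; split].
Qed.

End Definability.

(** * The IF-system of 0-definable smooth functions *)

Section System.
Variables (R : realType) (E : expansion R).

Lemma derive_epsP (V : normedModType R) (f : V -> R) (x v : V) (y : R) : derivable f x v ->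
  (forall e : R, 0 < e -> exists d : R, 0 < d /\ forall h : R, h <> 0 -> `|h| < d ->
     `|h^-1 * (f (h *: v + x) - f x) - y| < e) <-> y = 'D_v f x.
Proof.
move=> df; split => [H|->].
  apply/esym/cvg_lim => //; apply/cvgrPdist_lt => e /H[d [d0 dP]].
  near=> h; rewrite distrC; apply: dP; first by apply/eqP; near: h; exact: nbhs_dnbhs_neq.
  by near: h; exact: dnbhs0_lt.
move=> e e0; have /cvgrPdist_lt/(_ _ e0) [d /= d0 dP] := df.
exists d; split => // h /eqP h0 hd; rewrite distrC; apply: dP => //=.
by rewrite sub0r normrN.
Unshelve. all: by end_near.
Qed.

Lemma zdfun_derive n (U : set 'rV[R]_n) (f : 'rV[R]_n -> R) i : zdef E U -> zdfun E f ->
  (forall x, U x -> derivable f x ('e_i)) -> zdfun E ('D_('e_i) f \_ U).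
Proof.
move=> zU df Df.
pose G (w : 'rV[R]_n.+1) := forall e : R, 0 < e -> exists d : R, 0 < d /\ forall h : R, h <> 0 -> `|h| < d ->
     `|h^-1 * (f (h *: 'e_i + rinit w) - f (rinit w)) - w 0 ord_max| < e.
apply: (zdfun_graph (G := G)) => // [|v y /Df Dv]; last first.
  by rewrite /G rinit_snoc snoc_last; exact: derive_epsP.
have P0 k : zdfun E (fun v : 'rV[R]_k.+1 => v 0 ord_max) by exact: zdfun_proj.
have M k : zdmap E (fun v : 'rV[R]_k.+1 => rinit v) by apply: zdmap_rinit; exact: zdmap_id.
have MM k l (H : 'rV[R]_k -> 'rV[R]_l.+1) : zdmap E H -> zdmap E (fun v => rinit (H v)).
  exact: zdmap_rinit.
apply: zdef_all; apply: zdef_imp; first exact: zdef_lt (zdfun0 _ _) (P0 _).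
apply: zdef_ex; apply: zdef_and; first exact: zdef_lt (zdfun0 _ _) (P0 _).
apply: zdef_all.
apply: zdef_imp; first by apply: zdef_not; exact: zdef_eq (P0 _) (zdfun0 _ _).
apply: zdef_imp; first exact: zdef_lt (zdfun_norm (P0 _)) (zdfun_app (P0 _) (M _)).
apply: zdef_lt; last exact: zdfun_app (zdfun_app (P0 _) (M _)) (M _).
have Mx : zdmap E (fun w : 'rV[R]_n.+4 => rinit (rinit (rinit (rinit w)))) by do 3 apply/MM; exact: M.
apply/zdfun_norm/zdfun_sub; last exact: zdfun_app (zdfun_app (zdfun_app (P0 _) (M _)) (M _)) (M _).
apply: zdfun_mul; first exact/zdfun_inv/P0.
apply: zdfun_sub; last exact: zdfun_app df Mx.
apply: (zdfun_app df) => j.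
apply: (zdfun_ext (f := fun w : 'rV[R]_n.+4 => w 0 ord_max * (j == i)%:R + rinit (rinit (rinit (rinit w))) 0 j)).
  by move=> w; rewrite !mxE eqxx.
apply: zdfun_add; last exact: Mx.
by apply: zdfun_mul => //; case: eqP => _; [exact: zdfun1|exact: zdfun0].
Qed.

(** The witness g is a total function, 0-definable and smooth on an open box
    that contains [-r, r]; it thus records both the smoothness up to the
    boundary and the extension property. *)
Definition Csys : fun_collection R := fun n r f =>
  exists (s : 'rV[rat]_n) (g : 'rV[R]_n -> R),
   [/\ forall i, r 0 i < s 0 i, zdfun E g, smooth (obox s) g & forall x, box r x -> f x = g x].

Lemma obox_subset n (r s : 'rV[rat]_n) : (forall i, r 0 i <= s 0 i) ->
  (obox r : set 'rV[R]_n) `<=` obox s.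
Proof. by move=> rs x rx i; apply: lt_le_trans (rx i) _; rewrite ler_rat. Qed.

Lemma smooth_subset n (U V : set 'rV[R]_n) f : V `<=` U -> smooth U f -> smooth V f.
Proof. by move=> VU sf k; exact: Ck_subset (sf k). Qed.

Lemma Csys_const n (r : 'rV[rat]_n) (c : R) : zdfun E (fun _ : 'rV[R]_n => c) -> Csys r (cst c).
Proof.
move=> dc; exists (\row_i (r 0 i + 1)), (cst c); split => //.
  by move=> i; rewrite mxE ltrDl.
by move=> k; exact: Ck_cst.
Qed.

Lemma rV0_eq (x y : 'rV[R]_0) : x = y.
Proof. by apply/rowP; case. Qed.

(** A function on the one-point space R^0 is its only value. *)
Lemma Csys_const0 (r : 'rV[rat]_0) (c : R) : Csys r (cst c) -> zdfun E (fun _ : 'rV[R]_0 => c).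
Proof.
move=> [s [g [_ dg _ gc]]]; apply: zdfun_ext dg => v.
by rewrite -gc //; case.
Qed.

Lemma Csys_op2 (op : R -> R -> R) n (r : 'rV[rat]_n) f g :
  (forall n (a b : 'rV[R]_n -> R), zdfun E a -> zdfun E b -> zdfun E (fun v => op (a v) (b v))) ->
  (forall k (U : set 'rV[R]_n) (a b : 'rV[R]_n -> R), open U -> Ck k U a -> Ck k U b -> Ck k U (fun v => op (a v) (b v))) ->
  Csys r f -> Csys r g -> Csys r (fun v => op (f v) (g v)).
Proof.
move=> dop cop [s1 [f1 [r1 df1 sf1 ff1]]] [s2 [g1 [r2 dg1 sg1 gg1]]].
exists (\row_i Num.min (s1 0 i) (s2 0 i)), (fun v => op (f1 v) (g1 v)); split.
- by move=> i; rewrite mxE lt_min r1 r2.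
- exact: dop.
- move=> k; apply: cop; first exact: obox_open.
    by apply: Ck_subset (sf1 k); apply: obox_subset => i; rewrite mxE ge_min lexx.
  by apply: Ck_subset (sg1 k); apply: obox_subset => i; rewrite mxE ge_min lexx orbT.
- by move=> x rx; rewrite ff1// gg1.
Qed.

Lemma Csys_coord n (r : 'rV[rat]_n) (i : 'I_n) : Csys r (fun x => x 0 i).
Proof.
exists (\row_i (r 0 i + 1)), (fun x => x 0 i); split => //.
- by move=> j; rewrite mxE ltrDl.
- exact: zdfun_proj.
- by move=> k; apply: Ck_coord; exact: obox_open.
Qed.

Lemma Csys_extend n (r : 'rV[rat]_n) f : Csys r f ->
  exists (s : 'rV[rat]_n) (g : 'rV[R]_n -> R),
      [/\ forall i, r 0 i < s 0 i, Csys s g & forall x, box r x -> f x = g x].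
Proof.
move=> [s [g [rs dg sg fg]]].
exists (\row_i ((r 0 i + s 0 i) / 2)), g; split => //.
  by move=> i; rewrite mxE midf_lt.
by exists s, g; split => // i; rewrite mxE midf_lt.
Qed.

Lemma open_all_fin n (I : finType) (U : I -> set 'rV[R]_n) :
  (forall i, open (U i)) -> open [set x | forall i, U i x].
Proof.
move=> oU; apply/row_openP => x Ux; apply: (near_row_forall (P := U)) => i.
by apply: (row_openP (U i)).1 => //; exact: Ux.
Qed.

Lemma Csys_comp m n (r : 'rV[rat]_m) (s : 'rV[rat]_n)
      (g : 'I_n -> 'rV[R]_m -> R) (f : 'rV[R]_n -> R) : pos_radius r ->
    (forall i, Csys r (g i)) ->
    (forall x, box r x -> box s (\row_i g i x)) ->
    Csys s f -> Csys r (fun x => f (\row_i g i x)).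
Proof.
move=> r0 Cg gs [s' [F [ss dF sF fF]]].
have [t] := choice Cg; move=> /choice[G GP].
have rt i j : r 0 j < t i 0 j by have [+ _ _ _] := GP i; exact.
have dG i : zdfun E (G i) by have [_ + _ _] := GP i; exact.
have sG i : smooth (obox (t i)) (G i) by have [_ _ + _] := GP i; exact.
have gG i x : box r x -> g i x = G i x by have [_ _ _ +] := GP i; exact.
pose O1 : set 'rV[R]_m := [set x | forall i, obox (t i) x].
have oO1 : open O1 by apply: open_all_fin => i; exact: obox_open.
have sG1 i : smooth O1 (G i) by apply: smooth_subset (sG i) => x; exact.
pose U := [set x | O1 x /\ obox s' (\row_i G i x)].
have oU : open U.
  apply: (row_cont_open (g := fun x => \row_i G i x) oO1 (@obox_open R n s')) => i x Ox.
  have -> : (fun z => (\row_i G i z) 0 i) = G i by apply/funext => z; rewrite mxE.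
  exact: (smooth_continuous oO1 (sG1 i)).
have gGr x : box r x -> \row_i g i x = \row_i G i x.
  by move=> rx; apply/rowP => i; rewrite !mxE gG.
have rU : box r `<=` U.
  move=> x rx; split => [i|]; first exact: box_obox rx.
  by rewrite -gGr//; apply: box_obox ss _ _; exact: gs.
have [r' [rr' r'U]] := box_thicken r0 oU rU.
exists r', (fun x => F (\row_i G i x)); split => //.
- by apply: (zdfun_app dF); exact: zdmap_row.
- move=> k; apply: (Ck_comp (@obox_open R m r') (@obox_open R n s')) => //.
  + by move=> x /obox_box/r'U[].
  + by move=> i; apply: Ck_subset (sG1 i k) => x /obox_box/r'U[].
- by move=> x rx; rewrite -gGr// fF//; exact: gs.
Qed.

Lemma zdmap_lscale0 n : zdmap E (@lscale R n 0).
Proof.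
apply: (@zdmap_snoc R E n.+1 n (fun z => rinit z) (fun z => 0 * z 0 ord_max)).
  by apply: zdmap_rinit; exact: zdmap_id.
by apply: zdfun_mul; [exact: zdfun0|exact: zdfun_proj].
Qed.

(** The extension F of f may fail to vanish for x_m = 0 outside [-r, r], so
    the division is applied to F(x, y) - F(x, 0), which agrees with f on
    [-r, r].  The quotient is definable because it is a quotient off x_m = 0
    and a partial derivative on x_m = 0. *)
Lemma Csys_div m (r : 'rV[rat]_m.+1) (f : 'rV[R]_m.+1 -> R) : pos_radius r ->
  Csys r f -> (forall x, box r x -> x 0 ord_max = 0 -> f x = 0) ->
  exists2 g, Csys r g & forall x, box r x -> f x = x 0 ord_max * g x.
Proof.
move=> r0 [s [F [rs dF sF fF]]] f0.
pose W : set 'rV[R]_m.+1 := obox s.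
have oW : open W by exact: obox_open.
have s0 i : 0 < s 0 i by apply: lt_trans (rs i); exact: r0.
have starW z (t : R) : W z -> 0 <= t <= 1 -> W (lscale t z).
  move=> Wz t01 i; rewrite lweightE normrM; apply: le_lt_trans (Wz i).
  have /andP[w0 w1] := lweight01 i t01.
  by rewrite ler_piMl// ger0_norm.
(* lscale 0 z is the projection of z to the hyperplane x_m = 0 *)
pose F0 z := F z - F (lscale 0 z).
have dF0 : zdfun E F0.
  by apply: zdfun_sub => //; apply: (zdfun_app dF); exact: zdmap_lscale0.
have sF0 : smooth W F0.
  move=> k; apply: Ck_sub => //.
  have UV x : W x -> W (snoc (rinit x) (0 * x 0 ord_max)).
    by move=> Wx; apply: starW => //; rewrite lexx ler01.
  apply: (Ck_snoc (g := fun z : 'rV[R]_m.+1 => rinit z) oW oW UV); first exact: sF.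
    move=> i; apply: (Ck_ext (f := fun z : 'rV[R]_m.+1 => z 0 (lift ord_max i))) => //.
      by move=> x _; rewrite mxE.
    exact: Ck_coord.
  by apply: Ck_mul => //; [exact: Ck_cst|exact: Ck_coord].
have F00 (z : 'rV[R]_m.+1) : z 0 ord_max = 0 -> F0 z = 0.
  move=> z0; rewrite /F0 (_ : lscale 0 z = z) ?subrr//.
  by rewrite -[RHS]rinitK /lscale z0 mulr0.
have [g sg Fg] := hadamard oW starW sF0 (fun z _ => F00 z).
have gD z : W z -> z 0 ord_max = 0 -> 'D_('e_ord_max) F0 z = g z.
  move=> Wz z0.
  have dg : derivable g z ('e_ord_max) by exact: smooth_derivable sg Wz.
  have dz : derivable (fun x : 'rV[R]_m.+1 => x 0 ord_max) z ('e_ord_max).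
    by have [] := is_derive_coord ord_max z ('e_ord_max).
  have -> : 'D_('e_ord_max) F0 z = 'D_('e_ord_max) ((fun x : 'rV[R]_m.+1 => x 0 ord_max) * g) z.
    by apply: near_eq_derive; apply: (open_near oW Wz) => x /Fg.
  rewrite (deriveM dz dg) z0 scale0r add0r.
  have [_ ->] := is_derive_coord ord_max z ('e_ord_max).
  by rewrite mxE !eqxx /GRing.scale /= mulr1.
have dgW : zdfun E (g \_ W).
  pose D := 'D_('e_ord_max) F0 \_ W.
  have dD : zdfun E D.
    by apply: zdfun_derive => //; [exact: zdef_obox|move=> x; exact: smooth_derivable sF0].
  pose G (w : 'rV[R]_m.+2) := (rinit w 0 ord_max <> 0 /\ rinit w 0 ord_max * w 0 ord_max = F0 (rinit w)) \/
     (rinit w 0 ord_max = 0 /\ w 0 ord_max = D (rinit w)).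
  apply: (zdfun_graph (G := G)); first exact: zdef_obox.
    have M : zdmap E (fun v : 'rV[R]_m.+2 => rinit v) by apply: zdmap_rinit; exact: zdmap_id.
    have P1 : zdfun E (fun v : 'rV[R]_m.+2 => v 0 ord_max) by exact: zdfun_proj.
    have P2 := M ord_max.
    have Z := zdef_eq P2 (zdfun0 _ _).
    apply: zdef_or; apply: zdef_and => //.
    - exact: zdef_not.
    - by apply: zdef_eq; [exact: zdfun_mul|exact: zdfun_app dF0 M].
  move=> v y Wv; rewrite /G rinit_snoc snoc_last /D patchE mem_set//.
  have [v0|v0] := eqVneq (v 0 ord_max) 0.
    by rewrite gD//; split; [case=> -[]|move=> ->; right].
  split.
    case=> [[_]|[/eqP]]; last by rewrite (negbTE v0).
    by rewrite Fg//; exact: mulfI.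
  by move=> ->; left; split; [exact/eqP|rewrite Fg].
exists (g \_ W).
  exists s, (g \_ W); split => // k; apply: Ck_ext (sg k) => // x Wx.
  by rewrite patchE mem_set.
move=> x rx; have Wx : W x by exact: box_obox rx.
have bl : box r (lscale 0 x).
  move=> i; rewrite lweightE normrM; apply: le_trans (rx i).
  have /andP[w0 w1] : 0 <= lweight (0 : R) i <= 1 by apply: lweight01; rewrite lexx ler01.
  by rewrite ler_piMl// ger0_norm.
rewrite patchE mem_set// -Fg// /F0 -(fF _ rx) -(fF _ bl) (f0 _ bl) ?subr0//.
by rewrite lscale_last mul0r.
Qed.

(** The one-sided difference quotients inside the box form a proper filter,
    because the box has positive radii; so they have the same limit as the
    two-sided quotients of an extension. *)
Lemma pderivE n (r : 'rV[rat]_n) (f F : 'rV[R]_n -> R) i x :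
  pos_radius r -> (forall z, box r z -> f z = F z) -> box r x ->
  derivable F x ('e_i) -> pderiv r i f x = 'D_('e_i) F x.
Proof.
move=> r0 fF rx dF; rewrite /pderiv.
set D := [set h : R | box r (h *: delta_mx 0 i + x)].
have PF : ProperFilter (within D (0 : R)^').
  apply: Build_ProperFilter => -[e /= e0 eA].
  (* moving towards the centre stays inside the box *)
  pose sg : R := if 0 <= x 0 i then -1 else 1.
  have ri : 0 < ratr (r 0 i) :> R by rewrite ltr0q; exact: r0.
  pose h := sg * Num.min (e / 2) (ratr (r 0 i)).
  have m0 : 0 < Num.min (e / 2) (ratr (r 0 i)) :> R by rewrite lt_min divr_gt0.
  have sg1 : `|sg| = 1 by rewrite /sg; case: ifP => _; rewrite ?normrN normr1.
  apply: (eA h).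
  - rewrite /= sub0r normrN /h normrM sg1 mul1r gtr0_norm//.
    by rewrite gt_min; apply/orP; left; lra.
  - by apply: mulf_neq0; [rewrite -normr_gt0 sg1|rewrite gt_eqF].
  move=> k; rewrite !mxE eqxx /=; have [->|_] := eqVneq k i; last first.
    by rewrite mulr0 add0r; exact: rx.
  rewrite mulr1 /h /sg; have := rx i; have [x0|x0] := leP 0 (x 0 i).
    have : Num.min (e / 2) (ratr (r 0 i)) <= ratr (r 0 i) :> R by rewrite ge_min lexx orbT.
    by rewrite mulN1r !ler_norml => H /andP[h1 h2]; apply/andP; split; lra.
  have : Num.min (e / 2) (ratr (r 0 i)) <= ratr (r 0 i) :> R by rewrite ge_min lexx orbT.
  by rewrite mul1r !ler_norml => H /andP[h1 h2]; apply/andP; split; lra.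
apply: cvg_lim => //.
have H : (fun h : R => h^-1 * (F (h *: delta_mx 0 i + x) - F x)) @ (within D (0 : R)^') --> 'D_('e_i) F x.
  by apply: cvg_within_filter; exact: dF.
apply: cvg_trans H; apply: near_eq_cvg.
apply: (@filterS _ (within D (0 : R)^') _ D); last exact: withinT.
by move=> h Dh /=; rewrite !fF.
Qed.

(** After thickening the boxes the conditions IF still hold for the extension
    F, which provides the implicit function on a larger box; uniqueness of the
    root identifies it with g on [-r, r]. *)
Lemma Csys_implicit m (r : 'rV[rat]_m) (s : rat) (f : 'rV[R]_m.+1 -> R)
      (g : 'rV[R]_m -> R) :
    pos_radius r -> 0 < s -> Csys (snoc r s) f -> IF_condition r s f ->
    (forall x, box r x -> - ratr s < g x < ratr s /\ f (snoc x (g x)) = 0) ->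
    Csys r g.
Proof.
move=> r0 s0 [s' [F0 [ss dF0 sF0 fF0]]] [sigma sigmaE [Hd Hs]] gP.
have rs0 : pos_radius (snoc r s).
  by rewrite /pos_radius; apply: ord_snocP => [|j]; rewrite ?snoc_last// snoc_lift.
have bs x (y : R) : box r x -> - ratr s <= y <= ratr s -> box (snoc r s) (snoc x y).
  move=> rx ys; apply: ord_snocP => [|j]; first by rewrite !snoc_last ler_norml.
  by rewrite !snoc_lift; exact: rx.
have ps0 : 0 < ratr s :> R by rewrite ltr0q.
pose F z := sigma * F0 z.
have dsigma n : zdfun E (fun _ : 'rV[R]_n => sigma).
  by case: sigmaE => ->; [exact: zdfun1|apply: zdfun_opp; exact: zdfun1].
have sig0 : sigma != 0 by case: sigmaE => ->; rewrite ?oppr_eq0 oner_eq0.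
have dF : zdfun E F by exact: zdfun_mul.
have oS : open (obox s' : set 'rV[R]_m.+1) by exact: obox_open.
have sF : smooth (obox s') F.
  by move=> k; apply: Ck_mul => //; exact: Ck_cst.
pose O1 := [set z | obox s' z /\ 0 < 'D_('e_ord_max) F z].
have oO1 : open O1.
  apply: real_cont_open_gt => // x Ox.
  by apply: (smooth_continuous oS _ Ox); exact: smooth_derive.
have rO1 : box (snoc r s) `<=` O1.
  move=> z rz; have Oz : obox s' z by exact: box_obox rz.
  split => //.
  have dz := smooth_derivable (i := ord_max) sF0 Oz.
  have -> : 'D_('e_ord_max) F z = sigma * 'D_('e_ord_max) F0 z.
    by rewrite /F deriveMl.
  by rewrite -(pderivE rs0 fF0)//; exact: Hd.
have [t [st tO1]] := box_thicken rs0 oO1 rO1.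
have ts : s < t 0 ord_max by have := st ord_max; rewrite snoc_last.
pose V0 : set 'rV[R]_m := obox (rinit t).
have oV0 : open V0 by exact: obox_open.
have rV0 : box r `<=` V0.
  by apply: box_obox => i; have := st (lift ord_max i); rewrite snoc_lift mxE.
have V0O x (y : R) : V0 x -> - ratr s <= y <= ratr s -> O1 (snoc x y).
  move=> Vx ys; apply: tO1; apply: ord_snocP => [|j].
    rewrite snoc_last; apply: (@le_trans _ _ (ratr s)); first by rewrite ler_norml.
    by rewrite ler_rat ltW.
  by rewrite snoc_lift; have := Vx j; rewrite mxE => /ltW.
have sF1 : smooth O1 F by apply: smooth_subset sF => z [].
have cF (y : R) (x : 'rV[R]_m) : - ratr s <= y <= ratr s -> V0 x -> {for x, continuous (fun z => F (snoc z y))}.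
  move=> ycd Vx; apply: continuous_comp; first exact: snoc_continuous.
  by apply: (smooth_continuous oO1 sF1); exact: V0O.
pose V1 := [set x | V0 x /\ 0 < F (snoc x (ratr s))].
have oV1 : open V1 by apply: real_cont_open_gt => // x Vx; apply: cF => //; lra.
pose V2 := [set x | V1 x /\ 0 < - F (snoc x (- ratr s))].
have oV2 : open V2.
  apply: (real_cont_open_gt (g := fun x => - F (snoc x (- ratr s)))) => // x [Vx _].
  by apply: (@continuousN _ R^o); apply: cF => //; lra.
have rV2 : box r `<=` V2.
  move=> x rx; have [H1 H2] := Hs x rx.
  rewrite !fF0 in H1 H2; [|by apply: bs => //; lra..].
  by split; [split => //; exact: rV0|rewrite oppr_gt0].
have [r' [rr' r'V2]] := box_thicken r0 oV2 rV2.
pose V : set 'rV[R]_m := obox r'.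
have oV : open V by exact: obox_open.
have VV2 : V `<=` V2 by move=> x /obox_box/r'V2.
have cd : - ratr s < ratr s :> R by lra.
have VO x y : V x -> - ratr s <= y <= ratr s -> O1 (snoc x y).
  by move=> /VV2[[Vx _] _]; exact: V0O.
have Vd x y : V x -> - ratr s <= y <= ratr s -> 0 < 'D_('e_ord_max) F (snoc x y).
  by move=> Vx ys; have [] := VO x y Vx ys.
have VF x : V x -> F (snoc x (- ratr s)) < 0 < F (snoc x (ratr s)).
  by move=> /VV2[[_ ->]]; rewrite oppr_gt0 andbT.
have ex x : exists y, V x -> - ratr s <= y <= ratr s /\ F (snoc x y) = 0.
  have [Vx|nV] := pselect (V x); last by exists 0.
  have [y /andP[cy yd] Fy] := implicit_exists sF1 cd VO VF Vx.
  by exists y => _; rewrite !ltW.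
have [h hP] := choice ex.
have hcd x : V x -> - ratr s <= h x <= ratr s by move=> /hP[].
have Fh x : V x -> F (snoc x (h x)) = 0 by move=> /hP[].
have sh : smooth V h by exact: (implicit_smooth oV oO1 sF1 cd VO Vd VF hcd Fh).
have huniq x y : V x -> - ratr s <= y <= ratr s -> F (snoc x y) = 0 -> y = h x.
  move=> Vx ys Fy; apply: (implicit_inj sF1 VO Vd Vx ys (hcd x Vx)).
  by rewrite Fy Fh.
exists r', (h \_ V); split => //.
- pose G (w : 'rV[R]_m.+1) := (- ratr s <= w 0 ord_max /\ w 0 ord_max <= ratr s) /\ F w = 0.
  apply: (zdfun_graph (G := G)); first exact: zdef_obox.
    have P1 : zdfun E (fun v : 'rV[R]_m.+1 => v 0 ord_max) by exact: zdfun_proj.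
    apply: zdef_and; last exact: zdef_eq dF (zdfun0 _ _).
    apply: zdef_and; apply: zdef_le => //; last exact: zdfun_rat.
    by apply: zdfun_opp; exact: zdfun_rat.
  move=> v y Vv; rewrite /G snoc_last; split.
    by move=> [/andP ys Fy]; exact: huniq.
  by move=> ->; split; [apply/andP; exact: hcd|exact: Fh].
- move=> k; apply: Ck_ext (sh k) => // x Vx.
  by rewrite patchE mem_set.
- move=> x rx; have Vx : V x by exact: box_obox rx.
  rewrite patchE mem_set//.
  have [/andP[g1 g2] fg] := gP x rx.
  have gs : - ratr s <= g x <= ratr s by rewrite !ltW.
  by apply: huniq => //; rewrite /F -fF0 ?fg ?mulr0//; exact: bs.
Qed.

Lemma Csys_if_system : if_system Csys.
Proof.
split.
- by move=> n r f g r0 fg [s [h [rs dh sh fh]]]; exists s, h; split => // x rx; rewrite -fg// fh.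
- move=> n r f r0 [s [h [rs dh sh fh]]] a ra; exists (obox s), h; split => //.
  + exact: obox_open.
  + exact: box_obox ra.
  + by move=> x rx _; exact: fh.
- have CE (c : R) : (c \in [pred c : R | cst c \in Csys (0 : 'rV_0)]) <-> zdfun E (fun _ : 'rV[R]_0 => c).
    change ((cst c \in (Csys (0 : 'rV_0) : set ('rV[R]_0 -> R))) <-> zdfun E (fun _ : 'rV[R]_0 => c)).
    split; first by move=> /set_mem/Csys_const0.
    by move=> dc; apply/mem_set; exact: Csys_const.
  split; first by apply/CE; exact: zdfun1.
    by move=> x y /CE dx /CE dy; apply/CE; exact: zdfun_sub.
  by move=> x y /CE dx /CE dy; apply/CE; apply: zdfun_mul => //; exact: zdfun_inv.
- move=> n r n0 r0; split.
  + by apply: Csys_const; exact: zdfun1.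
  + move=> f g; apply: (@Csys_op2 (fun x y => x - y)) => [*|*]; first exact: zdfun_sub.
    exact: Ck_sub.
  + move=> f g; apply: (@Csys_op2 (fun x y => x * y)) => [*|*]; first exact: zdfun_mul.
    exact: Ck_mul.
- by move=> n r i _ _; exact: Csys_coord.
- by move=> n r f _ _; exact: Csys_extend.
- by move=> m n r s g f r0 _; exact: Csys_comp.
- exact: Csys_div.
- exact: Csys_implicit.
Qed.

End System.

(** * Flat definable functions of one variable vanish *)

Section OneVariable.
Variables (R : realType) (E : expansion R).

(** An interval that meets every (a, a + e) contains some (a, a + e), by
    convexity. *)
Lemma itv_germ (I : interval R) (a : R) :
  exists2 e : R, 0 < e & (forall t, a < t < a + e -> t \in I) \/
                         (forall t, a < t < a + e -> t \notin I).
Proof.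
have [H|nH] := pselect (exists2 e : R, 0 < e & forall t, a < t < a + e -> t \notin I).
  by have [e e0 eP] := H; exists e => //; right.
have inI (e : R) : 0 < e -> exists2 t, a < t < a + e & t \in I.
  move=> e0; apply: contrapT => nt; apply: nH; exists e => // t te.
  by apply/negP => tI; apply: nt; exists t.
have [t0 /andP[at0 _] t0I] := inI 1 ltr01.
exists (t0 - a); first by rewrite subr_gt0.
left=> t; rewrite addrC subrK => /andP[at_ tt0].
have ta : 0 < t - a by rewrite subr_gt0.
have [t1] := inI _ ta; rewrite addrC subrK => /andP[_ t1t] t1I.
have := @interval_is_interval R I t1 t0; rewrite /= => H.
by apply: H => //; rewrite !ltW.
Qed.

Lemma has_germ (s : seq (interval R)) (a : R) :
  exists2 e : R, 0 < e & (forall t, a < t < a + e -> has (fun I => t \in I) s) \/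
                         (forall t, a < t < a + e -> ~~ has (fun I => t \in I) s).
Proof.
elim: s => [|I s [e e0 IH]]; first by exists 1 => //; right.
have [d d0 Id] := itv_germ I a.
have m0 : 0 < Num.min e d by rewrite lt_min e0.
have le_e t : a < t < a + Num.min e d -> a < t < a + e.
  by move=> /andP[-> H] /=; apply: lt_le_trans H _; rewrite lerD2l ge_min lexx.
have le_d t : a < t < a + Num.min e d -> a < t < a + d.
  by move=> /andP[-> H] /=; apply: lt_le_trans H _; rewrite lerD2l ge_min lexx orbT.
exists (Num.min e d) => //.
case: Id => Id; first by left=> t /le_d/Id /= ->.
case: IH => IH; first by left=> t /le_e/IH /= ->; rewrite orbT.
by right=> t td /=; rewrite negb_or Id ?IH//; [exact: le_e|exact: le_d].
Qed.

Hypothesis omin : o_minimal E.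

(** The form in which o-minimality is used throughout: a definable condition on a
    real t, with parameters c, is constant for t slightly larger than a. *)
Lemma zdef_germ k (P : 'rV[R]_(k + 1) -> Prop) (c : 'rV[R]_k) (a : R) : zdef E P ->
  exists2 e : R, 0 < e & (forall t, a < t < a + e -> P (row_mx c (const_mx t))) \/
                         (forall t, a < t < a + e -> ~ P (row_mx c (const_mx t))).
Proof.
move=> /(definable_fiber c)/omin[s sP].
have PE (t : R) : P (row_mx c (const_mx t)) <-> has (fun I => t \in I) s.
  have : [set v : 'rV[R]_1 | P (row_mx c v)] (const_mx t) <->
     [set v : 'rV[R]_1 | has (fun I => v 0 0 \in I) s] (const_mx t) by rewrite sP.
  by rewrite /= mxE.
have [e e0 eP] := has_germ s a; exists e => //.
by case: eP => eP; [left=> t /eP/PE|right=> t /eP/negP H /PE].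
Qed.

Hypothesis pbnd : polynomially_bounded E.

Variables (n : nat) (u : 'rV[R]_n -> R).
Hypothesis du : zdfun E u.

Let line (w : 'rV[R]_(n + n)) (t : R) : 'rV[R]_n := t *: rsubmx w + lsubmx w.

Lemma zdmap_line m (G : 'rV[R]_m -> 'rV[R]_(n + n)) (t : 'rV[R]_m -> R) :
  zdmap E G -> zdfun E t -> zdmap E (fun v => line (G v) (t v)).
Proof.
move=> dG dt i.
apply: (zdfun_ext (f := fun v => t v * rsubmx (G v) 0 i + lsubmx (G v) 0 i)).
  by move=> v; rewrite [RHS]mxE [X in _ = X + _]mxE.
apply: zdfun_add; last exact: (zdmap_lsubmx dG).
by apply: zdfun_mul => //; exact: (zdmap_rsubmx dG).
Qed.

(** Otherwise u (t v + x) has no zero for small t > 0 and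
    t |-> 1 / |u (t^-1 v + x)| is a definable function that dominates every
    power of t. *)
Lemma flat_zero (x v : 'rV[R]_n) :
  (forall N : nat, exists C d : R, [/\ 0 < C, 0 < d &
     forall t, 0 < t < d -> `|u (t *: v + x)| <= C * t ^+ N]) ->
  exists2 e : R, 0 < e & forall t, 0 < t < e -> u (t *: v + x) = 0.
Proof.
move=> flat; pose c := row_mx x v.
have lineE t : line c t = t *: v + x by rewrite /line row_mxKl row_mxKr.
have zP : zdef E (fun w : 'rV[R]_(n + n + 1) => u (line (lsubmx w) (w 0 (rshift (n + n) 0))) = 0).
  apply: zdef_eq; last exact: zdfun0.
  apply: (zdfun_app du); apply: zdmap_line; last exact: zdfun_proj.
  by apply: zdmap_lsubmx; exact: zdmap_id.
have [e e0] := zdef_germ c 0 zP.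
case=> H; exists e => // t te; have := H t; rewrite add0r => /(_ te);
  rewrite row_mxKl row_mxEr mxE lineE // => _.
exfalso; clear t te.
have {}H t : 0 < t < e -> u (t *: v + x) <> 0.
  by have := H t; rewrite add0r row_mxKl row_mxEr mxE lineE.
pose F (t : R) := (`|u (t^-1 *: v + x)|)^-1.
have [|M [N [M0 N0 MN]]] := pbnd (f := F).
  pose Q (w : 'rV[R]_(n + n + 2)) := w 0 (rshift (n + n) ord_max) =
    (`|u (line (lsubmx w) (w 0 (rshift (n + n) ord0))^-1)|)^-1.
  have zQ : zdef E Q.
    apply: zdef_eq; first exact: zdfun_proj.
    apply/zdfun_inv/zdfun_norm/(zdfun_app du)/zdmap_line; last exact/zdfun_inv/zdfun_proj.
    by apply: zdmap_lsubmx; exact: zdmap_id.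
  have := definable_fiber c zQ; congr (definable E _).
  apply/seteqP; split => w /=; by rewrite /Q row_mxKl !row_mxEr lineE.
(* t^k dominates the polynomial bound, while flatness to order k + 1 gives the lower bound t^(k+1) / C *)
have [k Nk] : exists k : nat, N <= k%:R.
  by exists (Num.truncn N).+1; rewrite ltW// truncnS_gt.
have [C [d [C0 d0 Cd]]] := flat k.+1.
pose t := M + d^-1 + e^-1 + C + 1.
have d'0 : 0 < d^-1 by rewrite invr_gt0.
have e'0 : 0 < e^-1 by rewrite invr_gt0.
have tM : M < t by rewrite /t; lra.
have t1 : 1 <= t by rewrite /t; lra.
have t0 : 0 < t by lra.
have td : t^-1 < d by rewrite invf_plt ?posrE// /t; lra.
have te : t^-1 < e by rewrite invf_plt ?posrE// /t; lra.
have tC : C < t by rewrite /t; lra.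
have ti0 : 0 < t^-1 by rewrite invr_gt0.
have u0 : u (t^-1 *: v + x) <> 0 by apply: H; rewrite ti0.
have up : 0 < `|u (t^-1 *: v + x)| by rewrite normr_gt0; exact/eqP.
have Fb := MN t tM.
have ub : `|u (t^-1 *: v + x)| <= C * t^-1 ^+ k.+1 by apply: Cd; rewrite ti0.
have : t `^ N <= t ^+ k by rewrite -powR_mulrn; [exact: ler_powR|exact: ltW].
move=> H1; have := le_trans Fb H1; rewrite /F normrV ?unitfE ?normr_eq0 ?normr_id; last exact/eqP.
rewrite invf_ple ?posrE ?exprn_gt0// => H2.
have := le_trans H2 ub; rewrite exprVn exprSr invfM mulrA ler_pdivlMr//.
rewrite mulrC ler_pdivlMr ?exprn_gt0//.
rewrite mulfVK ?gt_eqF ?exprn_gt0//.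
by move=> /(lt_le_trans tC); rewrite ltxx.
Qed.

End OneVariable.

(** * Quasianalyticity *)

Section Quasianalytic.
Variables (R : realType) (E : expansion R).
Hypothesis omin : o_minimal E.
Hypothesis pbnd : polynomially_bounded E.

(** Restriction by 0 outside W keeps iterated derivatives 0-definable, as the
    derivative of a definable function is only controlled where it exists. *)
Definition Dres n (W : set 'rV[R]_n) (i : 'I_n) (h : 'rV[R]_n -> R) : 'rV[R]_n -> R :=
  'D_('e_i) h \_ W.

Lemma line_norm n (i : 'I_n) (t : R) (p : 'rV[R]_n) k : `|(t *: 'e_i + p) 0 k - p 0 k| <= `|t|.
Proof.
rewrite !mxE addrK eqxx normrM ler_piMr//.
by case: eqP => _ /=; rewrite ?normr1 ?normr0.
Qed.

Section Line.
Variables (n : nat) (W : set 'rV[R]_n) (i : 'I_n).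
Hypotheses (oW : open W) (zW : zdef E W).

Lemma DresE h x : W x -> Dres W i h x = 'D_('e_i) h x.
Proof. by move=> Wx; rewrite /Dres patchE mem_set. Qed.

Lemma smooth_Dres h : smooth W h -> smooth W (Dres W i h).
Proof. by move=> sh k; apply: Ck_ext (smooth_derive i sh k) => // x /DresE ->. Qed.

Lemma zdfun_Dres h : smooth W h -> zdfun E h -> zdfun E (Dres W i h).
Proof. by move=> sh dh; apply: zdfun_derive => // x; exact: smooth_derivable sh. Qed.

Lemma smooth_iter_Dres h k : smooth W h -> smooth W (iter k (Dres W i) h).
Proof. by move=> sh; elim: k => // k IH; exact: smooth_Dres. Qed.

(** Integrating N times, that is, using the mean value theorem N times. *)
Lemma flat_of_iter w p : smooth W w -> W p -> (forall k, iter k (Dres W i) w p = 0) ->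
  forall N, exists C d : R, [/\ 0 < C, 0 < d &
    forall t : R, `|t| < d -> `|w (t *: 'e_i + p)| <= C * `|t| ^+ N].
Proof.
move=> sw Wp wp N; elim: N w sw wp => [|N IH] w sw wp.
  have /row_contP/(_ _ ltr01)[d d0 dP] := smooth_continuous oW sw Wp.
  exists 1, d; split => // t td; rewrite expr0 mulr1.
  have := wp 0%N => /= w0.
  rewrite -[w _]subr0 -w0 ltW//; apply: dP => k.
  by apply: le_lt_trans (line_norm _ _ _ _) td.
have [|k|C [d [C0 d0 Cd]]] := IH (Dres W i w); first exact: smooth_Dres.
  by rewrite -iterSr.
have [e e0 eW] := (row_openP W).1 oW p Wp.
exists C, (Num.min d e); split => //; first by rewrite lt_min d0.
move=> t; rewrite lt_min => /andP[td te].
have bet (s : R) : Num.min 0 t <= s <= Num.max 0 t -> `|s| <= `|t|.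
  case: (leP 0 t) => t0 /andP[s1 s2]; first by rewrite !ger0_norm.
  by rewrite !ler0_norm ?lerN2// ltW.
have Ws s : `|s| <= `|t| -> W (s *: 'e_i + p).
  move=> st; apply: eW => k; apply: le_lt_trans (line_norm _ _ _ _) _.
  exact: le_lt_trans st te.
have [s /bet st|s /bet st] := @line_mvt _ _ w p ('e_i) t.
  by apply: smooth_derivable sw _; exact: Ws.
have := wp 0%N => /= ->; rewrite subr0 => ->.
rewrite -DresE; last exact: Ws.
rewrite normrM exprSr mulrA ler_wpM2r//.
apply: le_trans (Cd _ (le_lt_trans st td)) _.
by rewrite ler_pM2l// lerXn2r// nnegrE.
Qed.

Lemma Dres_zero_line (O : set R) w p : open O -> (forall s, O s -> w (s *: 'e_i + p) = 0) ->
  forall k s, O s -> iter k (Dres W i) w (s *: 'e_i + p) = 0.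
Proof.
move=> oO w0; elim=> [//|k IH] s Os.
rewrite /= /Dres patchE; case: ifP => // _.
apply: cvg_lim => //.
have : (0 : R) @[h --> (0 : R)^'] --> (0 : R) by exact: cvg_cst.
apply: cvg_trans; apply: near_eq_cvg.
move: oO; rewrite openE => /(_ s Os) /nbhs_ballP[e /= e0 eO].
near=> h; have he : `|h| < e by near: h; exact: dnbhs0_lt.
rewrite /= addrA -scalerDl !IH ?subrr ?scaler0//.
by apply: eO; rewrite /ball /= opprD addrCA subrr addr0 normrN.
Unshelve. all: by end_near.
Qed.

(** The set of t at which all derivatives along the line vanish is closed by
    continuity, and open by [flat_zero] applied in both directions; a segment is
    connected. *)
Lemma line_propagation w x c : zdfun E w -> smooth W w ->
  (forall s : R, Num.min 0 c <= s <= Num.max 0 c -> W (s *: 'e_i + x)) ->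
  (forall k, iter k (Dres W i) w x = 0) -> w (c *: 'e_i + x) = 0.
Proof.
move=> dw sw Wseg wx.
pose A := `[Num.min 0 c, Num.max 0 c]%classic.
pose L : set R := [set t | W (t *: 'e_i + x)].
pose Z : set R := [set t | forall k, iter k (Dres W i) w (t *: 'e_i + x) = 0].
have linec (t : R) (V : set 'rV[R]_n) : nbhs (t *: 'e_i + x) V -> nbhs t [set s : R | V (s *: 'e_i + x)].
  move=> /row_nbhsP[e e0 eV]; apply/nbhs_ballP; exists e => //= s; rewrite /ball /= => ts.
  apply: eV => k; apply: le_lt_trans ts.
  have -> : s *: 'e_i + x = (s - t) *: 'e_i + (t *: 'e_i + x).
    by rewrite addrA -scalerDl subrK.
  by rewrite (distrC t s); exact: line_norm.
have oL : open L.
  by rewrite openE => t Lt; apply: linec; apply: open_nbhs_nbhs.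
have oLZ : open (L `&` Z).
  rewrite openE => t [Lt Zt].
  have flat (v : 'rV[R]_n) : v = 'e_i \/ v = - 'e_i ->
      exists2 e : R, 0 < e & forall s, 0 < s < e -> w (s *: v + (t *: 'e_i + x)) = 0.
    move=> vE; apply: (flat_zero omin pbnd dw) => N.
    have [C [d [C0 d0 Cd]]] := flat_of_iter sw Lt Zt N.
    exists C, d; split => // s /andP[s0 sd].
    case: vE => ->; first by have := Cd s; rewrite gtr0_norm//; exact.
    by rewrite scalerN -scaleNr; have := Cd (- s); rewrite normrN gtr0_norm//; exact.
  have [e1 e10 H1] := flat ('e_i) (or_introl erefl).
  have [e2 e20 H2] := flat (- 'e_i) (or_intror erefl).
  pose e := Num.min e1 e2.
  have e0 : 0 < e by rewrite lt_min e10.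
  have wz (s : R) : `|s - t| < e -> w (s *: 'e_i + x) = 0.
    rewrite /e lt_min => /andP[se1 se2].
    have -> : s *: 'e_i + x = (s - t) *: 'e_i + (t *: 'e_i + x).
      by rewrite addrA -scalerDl subrK.
    have [st|st|st] := ltgtP (s - t) 0.
    - rewrite -[s - t]opprK scaleNr -scalerN; apply: H2.
      by rewrite oppr_gt0 st; rewrite ltr0_norm in se2.
    - by apply: H1; rewrite st; rewrite gtr0_norm in se1.
    - by rewrite st scale0r add0r; exact: (Zt 0%N).
  have oO : open [set s : R | `|s - t| < e].
    have -> : [set s : R | `|s - t| < e] = ball t e by apply/seteqP; split => s; rewrite /ball /= distrC.
    exact: ball_open.
  have Ot : [set s : R | `|s - t| < e] t by rewrite /= subrr normr0.
  apply: filterI; first by apply: open_nbhs_nbhs.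
  apply: (@filterS _ (nbhs t) _ [set s : R | `|s - t| < e]); last exact: open_nbhs_nbhs.
  by move=> s Os k; exact: (Dres_zero_line oO wz).
have oLnZ : open (L `&` ~` Z).
  rewrite openE => t [Lt /existsNP[k /eqP nz]].
  have cw := smooth_continuous oW (smooth_iter_Dres k sw) Lt.
  apply: filterI; first by apply: open_nbhs_nbhs.
  have := linec t [set y | iter k (Dres W i) w y != 0].
  have H : nbhs (t *: 'e_i + x) [set y | iter k (Dres W i) w y != 0].
    have Npos : 0 < `|iter k (Dres W i) w (t *: 'e_i + x)| by rewrite normr_gt0.
    have /row_contP/(_ _ Npos)[d d0 dP] := cw.
    apply/row_nbhsP; exists d => // y /dP; rewrite /=.
    by apply: contraTneq => ->; rewrite sub0r normrN ltxx.
  move=> /(_ H); apply: filterS => s /= /eqP nzs Zs; exact: nzs.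
have AL : A `<=` L by move=> s; rewrite /A /= in_itv /=; exact: Wseg.
have cA : connected A by apply/connected_intervalP; exact: interval_is_interval.
have : A `&` Z = A.
  apply: cA.
  - exists 0; split; first by rewrite /A /= in_itv /= ge_min le_max !lexx.
    by move=> k; rewrite scale0r add0r.
  - exists (L `&` Z) => //; rewrite setIA (_ : A `&` L = A)//; exact: setIidl.
  - exists (~` (L `&` ~` Z)); first exact: open_closedC.
    apply/seteqP; split => s [As].
      by move=> Zs; split => // -[_]; exact.
    by move=> H; split => //; apply: contrapT => nZ; apply: H; split => //; exact: AL.
move=> AZ; have : A c by rewrite /A /= in_itv /= ge_min le_max !lexx !orbT.
by rewrite -AZ => -[_ /(_ 0%N)].
Qed.

End Line.

Section Peel.
Variables (n : nat) (W : set 'rV[R]_n) (r : 'rV[rat]_n).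
Hypotheses (oW : open W) (zW : zdef E W) (rW : box r `<=` W).

(** The restricted counterpart of [mpderiv], for a list of variables. *)
Definition Dmulti (alpha : 'I_n -> nat) (l : seq 'I_n) (h : 'rV[R]_n -> R) :=
  foldr (fun i g => iter (alpha i) (Dres W i) g) h l.

Lemma Dmulti_good alpha l h : zdfun E h -> smooth W h ->
  zdfun E (Dmulti alpha l h) /\ smooth W (Dmulti alpha l h).
Proof.
move=> dh sh; elim: l => [//|i l [IH1 IH2]] /=.
elim: (alpha i) => [//|k [IH3 IH4]] /=; split; first exact: zdfun_Dres.
exact: smooth_Dres.
Qed.

Lemma eq_Dmulti (al be : 'I_n -> nat) l h :
  {in l, al =1 be} -> Dmulti al l h = Dmulti be l h.
Proof.
elim: l => [//|i l IH] H /=; rewrite IH ?H ?mem_head// => j jl.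
by apply: H; rewrite inE jl orbT.
Qed.

(** For l = i :: l', each derivative g of h in the variables l' has vanishing
    iterated derivatives along e_i at a, so g vanishes on the line through a in
    direction e_i; the hypothesis thus holds for l' at every point of this
    line. *)
Lemma peel l h a : uniq l -> zdfun E h -> smooth W h -> box r a ->
  (forall alpha, Dmulti alpha l h a = 0) ->
  forall y, box r y -> (forall i, i \notin l -> y 0 i = a 0 i) -> h y = 0.
Proof.
move=> + dh sh; elim: l a => [|i l IH] a.
  move=> _ ra ha y ry ya; have -> : y = a by apply/rowP => i; exact: ya.
  exact: (ha (fun=> 0%N)).
rewrite cons_uniq => /andP[il ul] ra ha y ry ya.
pose a' : 'rV[R]_n := (y 0 i - a 0 i) *: 'e_i + a.
have a'i : a' 0 i = y 0 i by rewrite !mxE !eqxx mulr1 subrK.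
have a'j j : j != i -> a' 0 j = a 0 j.
  by move=> ji; rewrite !mxE eqxx (negbTE ji) mulr0 add0r.
have ra' : box r a'.
  by move=> j; have [->|ji] := eqVneq j i; [rewrite a'i|rewrite a'j].
apply: (IH a') => //.
  move=> alpha; have [dm sm] := Dmulti_good alpha l dh sh.
  apply: (line_propagation (i := i) (x := a) (c := y 0 i - a 0 i) oW dm sm).
    move=> s sy; apply: rW => j; rewrite !mxE eqxx /=.
    have [->|ji] := eqVneq j i; last by rewrite mulr0 add0r.
    rewrite mulr1; have := ra i; have := ry i; rewrite !ler_norml.
    move: sy; case: (leP 0 (y 0 i - a 0 i)) => H0 /andP[s1 s2] /andP[y1 y2] /andP[a1 a2];
      by apply/andP; split; lra.
  move=> k; pose al j := if j == i then k else alpha j.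
  have := ha al; rewrite -[Dmulti al (i :: l) h]/(iter (al i) (Dres W i) (Dmulti al l h)).
  rewrite (@eq_Dmulti al alpha l h); first by rewrite /al eqxx.
  by move=> j jl; rewrite /al; case: eqP => // ji; rewrite -ji jl in il.
move=> j jl; have [->|ji] := eqVneq j i; first by rewrite a'i.
by rewrite a'j// ya// inE negb_or ji.
Qed.

Hypothesis r0 : pos_radius r.

Lemma mpderiv_Dmulti alpha l f F : smooth W F -> (forall x, box r x -> f x = F x) ->
  forall x, box r x -> foldr (fun i g => iter (alpha i) (pderiv r i) g) f l x = Dmulti alpha l F x.
Proof.
move=> sF fF.
have it i k (g G : 'rV[R]_n -> R) : smooth W G -> (forall x, box r x -> g x = G x) ->
    smooth W (iter k (Dres W i) G) /\
    forall x, box r x -> iter k (pderiv r i) g x = iter k (Dres W i) G x.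
  move=> sG gG; elim: k => [//|k [IH1 IH2]] /=; split; first exact: smooth_Dres.
  move=> x rx; rewrite DresE; last exact: rW.
  apply: pderivE => //; apply: smooth_derivable IH1 _; exact: rW.
suff H : smooth W (Dmulti alpha l F) /\ forall x, box r x ->
    foldr (fun i g => iter (alpha i) (pderiv r i) g) f l x = Dmulti alpha l F x by case: H.
by elim: l => [//|i l [IH1 IH2]] /=; exact: it.
Qed.

Lemma DmultiB alpha l F G : smooth W F -> smooth W G ->
  smooth W (Dmulti alpha l F) /\ smooth W (Dmulti alpha l G) /\
  forall x, W x -> Dmulti alpha l (fun z => F z - G z) x = Dmulti alpha l F x - Dmulti alpha l G x.
Proof.
move=> sF sG; elim: l => [//|i l].
rewrite -![Dmulti alpha (i :: l) _]/(iter (alpha i) (Dres W i) (Dmulti alpha l _)).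
move: (Dmulti alpha l F) (Dmulti alpha l G) (Dmulti alpha l (fun z => F z - G z)) => F' G' H' IH.
elim: (alpha i) => [//|k].
rewrite ![iter k.+1 _ _]/=.
move: (iter k _ F') (iter k _ G') (iter k _ H') => F2 G2 H2 [sF2 [sG2 H2E]].
split; first exact: smooth_Dres.
split; first exact: smooth_Dres.
move=> x Wx; rewrite !DresE//.
have -> : 'D_('e_i) H2 x = 'D_('e_i) (F2 - G2) x.
  by apply: near_eq_derive; apply: (open_near oW Wx).
by rewrite deriveB//; [exact: smooth_derivable sF2 Wx|exact: smooth_derivable sG2 Wx].
Qed.

End Peel.

Lemma Csys_quasianalytic : quasianalytic (Csys E).
Proof.
move=> n r a n0 r0 ra f g [s1 [F [r1 dF sF fF]]] [s2 [G [r2 dG sG gG]]] T x rx.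
pose s : 'rV[rat]_n := \row_i Num.min (s1 0 i) (s2 0 i).
pose W : set 'rV[R]_n := obox s.
have oW : open W by exact: obox_open.
have rW : box r `<=` W by apply: box_obox => i; rewrite mxE lt_min r1 r2.
have sF' : smooth W F by apply: smooth_subset sF; apply: obox_subset => i; rewrite mxE ge_min lexx.
have sG' : smooth W G by apply: smooth_subset sG; apply: obox_subset => i; rewrite mxE ge_min lexx orbT.
have sH : smooth W (fun z => F z - G z) by move=> k; exact: Ck_sub.
rewrite fF// gG//; apply/eqP; rewrite -subr_eq0; apply/eqP.
apply: (peel oW (zdef_obox E s) rW (l := enum 'I_n) (h := fun z => F z - G z) (a := a)) => //.
- exact: enum_uniq.
- exact: zdfun_sub.
- move=> alpha; have [_ [_ ->]] := DmultiB oW alpha (enum 'I_n) sF' sG'; last exact: rW.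
  have := congr1 (fun T => T alpha) T; rewrite /taylor /mpderiv.
  rewrite (mpderiv_Dmulti oW rW r0 _ _ sF' fF)// (mpderiv_Dmulti oW rW r0 _ _ sG' gG)//.
  set m := _%:R => /eqP; have m0 : m != 0 :> R.
    rewrite pnatr_eq0 -lt0n; apply: prodn_gt0 => i; exact: fact_gt0.
  by rewrite -subr_eq0 -mulrBl mulf_eq0 invr_eq0 (negbTE m0) orbF => /eqP.
- by move=> i; rewrite mem_enum.
Qed.

End Quasianalytic.

(** * Manifolds as graphs over coordinate subspaces *)

Section Charts.
Variable R : realType.

Definition upd n (u : 'rV[R]_n) (j : 'I_n) (t : R) : 'rV[R]_n :=
  \row_l (if l == j then t else u 0 l).

Lemma upd_same n (u : 'rV[R]_n) j t : upd u j t 0 j = t.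
Proof. by rewrite mxE eqxx. Qed.

Lemma upd_other n (u : 'rV[R]_n) j t l : l != j -> upd u j t 0 l = u 0 l.
Proof. by move=> /negbTE lj; rewrite mxE lj. Qed.

Lemma upd_upd n (u : 'rV[R]_n) j s t : upd (upd u j s) j t = upd u j t.
Proof. by apply/rowP => l; rewrite !mxE; case: eqP. Qed.

Lemma upd_id n (u : 'rV[R]_n) j : upd u j (u 0 j) = u.
Proof. by apply/rowP => l; rewrite !mxE; case: eqP => [->|]. Qed.

(** A smooth parametrization phi : U -> M whose image is a neighbourhood of a
    in M, together with a smooth left inverse psi defined on an open subset of
    the ambient space.  Keeping psi in the data replaces any condition on the
    rank of phi and is easily updated in [chart_step]. *)
Definition local_chart n d (M : set 'rV[R]_n) (a : 'rV[R]_n) (U : set 'rV[R]_d)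
    (N : set 'rV[R]_n) (phi : 'rV[R]_d -> 'rV[R]_n) (psi : 'rV[R]_n -> 'rV[R]_d) :=
  [/\ open U, open N /\ N a,
      (forall i, smooth U (fun u => phi u 0 i)) /\ (forall j, smooth N (fun z => psi z 0 j)),
      (forall u, U u -> [/\ M (phi u), N (phi u) & psi (phi u) = u]) &
      (forall z, M z -> N z -> U (psi z) /\ phi (psi z) = z)].

Lemma smooth_on_local n (A : set 'rV[R]_n) m (f : 'rV[R]_n -> 'rV[R]_m) a :
  smooth_map_on A f -> A a -> exists (O : set 'rV[R]_n) (g : 'rV[R]_n -> 'rV[R]_m),
   [/\ open O, O a, forall j, smooth O (fun x => g x 0 j) & forall x, A x -> O x -> f x = g x].
Proof.
move=> sf Aa; have H j := sf j a Aa.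
have [V] := choice H; move=> /choice[g gP].
exists [set x | forall j, V j x], (fun x => \row_j g j x); split.
- by apply: open_all_fin => j; have [] := gP j.
- by move=> j; have [] := gP j.
- move=> j; have -> : (fun x => (\row_j0 g j0 x) 0 j) = g j by apply/funext => x; rewrite mxE.
  by move=> k; have [_ _ /(_ k) + _] := gP j; apply: Ck_subset => x; exact.
- move=> x Ax Ox; apply/rowP => j; rewrite mxE.
  by have [_ _ _] := gP j; apply.
Qed.

Lemma smooth_on_open n (U : set 'rV[R]_n) (f : 'rV[R]_n -> R) : open U ->
  smooth_on U f -> smooth U f.
Proof.
move=> oU sf k; apply: Ck_local => x Ux.
have [V [g [oV Vx sg fg]]] := sf x Ux.
exists (U `&` V); split => //; first exact: openI.
apply: (Ck_ext (f := g)); first exact: openI.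
  by move=> z [Uz Vz]; rewrite fg.
by apply: Ck_subset (sg k) => z [].
Qed.

Lemma manifold_local_chart n d (M : set 'rV[R]_n) a : smooth_manifold d M -> M a ->
  exists U N phi psi, @local_chart n d M a U N phi psi.
Proof.
move=> + Ma => /(_ a Ma)[W [U [phi [psi [[oW Wa] oU phiU psiphi [sphi spsi]]]]]].
have phiMW u : U u -> M (phi u) /\ W (phi u).
  by move=> Uu; have : (phi @` U) (phi u); [exists u|rewrite phiU].
have [V [Psi [oV Va sPsi psiE]]] := smooth_on_local spsi (conj Ma Wa).
have sphi' i : smooth U (fun u => phi u 0 i) by apply: smooth_on_open.
have cphi i x : U x -> {for x, continuous (fun z => phi z 0 i)}.
  exact: smooth_continuous.
pose U' := [set u | U u /\ (W `&` V) (phi u)].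
have oU' : open U' by apply: (row_cont_open (g := phi) oU (openI oW oV)).
pose N := [set z | (W `&` V) z /\ U' (Psi z)].
have oN : open N.
  apply: (row_cont_open (g := Psi) (openI oW oV) oU') => i x [_ Vx].
  exact: (smooth_continuous oV (sPsi i)).
have MV z : M z -> W z -> V z -> U' (Psi z) /\ phi (Psi z) = z.
  move=> Mz Wz Vz; have : (M `&` W) z by [].
  rewrite -phiU => -[u Uu uz].
  have -> : Psi z = u by rewrite -psiE// -uz psiphi.
  by split => //; split => //; rewrite uz.
exists U', N, phi, Psi; split => //.
- by split => //; split => //; have [] := MV a Ma Wa Va.
- split=> [i|j]; first by apply: smooth_subset (sphi' i) => u [].
  by apply: smooth_subset (sPsi j) => z [[]].
- move=> u [Uu [Wu Vu]]; have [Mu _] := phiMW u Uu.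
  have [U'u phiu] := MV _ Mu Wu Vu.
  have E : Psi (phi u) = u by rewrite -psiE// psiphi.
  by split => //; split.
- by move=> z Mz [[Wz Vz] _]; exact: MV.
Qed.

Section ChartStep.
Variables (n d : nat) (M : set 'rV[R]_n) (a : 'rV[R]_n).

(** psi o phi = id has derivative 1 in u_j, which the chain rule forbids if all
    the components of phi have derivative 0 in u_j. *)
Lemma chart_rank U N phi psi (j : 'I_d) : M a -> local_chart M a U N phi psi ->
  exists i, 'D_('e_j) (fun u => phi u 0 i) (psi a) != 0.
Proof.
move=> Ma [oU [oN Na] [sphi spsi] HU HN].
have [Ua phia] := HN a Ma Na.
apply: contrapT => nex.
have D0 i : 'D_('e_j) (fun u => phi u 0 i) (psi a) = 0.
  by apply/eqP/negPn/negP => Di; apply: nex; exists i.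
have dphi i : is_derive (psi a) ('e_j) (fun u => phi u 0 i) 0.
  by split; [exact: smooth_derivable (sphi i) Ua|exact: D0].
have := @chain_rule R _ n (fun z => psi z 0 j) phi (psi a) ('e_j) (fun=> 0).
rewrite phia; case=> [|i|_].
- by apply: (open_near oN Na) => z Nz i; exact: smooth_derivable (spsi j) Nz.
- by apply: (smooth_continuous oN _ Na); exact: smooth_derive (spsi j).
rewrite big1 => [|i _]; last by rewrite mulr0.
have -> : 'D_('e_j) (fun z => psi (phi z) 0 j) (psi a) = 'D_('e_j) (fun u : 'rV[R]_d => u 0 j) (psi a).
  by apply: near_eq_derive; apply: (open_near oU Ua) => u /HU[_ _ ->].
have [_ ->] := is_derive_coord j (psi a) ('e_j).
by rewrite mxE !eqxx => /eqP; rewrite oner_eq0.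
Qed.

(** Measures the progress of [chart_step]: for k = d the chart is a graph. *)
Definition normalized (k : nat) (U : set 'rV[R]_d) (phi : 'rV[R]_d -> 'rV[R]_n) :=
  forall j : 'I_d, (j < k)%N -> exists i, forall u, U u -> phi u 0 i = u 0 j.

(** Choose a component phi_i with D_j0 phi_i <> 0 and take its value as the new
    j0-th parameter.  This changes one parameter only, so it requires one scalar
    implicit function, and the parameters that already are coordinates remain
    so. *)
Lemma chart_step U N phi psi (j0 : 'I_d) : M a -> local_chart M a U N phi psi ->
  normalized j0 U phi ->
  exists U' N' phi' psi', local_chart M a U' N' phi' psi' /\ normalized j0.+1 U' phi'.
Proof.
move=> Ma ch nU; have [i Di] := chart_rank j0 Ma ch.
have [oU [oN Na] [sphi spsi] HU HN] := ch.
have [Ua phia] := HN a Ma Na.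
pose u0 := psi a; pose v0 := upd u0 j0 (a 0 i); pose t0 := u0 0 j0.
(* w = (v, t) stands for the new parameters v and the old j0-th parameter t *)
pose L (w : 'rV[R]_d.+1) := upd (rinit w) j0 (w 0 ord_max).
pose F (w : 'rV[R]_d.+1) := phi (L w) 0 i - rinit w 0 j0.
pose Om : set 'rV[R]_d.+1 := [set w | setT w /\ U (L w)].
have cL l k : Ck k setT (fun w => L w 0 l).
  have [->|lj] := eqVneq l j0.
    apply: (Ck_ext (f := fun w : 'rV[R]_d.+1 => w 0 ord_max)); first exact: openT.
      by move=> w _; rewrite upd_same.
    by apply: Ck_coord; exact: openT.
  apply: (Ck_ext (f := fun w : 'rV[R]_d.+1 => w 0 (lift ord_max l))); first exact: openT.
    by move=> w _; rewrite upd_other// mxE.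
  by apply: Ck_coord; exact: openT.
have oOm : open Om.
  apply: (row_cont_open (g := L) openT oU) => l x _.
  by apply: (smooth_continuous openT) => // k; exact: cL.
have L0 : L (snoc v0 t0) = u0.
  by rewrite /L rinit_snoc snoc_last /v0 upd_upd upd_id.
have sF : smooth Om F.
  move=> k; apply: Ck_sub => //.
    have LE w : L w = \row_l L w 0 l by apply/rowP => l; rewrite mxE.
    apply: (Ck_ext (f := fun w => phi (\row_l (fun l w => L w 0 l) l w) 0 i)) => //.
      by move=> w _; rewrite -LE.
    apply: (Ck_comp (f := fun u => phi u 0 i) oOm oU) => [w [_ Uw]||l].
    - by rewrite -LE.
    - exact: sphi.
    - by apply: Ck_subset (cL l k).
  apply: (Ck_ext (f := fun w : 'rV[R]_d.+1 => w 0 (lift ord_max j0))) => //.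
    by move=> w _; rewrite mxE.
  exact: Ck_coord.
have Om0 : Om (snoc v0 t0) by split => //; rewrite L0.
have F0 : F (snoc v0 t0) = 0 by rewrite /F L0 rinit_snoc /v0 upd_same phia subrr.
have DF : 'D_('e_ord_max) F (snoc v0 t0) != 0.
  have -> // : 'D_('e_ord_max) F (snoc v0 t0) = 'D_('e_j0) (fun u => phi u 0 i) u0.
  have FE : (fun h : R => h^-1 *: (F (h *: 'e_ord_max + snoc v0 t0) - F (snoc v0 t0))) =
     (fun h : R => h^-1 *: (phi (h *: 'e_j0 + u0) 0 i - phi u0 0 i)).
    apply/funext => h; congr (_ *: _).
    have -> : h *: 'e_ord_max + snoc v0 t0 = snoc v0 (h + t0).
      by rewrite (snoc_addlast v0 t0 (h + t0)) addrK.
    rewrite /F L0 !rinit_snoc /L rinit_snoc snoc_last opprB addrA subrK.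
    congr (phi _ 0 i - _); apply/rowP => l; rewrite !mxE eqxx /=.
    by case: eqP => [->|_]; rewrite ?mulr1// mulr0 add0r.
  by rewrite /derive /shift /comp /= FE.
have [V [c [e [th [oV Vv0 /andP[ct te] sth thP]]]]] := implicit_local oOm sF Om0 F0 DF.
pose w (v : 'rV[R]_d) := upd v j0 (th v).
have thce v : V v -> c <= th v <= e.
  by move=> /thP[/andP[? ?] _ _]; rewrite !ltW.
have Uw v : V v -> U (w v).
  move=> Vv; have [_ _ H] := thP v Vv.
  by have [[_]] := H _ (thce v Vv); rewrite /L rinit_snoc snoc_last.
have Fw v : V v -> phi (w v) 0 i = v 0 j0.
  move=> Vv; have [_ + _] := thP v Vv; rewrite /F /L rinit_snoc snoc_last.
  by move/eqP; rewrite subr_eq0 => /eqP.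
pose psi' z := upd (psi z) j0 (z 0 i).
have spsi' l : smooth N (fun z => psi' z 0 l).
  move=> k; have [->|lj] := eqVneq l j0.
    apply: (Ck_ext (f := fun z : 'rV[R]_n => z 0 i)) => //; last exact: Ck_coord.
    by move=> z _; rewrite upd_same.
  by apply: Ck_ext (spsi l k) => // z _; rewrite upd_other.
pose N1 := [set z | N z /\ V (psi' z)].
have oN1 : open N1.
  by apply: (row_cont_open (g := psi') oN oV) => l x Nx; exact: (smooth_continuous oN (spsi' l)).
pose N' := [set z | N1 z /\ c < psi z 0 j0 < e].
have oN' : open N'.
  by apply: real_cont_open => // x [Nx _]; exact: (smooth_continuous oN (spsi j0)).
have N'N : N' `<=` N by move=> z [[]].
exists V, N', (fun v => phi (w v)), psi'; split; first split => //.
- by split => //; split; [split => //; rewrite /psi' phia|rewrite ct te].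
- split => [l k|j]; last by apply: smooth_subset (spsi' j).
  apply: (Ck_comp (f := fun u => phi u 0 l) oV oU Uw); first exact: sphi.
  move=> j; have [jj|jj] := eqVneq j j0; first exact: sth.
  exact: Ck_coord.
- move=> v Vv; have [Mw Nw psiw] := HU _ (Uw v Vv).
  have psi'w : psi' (phi (w v)) = v.
    by rewrite /psi' psiw Fw// /w upd_upd upd_id.
  split => //; split; first by split => //; rewrite psi'w.
  by rewrite psiw /w upd_same; have [] := thP v Vv.
- move=> z Mz [[Nz Vz] zce]; have [Uz phiz] := HN z Mz Nz.
  split => //.
  have E : psi z 0 j0 = th (psi' z).
    have [_ _ H] := thP _ Vz; have [|_] := H (psi z 0 j0).
      by case/andP: zce => *; rewrite !ltW.
    apply; rewrite /F /L rinit_snoc snoc_last /psi' upd_upd upd_id phiz upd_same.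
    by rewrite subrr.
  by rewrite /w -E /psi' upd_upd upd_id.
- move=> j; rewrite ltnS leq_eqVlt => /orP[/eqP/val_inj ->|jj0].
    by exists i => v; exact: Fw.
  have [l lP] := nU j jj0; exists l => v Vv.
  rewrite lP; last exact: Uw.
  by rewrite /w upd_other//; apply: contraTneq jj0 => ->; rewrite ltnn.
Qed.

(** After d steps all the parameters are ambient coordinates, so M is near a
    the graph of a function of the coordinates c 0, ..., c (d - 1). *)
Lemma graph_chart : smooth_manifold d M -> M a ->
  exists (U : set 'rV[R]_d) N phi psi (c : 'I_d -> 'I_n), local_chart M a U N phi psi /\
    (forall (u : 'rV[R]_d) (j : 'I_d), U u -> phi u 0 (c j) = u 0 j).
Proof.
move=> mM Ma.
have H k : (k <= d)%N -> exists (U : set 'rV[R]_d) N phi psi, local_chart M a U N phi psi /\ normalized k U phi.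
  elim: k => [_|k IH kd].
    have [U [N [phi [psi ch]]]] := manifold_local_chart mM Ma.
    by exists U, N, phi, psi; split => // j.
  have [U [N [phi [psi [ch nU]]]]] := IH (ltnW kd).
  exact: (chart_step (j0 := Ordinal kd) Ma ch nU).
have [U [N [phi [psi [ch nU]]]]] := H d (leqnn d).
have [c cP] := choice (fun j : 'I_d => nU j (ltn_ord j)).
by exists U, N, phi, psi, c; split => // u j; exact: cP.
Qed.

End ChartStep.

End Charts.

(** * Images of compact manifolds as finite unions of images of boxes *)

Section Cover.
Variables (R : realType) (E : expansion R).

Lemma rat_approx (x e : R) : 0 < e -> exists q : rat, `|x - ratr q| < e.
Proof.
move=> e0; have [|q] := @rat_in_itvoo R (x - e) (x + e); first by lra.
by rewrite in_itv /= => /andP[q1 q2]; exists q; rewrite ltr_norml; lra.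
Qed.

Lemma rat_small (e : R) : 0 < e -> exists q : rat, 0 < q /\ ratr q < e.
Proof.
move=> e0; have [q] := rat_in_itvoo e0; rewrite in_itv /= => /andP[q1 q2].
by exists q; split => //; rewrite -(ltr0q R).
Qed.

(** Rational data make the cube 0-definable. *)
Definition rcube n (p : 'rV[rat]_n) (q : rat) : set 'rV[R]_n := cube (\row_i ratr (p 0 i)) (ratr q).

Lemma zdef_rcube n (p : 'rV[rat]_n) q : zdef E (rcube p q).
Proof.
apply: zdef_all_fin => i; apply: zdef_lt; last exact: zdfun_rat.
apply: zdfun_norm; apply: zdfun_sub; first exact: zdfun_proj.
by apply: zdfun_ext (zdfun_rat _ _ (p 0 i)) => v; rewrite mxE.
Qed.

Lemma rcube_nbhs n (O : set 'rV[R]_n) a : open O -> O a ->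
  exists p q, rcube p q a /\ rcube p q `<=` O.
Proof.
move=> /row_openP /[apply] -[e e0 eO].
have e2 : 0 < e / 2 by rewrite divr_gt0.
have [q [q0 qe]] := rat_small e2.
have q0' : 0 < ratr q :> R by rewrite ltr0q.
have [p pP] := choice (fun i => rat_approx (a 0 i) q0').
exists (\row_i p i), q; split => [i|z za]; first by rewrite !mxE; exact: pP.
apply: eO => i; have := za i; have := pP i; rewrite !mxE !ltr_norml.
by move=> /andP[h1 h2] /andP[h3 h4]; apply/andP; split; lra.
Qed.

Section Local.
Variables (n m d : nat) (M : set 'rV[R]_n) (f : 'rV[R]_n -> 'rV[R]_m).
Hypothesis mM : smooth_manifold d M.
Hypothesis sf : smooth_map_on M f.
Hypothesis zf : zdef E [set row_mx x (f x) | x in M].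

(** Let phi parametrize M near a by d of the coordinates.  For v in a rational
    box, phi v is the only point of M with coordinates v in a rational cube
    around a; as the graph of f on M is 0-definable, so is v |-> f (phi v).
    Translating the rational centre P of the box to 0 gives functions on
    [-r, r]. *)
Lemma local_cover a : M a -> exists (N : set 'rV[R]_n) (r : 'rV[rat]_d) (H : 'I_m -> 'rV[R]_d -> R),
  [/\ open N /\ N a, pos_radius r, forall l, Csys E r (H l) /\ zdfun E (H l),
      (forall v, box r v -> exists2 z, M z & f z = \row_l H l v) &
      (forall z, M z -> N z -> exists2 v, box r v & f z = \row_l H l v)].
Proof.
move=> Ma.
have [U [N [phi [psi [c [[oU [oN Na] [sphi spsi] HU HN] cP]]]]]] := graph_chart mM Ma.
have [ O [g [oO Oa sg fg]]] := smooth_on_local sf Ma.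
have [Ua phia] := HN a Ma Na.
have [q [rho [Ba BNO]]] := rcube_nbhs (openI oN oO) (conj Na Oa).
pose B := rcube q rho.
have oB : open B by exact: cube_open.
pose U1 := [set u | U u /\ B (phi u)].
have oU1 : open U1.
  by apply: (row_cont_open (g := phi) oU oB) => i x Ux; exact: (smooth_continuous oU (sphi i)).
have U1a : U1 (psi a) by split => //; rewrite phia.
have [e e0 eU1] := (row_openP U1).1 oU1 _ U1a.
have e3 : 0 < e / 3 by rewrite divr_gt0.
(* P is at distance < s from psi a, so the box of radius 2 s around P lies within 3 s < e of psi a *)
have [s [s0 se]] := rat_small e3.
have s0' : 0 < ratr s :> R by rewrite ltr0q.
have [p pP] := choice (fun i => rat_approx (psi a 0 i) s0').
pose P : 'rV[R]_d := \row_j ratr (p j).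
pose r : 'rV[rat]_d := \row__ s.
pose r2 : 'rV[rat]_d := \row__ (s + s).
pose V : set 'rV[R]_d := obox r2.
have oV : open V by exact: obox_open.
have VU v : V v -> U1 (v + P).
  move=> Vv; apply: eU1 => j; have := Vv j; have := pP j.
  rewrite !mxE rmorphD /= !ltr_norml => /andP[h1 h2] /andP[h3 h4].
  by apply/andP; split; lra.
pose h l v := g (phi (v + P)) 0 l.
have sh l : smooth V (h l).
  move=> k.
  have phiE u : phi u = \row_i (fun i u => phi u 0 i) i u by apply/rowP => i; rewrite mxE.
  have addE (v : 'rV[R]_d) : v + P = \row_j (fun j (v : 'rV[R]_d) => v 0 j + P 0 j) j v.
    by apply/rowP => j; rewrite !mxE.
  have sphi1 i : Ck k V (fun v => phi (v + P) 0 i).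
    apply: (Ck_ext (f := fun v => phi (\row_j (fun j (v : 'rV[R]_d) => v 0 j + P 0 j) j v) 0 i)) => //.
      by move=> v _; rewrite -addE.
    apply: (Ck_comp (f := fun u => phi u 0 i) oV oU) => [v Vv||j].
    - by rewrite -addE; have [] := VU v Vv.
    - exact: sphi.
    - by apply: Ck_add => //; [exact: Ck_coord|exact: Ck_cst].
  apply: (Ck_ext (f := fun v => g (\row_i (fun i v => phi (v + P) 0 i) i v) 0 l)) => //.
    by move=> v _; rewrite /h -phiE.
  apply: (Ck_comp (f := fun z => g z 0 l) oV oO) => [v Vv||//]; last exact: sg.
  by rewrite -phiE; have [_ /BNO[]] := VU v Vv.
have fphi v : V v -> M (phi (v + P)) /\ f (phi (v + P)) = \row_l h l v.
  move=> Vv; have [/HU[Mv _ _] /BNO[_ Ov]] := VU v Vv.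
  by split => //; rewrite fg//; apply/rowP => l; rewrite mxE.
have key v z : V v -> M z -> B z -> (forall j, z 0 (c j) = v 0 j + P 0 j) -> z = phi (v + P).
  move=> Vv Mz Bz zv; have [Nz _] := BNO z Bz.
  have [Uz phiz] := HN z Mz Nz; rewrite -phiz; congr phi.
  by apply/rowP => j; rewrite -cP// phiz zv [RHS]mxE.
have cphi v j : V v -> phi (v + P) 0 (c j) = v 0 j + P 0 j.
  by move=> /VU[Uv _]; rewrite cP// mxE.
have dh l : zdfun E (h l \_ V).
  pose G (w : 'rV[R]_d.+1) := exists z : 'rV[R]_n, exists y : 'rV[R]_m,
    B z /\ (forall j, z 0 (c j) = rinit w 0 j + ratr (p j)) /\
    [set row_mx x (f x) | x in M] (row_mx z y) /\ w 0 ord_max = y 0 l.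
  apply: (zdfun_graph (G := G)); first exact: zdef_obox.
    apply: zdef_ex_row; apply: zdef_ex_row.
    have I0 : zdmap E (fun u : 'rV[R]_(d.+1 + n + m) => u) by exact: zdmap_id.
    have Mz : zdmap E (fun u : 'rV[R]_(d.+1 + n + m) => rsubmx (lsubmx u)).
      by apply: zdmap_rsubmx; exact: zdmap_lsubmx.
    have Mw : zdmap E (fun u : 'rV[R]_(d.+1 + n + m) => lsubmx (lsubmx u)).
      by apply: zdmap_lsubmx; exact: zdmap_lsubmx.
    have My : zdmap E (fun u : 'rV[R]_(d.+1 + n + m) => rsubmx u) by exact: zdmap_rsubmx.
    apply: zdef_and; first exact: zdef_app (@zdef_rcube _ _ _) Mz.
    apply: zdef_and.
      apply: zdef_all_fin => j; apply: zdef_eq; first exact: Mz.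
      by apply: zdfun_add; [exact: (zdmap_rinit Mw)|exact: zdfun_rat].
    apply: zdef_and; first by apply: (zdef_app zf); exact: zdmap_row_mx.
    by apply: zdef_eq; [exact: Mw|exact: My].
  move=> v y Vv; rewrite /G rinit_snoc snoc_last; split.
    move=> [z [y' [Bz [zc [[x Mx /eq_row_mx[xz fy]] ->]]]]].
    rewrite -fy xz; rewrite xz in Mx.
    have -> : z = phi (v + P) by apply: key => // j; rewrite zc mxE.
    by have [_ ->] := fphi v Vv; rewrite mxE.
  move=> ->; exists (phi (v + P)), (f (phi (v + P))).
  have [Mv fv] := fphi v Vv.
  split; first by have [] := VU v Vv.
  split; first by move=> j; rewrite cphi// mxE.
  split; first by exists (phi (v + P)).
  by rewrite fv mxE.
have rV : box r `<=` V by apply: box_obox => j; rewrite !mxE ltrDl.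
pose N1 := [set z | B z /\ cube P (ratr s) (\row_j z 0 (c j))].
exists N1, r, (fun l => h l \_ V); split.
- split; last first.
    by split => // j; have := pP j; rewrite -cP// phia !mxE.
  apply: (row_cont_open (g := fun z => \row_j z 0 (c j)) oB (@cube_open _ _ _ _)) => j x _.
  have -> : (fun z : 'rV[R]_n => (\row_j0 z 0 (c j0)) 0 j) = (fun z => z 0 (c j)).
    by apply/funext => z; rewrite mxE.
  exact: coord_continuous.
- by move=> j; rewrite mxE.
- move=> l; split => //; exists r2, (h l \_ V); split => //.
    by move=> j; rewrite !mxE ltrDl.
  by move=> k; apply: Ck_ext (sh l k) => // v Vv; rewrite patchE mem_set.
- move=> v /rV Vv; have [Mv fv] := fphi v Vv; exists (phi (v + P)) => //.
  by rewrite fv; apply/rowP => l; rewrite !mxE patchE mem_set.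
- move=> z Mz [Bz zc]; pose v : 'rV[R]_d := (\row_j z 0 (c j)) - P.
  have rv : box r v by move=> j; have := zc j; rewrite !mxE => /ltW.
  have Vv := rV v rv.
  have zE : z = phi (v + P) by apply: key => // j; rewrite /v !mxE subrK.
  exists v => //; have [_ fv] := fphi v Vv.
  by rewrite {1}zE fv; apply/rowP => l; rewrite !mxE patchE mem_set.
Qed.

Lemma cover_image : compact M -> exists (I : nat) (r : 'I_I -> 'rV[rat]_d) (H : 'I_I -> 'I_m -> 'rV[R]_d -> R),
  [/\ forall i, pos_radius (r i), forall i l, Csys E (r i) (H i l) /\ zdfun E (H i l) &
      forall y, (exists2 z, M z & f z = y) <-> exists i v, box (r i) v /\ y = \row_l H i l v].
Proof.
move=> cM.
have ex a : exists p : set 'rV[R]_n * 'rV[rat]_d * ('I_m -> 'rV[R]_d -> R), M a ->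
  [/\ open p.1.1 /\ p.1.1 a, pos_radius p.1.2, forall l, Csys E p.1.2 (p.2 l) /\ zdfun E (p.2 l),
      (forall v, box p.1.2 v -> exists2 z, M z & f z = \row_l p.2 l v) &
      (forall z, M z -> p.1.1 z -> exists2 v, box p.1.2 v & f z = \row_l p.2 l v)].
  have [Ma|nM] := pselect (M a); last by exists (set0, 0, fun _ _ => 0) => /nM.
  by have [N [r [H HP]]] := local_cover Ma; exists (N, r, H).
have [p pP] := choice ex.
move: cM; rewrite compact_cover => /(_ _ M (fun a => (p a).1.1)).
case=> [a Ma|a Ma|D DM Dcov].
- by have [[]] := pP a Ma.
- by exists a => //; have [[]] := pP a Ma.
pose s := finmap.enum_fset D.
have sM i : (i < size s)%N -> M (nth 0 s i).
  by move=> si; apply/set_mem/DM; exact: mem_nth.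
exists (size s), (fun i => (p (nth 0 s i)).1.2), (fun i => (p (nth 0 s i)).2); split.
- by move=> i; have [] := pP _ (sM i (ltn_ord i)).
- by move=> i; have [] := pP _ (sM i (ltn_ord i)).
move=> y; split.
  move=> [z Mz <-]; have [a Da pz] := Dcov z Mz.
  have ai : (index a s < size s)%N by rewrite index_mem.
  have [_ _ _ _ H] := pP a (set_mem (DM _ Da)).
  have [v rv fv] := H z Mz pz.
  by exists (Ordinal ai), v => /=; rewrite nth_index.
move=> [i [v [rv ->]]].
by have [_ _ _ H _] := pP _ (sM i (ltn_ord i)); have [z] := H v rv; exists z.
Qed.

End Local.
End Cover.

(** * Boundaries have empty interior; dimension *)

HB.instance Definition _ (R : realType) (m n : nat) := Complete.on 'M[R]_(m, n).

Section NowhereDense.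
Variables (R : realType) (E : expansion R).
Hypothesis omin : o_minimal E.

Lemma interior_cube n (A : set 'rV[R]_n) x : A° x <-> exists2 e : R, 0 < e & cube x e `<=` A.
Proof. by rewrite /interior /= row_nbhsP; split => -[e e0 eA]; exists e. Qed.

(** For each i the interior of S i and that of its complement have a dense
    union.  By Baire's theorem some point of the given cube lies in all these
    unions; it belongs to some S i, hence to the interior of this S i. *)
Lemma baire_pigeonhole n (J : countType) (S : J -> set 'rV[R]_n) (x : 'rV[R]_n) e :
  (forall i (y : 'rV[R]_n) d, 0 < d -> exists z r, [/\ 0 < r, cube z r `<=` cube y d &
      cube z r `<=` S i \/ cube z r `<=` ~` S i]) ->
  (forall y, exists i, S i y) -> 0 < e ->
  exists i z r, [/\ 0 < r, cube z r `<=` cube x e & cube z r `<=` S i].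
Proof.
move=> nd cov e0.
pose F k := if unpickle k is Some i then (S i)° `|` (~` S i)° else setT.
have FP k : open (F k) /\ dense (F k).
  rewrite /F; case: unpickle => [i|]; last first.
    by split; [exact: openT|move=> O O0 _; rewrite setIT].
  split; first by apply: openU; exact: open_interior.
  move=> O [y Oy] oO; have [d d0 dO] := (row_openP O).1 oO y Oy.
  have [z [r [r0 zy H]]] := nd i y d d0.
  exists z; split; first by apply: dO; apply: zy; exact: cube_center.
  by case: H => H; [left|right]; apply/interior_cube; exists r.
have /(_ (cube x e)) := @Baire R 'rV[R]_n F FP.
case=> [||z [zx Fz]].
- by exists x; exact: cube_center.
- exact: cube_open.
have [i Siz] := cov z.
have := Fz (pickle i) I; rewrite /F pickleK => -[/interior_cube[d d0 dS]|/interior_subset//].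
have [r r0 rx] := (row_openP _).1 (@cube_open R n x e) z zx.
exists i, z, (Num.min d r); split; first by rewrite lt_min d0.
  by move=> y /(cube_sub (e := r)) yr; apply: rx; apply: yr; rewrite ge_min lexx orbT.
by move=> y /(cube_sub (e := d)) yd; apply: dS; apply: yd; rewrite ge_min lexx.
Qed.

(** Near a rational p, each fibre of A in the last variable either contains or
    misses an interval (p, p + 1 / (k + 1)).  These countably many conditions
    define 0-definable sets of parameters, which satisfy the claim by
    induction; so a single one holds on a whole cube of parameters
    ([baire_pigeonhole]), and this cube times the interval is contained in A
    or in its complement. *)
Lemma zdef_subcube m (A : 'rV[R]_m -> Prop) : zdef E A -> forall x (e : R), 0 < e ->
  exists y d, [/\ 0 < d, cube y d `<=` cube x e & cube y d `<=` A \/ cube y d `<=` ~` A].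
Proof.
elim: m A => [|m IH] A zA x e e0.
  exists x, e; split => //; have [Ax|nAx] := pselect (A x); [left|right] => y _;
    by rewrite (rV0_eq y x).
have e2 : 0 < e / 2 by rewrite divr_gt0.
have [p pP] := rat_approx (x 0 ord_max) e2.
(* kb = (k, b): the fibre over y contains (if b) or misses (if not) the interval (p, p + 1 / (k + 1)) *)
pose S (kb : nat * bool) (y : 'rV[R]_m) := forall t : R, ratr p < t ->
  t < ratr (p + kb.1.+1%:R^-1) -> if kb.2 then A (snoc y t) else ~ A (snoc y t).
have zS kb : zdef E (S kb).
  rewrite /S; apply: zdef_all.
  have P1 : zdfun E (fun v : 'rV[R]_m.+1 => v 0 ord_max) by exact: zdfun_proj.
  apply: zdef_imp; first by apply: zdef_lt => //; exact: zdfun_rat.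
  apply: zdef_imp; first by apply: zdef_lt => //; exact: zdfun_rat.
  have zA' : zdef E (fun w : 'rV[R]_m.+1 => A (snoc (rinit w) (w 0 ord_max))).
    by apply: zdef_iff zA => w; rewrite rinitK.
  by case: kb.2 => //; exact: zdef_not.
have cov y : exists kb, S kb y.
  have zA' : zdef E (fun w : 'rV[R]_(m + 1) => A (snoc (lsubmx w) (w 0 (rshift m 0)))).
    apply: (zdef_app zA); apply: zdmap_snoc; last exact: zdfun_proj.
    by apply: zdmap_lsubmx; exact: zdmap_id.
  have [d d0 dP] := zdef_germ omin y (ratr p) zA'.
  have [k kd] : exists k : nat, k.+1%:R^-1 < d.
    exists (Num.truncn d^-1); rewrite invf_plt ?posrE ?ltr0n//.
    exact: truncnS_gt.
  have lt_d t : t < ratr (p + k.+1%:R^-1) -> t < ratr p + d.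
    move=> H; apply: lt_trans H _; rewrite rmorphD /= ltrD2l.
    by rewrite fmorphV /= ratr_nat.
  case: dP => dP; [exists (k, true)|exists (k, false)] => t pt /lt_d td /=;
    by have := dP t; rewrite pt td row_mxKl row_mxEr mxE; apply.
have nd i (y : 'rV[R]_m) d (d0 : 0 < d) := IH (S i) (zS i) y d d0.
have [[k b] [z [r [r0 zx zS1]]]] := baire_pigeonhole (rinit x) nd cov e0.
pose q : R := k.+1%:R^-1.
have q0 : 0 < q by rewrite invr_gt0 ltr0n.
(* the cube of radius h around (z, p + h) lies over (p, p + 2 h), a subset of (p, p + q) *)
pose h := Num.min r (Num.min (q / 2) (e / 4)).
have h0 : 0 < h by rewrite !lt_min r0 !divr_gt0.
have hr : h <= r by rewrite ge_min lexx.
have hq : h <= q / 2 by rewrite !ge_min lexx orbT.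
have he : h <= e / 4 by rewrite !ge_min lexx !orbT.
have key y : cube (snoc z (ratr p + h)) h y -> cube z r (rinit y) /\ ratr p < y 0 ord_max < ratr p + 2 * h.
  move=> yz; split.
    by move=> j; rewrite mxE; have := yz (lift ord_max j); rewrite snoc_lift => /lt_le_trans; exact.
  by have := yz ord_max; rewrite snoc_last ltr_norml => /andP[h1 h2]; apply/andP; split; lra.
exists (snoc z (ratr p + h)), h; split => //.
  move=> y /key[/zx yx /andP[y1 y2]]; apply: ord_snocP => [|j].
    by move: pP; rewrite !ltr_norml => /andP[p1 p2]; apply/andP; split; lra.
  by have := yx j; rewrite !mxE.
have inS y : cube (snoc z (ratr p + h)) h y -> if b then A y else ~ A y.
  move=> /key[/zS1 Sy /andP[y1 y2]]; have := Sy _ y1.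
  rewrite rinitK; apply; apply: lt_le_trans y2 _.
  rewrite rmorphD /= fmorphV /= ratr_nat -/q; lra.
by case: b inS {zS1} => inS; [left|right] => y /inS.
Qed.

End NowhereDense.

Section Dimension.
Variables (R : realType) (E : expansion R).

Lemma cell_dim_le n d (C : set 'rV[R]_n) : cell E d C -> (d <= n)%N.
Proof.
elim: n d C => [|n IH] d C /=; first by case=> ->.
case=> [[B [f [/IH dn _ _]]]|[d' [B [f [g [-> /IH dn _ _ _]]]]]]; first exact: leqW.
by rewrite ltnS.
Qed.

Lemma cell_point n (p : 'rV[R]_n) : cell E 0 [set p].
Proof.
elim: n p => [|n IH] p /=.
  by split => //; apply/seteqP; split => // x _; exact: rV0_eq.
left; exists [set rinit p], (cst (p 0 ord_max)).
have gE : [set snoc x (cst (p 0 ord_max) x) | x in [set rinit p]] = [set p].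
  apply/seteqP; split => [_ [x -> <-]|_ ->] /=; first by rewrite rinitK.
  by exists (rinit p) => //; rewrite rinitK.
split => //; split; last by apply: continuous_subspaceT => x; exact: cst_continuous.
rewrite gE.
have zP : zdef E (fun w : 'rV[R]_(n.+1 + n.+1) => forall i, rsubmx w 0 i = lsubmx w 0 i).
  apply: zdef_all_fin => i; apply: zdef_eq.
    by apply: zdfun_coord; apply: zdmap_rsubmx; exact: zdmap_id.
  by apply: zdfun_coord; apply: zdmap_lsubmx; exact: zdmap_id.
have := definable_fiber p zP; congr (definable E _).
apply/seteqP; split => v /=; rewrite row_mxKl row_mxKr; first by move=> /rowP.
by move=> ->.
Qed.

Lemma within_cube_continuous n (B : set 'rV[R]_n) (f : 'rV[R]_n -> R) x e :
  0 < e -> cube x e `<=` B -> {within B, continuous f} -> {for x, continuous f}.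
Proof.
move=> e0 eB cf; have : {within cube x e, continuous f} by exact: continuous_subspaceW cf.
rewrite continuous_open_subspace; last exact: cube_open.
by move=> /(_ x); apply; apply/mem_set; exact: cube_center.
Qed.

Lemma band_lower n (B : set 'rV[R]_n) f x e (y : R) : band_bound E B -oo%E f ->
  0 < e -> cube x e `<=` B -> (f x < y%:E)%E ->
  exists2 d : R, 0 < d & forall z t, cube x d z -> `|t - y| < d -> (f z < t%:E)%E.
Proof.
move=> [->|[f0 [_ cf] ->]] e0 eB fy; first by exists 1 => // z t _ _; rewrite ltNyr.
rewrite lte_fin in fy; have d0 : 0 < (y - f0 x) / 2 by rewrite divr_gt0// subr_gt0.
have /row_contP/(_ _ d0)[d d1 dP] := within_cube_continuous e0 eB cf.
exists (Num.min d ((y - f0 x) / 2)); first by rewrite lt_min d1.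
move=> z t zx; rewrite lt_min lte_fin => /andP[_ ty].
have zxd i : `|z 0 i - x 0 i| < d by have := zx i; rewrite lt_min => /andP[].
have := dP z zxd; move: ty; rewrite !ltr_norml => /andP[h1 h2] /andP[h3 h4]; lra.
Qed.

Lemma band_upper n (B : set 'rV[R]_n) f x e (y : R) : band_bound E B +oo%E f ->
  0 < e -> cube x e `<=` B -> (y%:E < f x)%E ->
  exists2 d : R, 0 < d & forall z t, cube x d z -> `|t - y| < d -> (t%:E < f z)%E.
Proof.
move=> [->|[f0 [_ cf] ->]] e0 eB fy; first by exists 1 => // z t _ _; rewrite ltry.
rewrite lte_fin in fy; have d0 : 0 < (f0 x - y) / 2 by rewrite divr_gt0// subr_gt0.
have /row_contP/(_ _ d0)[d d1 dP] := within_cube_continuous e0 eB cf.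
exists (Num.min d ((f0 x - y) / 2)); first by rewrite lt_min d1.
move=> z t zx; rewrite lt_min lte_fin => /andP[_ ty].
have zxd i : `|z 0 i - x 0 i| < d by have := zx i; rewrite lt_min => /andP[].
have := dP z zxd; move: ty; rewrite !ltr_norml => /andP[h1 h2] /andP[h3 h4]; lra.
Qed.

Lemma cell_full_cube n (C : set 'rV[R]_n) : cell E n C ->
  exists x (e : R), 0 < e /\ cube x e `<=` C.
Proof.
elim: n C => [|n IH] C /=.
  by move=> [_ ->]; exists 0, 1.
case=> [[B [f [/cell_dim_le]]]|[d' [B [f [g [[<-] cB [bf bg] fg ->]]]]]].
  by rewrite ltnn.
have [x [e [e0 eB]]] := IH B cB.
have Bx : B x by apply: eB; exact: cube_center.
have [y fy yg] : exists2 y : R, (f x < y%:E)%E & (y%:E < g x)%E.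
  have := fg x Bx; case: bf => [->|[f0 _ ->]]; case: bg => [->|[g0 _ ->]].
  - by exists 0; rewrite ?ltNyr ?ltry.
  - by exists (g0 x - 1); rewrite ?ltNyr// lte_fin; lra.
  - by exists (f0 x + 1); rewrite ?ltry// lte_fin; lra.
  - rewrite lte_fin => H; exists ((f0 x + g0 x) / 2); rewrite lte_fin; lra.
have [d1 d10 H1] := band_lower bf e0 eB fy.
have [d2 d20 H2] := band_upper bg e0 eB yg.
exists (snoc x y), (Num.min e (Num.min d1 d2)); split; first by rewrite !lt_min e0 d10.
move=> z zxy; exists (rinit z), (z 0 ord_max).
have zx i : `|rinit z 0 i - x 0 i| < Num.min e (Num.min d1 d2).
  by have := zxy (lift ord_max i); rewrite snoc_lift mxE.
have zy : `|z 0 ord_max - y| < Num.min e (Num.min d1 d2).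
  by have := zxy ord_max; rewrite snoc_last.
split; last by rewrite rinitK.
- by apply: eB => i; have := zx i; rewrite !lt_min => /and3P[].
- apply: H1; last by move: zy; rewrite !lt_min => /and3P[].
  by move=> i; have := zx i; rewrite !lt_min => /and3P[].
- apply: H2; last by move: zy; rewrite !lt_min => /and3P[].
  by move=> i; have := zx i; rewrite !lt_min => /and3P[].
Qed.

(** Points are cells, and cells in R^n have dimension at most n. *)
Lemma has_dim_exists n (A : set 'rV[R]_n) p : A p -> exists d, has_dim E A d.
Proof.
move=> Ap; pose P d := `[< exists2 C, cell E d C & C `<=` A >].
have exP : exists d, P d.
  by exists 0%N; apply/asboolP; exists [set p]; [exact: cell_point|move=> _ ->].
have bP d : P d -> (d <= n)%N by move=> /asboolP[C /cell_dim_le].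
case: (ex_maxnP exP bP) => d /asboolP Pd dmax; exists d; split => //.
by move=> d' C cC CA; apply: dmax; apply/asboolP; exists C.
Qed.

Lemma has_dim_lt n (A : set 'rV[R]_n) d : has_dim E A d ->
  (forall x e, 0 < e -> ~ cube x e `<=` A) -> (d < n)%N.
Proof.
move=> [[C cC CA] _] nA; rewrite ltn_neqAle (cell_dim_le cC) andbT.
apply/eqP => dn; rewrite dn in cC; have [x [e [e0 eC]]] := cell_full_cube cC.
by apply: (nA x e e0) => y /eC/CA.
Qed.

End Dimension.

(** * Definable equivalence *)

Section Equivalence.
Variables (R : realType) (E : expansion R).

Let F := ifs_expansion (Csys E).

Lemma sym_dfun (f : ifs_symbol (Csys E)) :
  zdfun E (@sym_fun R _ f \_ (box (@sym_radius R _ f))).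
Proof.
have [s [g [rs dg _ fg]]] := sym_mem f.
apply: zdfun_ext (zdfun_restrict (zdef_box E (sym_radius f)) dg) => v.
by rewrite !patchE; case: ifP => // /set_mem/fg.
Qed.

Lemma ifs_term_dfun n (t : term F n) : zdfun E (fun v => teval v t).
Proof.
elim: t => [i| | |t IH|t1 IH1 t2 IH2|t1 IH1 t2 IH2|f ts IH] /=.
- exact: zdfun_proj.
- exact: zdfun0.
- exact: zdfun1.
- exact: zdfun_opp.
- exact: zdfun_add.
- exact: zdfun_mul.
- by apply: (zdfun_app (sym_dfun f)); exact: zdmap_row.
Qed.

(** The symbols of R_C are interpreted by functions 0-definable in E. *)
Lemma ifs_definable n (P : 'rV[R]_n -> Prop) : zdef F P -> zdef E P.
Proof.
move=> [phi ->]; change (zdef E (sat phi)).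
elim: phi => {n P} [n t1 t2|n t1 t2|n []|n phi IH|n phi IH1 psi IH2|n phi IH] /=.
- by apply: zdef_eq; exact: ifs_term_dfun.
- by apply: zdef_lt; exact: ifs_term_dfun.
- exact: zdef_not.
- exact: zdef_and.
- by apply: zdef_ex; apply: zdef_iff IH => v; rewrite rinitK.
Qed.

Lemma Csys_dfun n (r : 'rV[rat]_n) h : pos_radius r -> Csys E r h -> zdfun F (h \_ (box r)).
Proof.
move=> r0 Ch; pose f := IfsSymbol r0 Ch.
apply: zdfun_ext (zdfun_term (@App F n f (fun i => Var _ i))) => v /=.
by congr ((h \_ (box r)) _); apply/rowP => i; rewrite mxE.
Qed.

Hypothesis unif : smooth_uniformization E.

(** K is a finite union of images of boxes under maps whose components belong
    to C, and a point of such an image belongs to A when one of its preimages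
    belongs to the inverse image of A, a subset of R^d. *)
Lemma compact_inter m d (K A : set 'rV[R]_m) : compact K -> zdef E K -> has_dim E K d ->
  (forall (r : 'rV[rat]_d) (H : 'I_m -> 'rV[R]_d -> R), pos_radius r -> (forall l, zdfun E (H l)) ->
     zdef F (fun v => box r v /\ A (\row_l H l v))) ->
  zdef F (K `&` A).
Proof.
move=> cK zK dK zA.
have [n [M [f [cM mM sf zf fMK]]]] := unif cK zK dK.
have [I [r [H [r0 HP cov]]]] := cover_image mM sf zf cM.
apply: (@zdef_iff _ _ _ (fun y => ~ forall i : 'I_I, ~ exists v : 'rV[R]_d,
    (box (r i) v /\ A (\row_l H i l v)) /\ forall l, y 0 l = (H i l \_ (box (r i))) v)).
  move=> y; rewrite -fMK; split.
    move=> nall; apply: contrapT => nKA; apply: nall => i [v [[rv Av] yv]].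
    have yE : y = \row_l H i l v.
      by apply/rowP => l; rewrite yv mxE patchE mem_set.
    by apply: nKA; split; [apply/cov; exists i, v|rewrite yE].
  move=> [/cov[i [v [rv yE]]] Ay] nall; apply: (nall i); exists v; rewrite -yE.
  by split => // l; rewrite yE mxE patchE mem_set.
apply: zdef_not; apply: zdef_all_fin => i; apply: zdef_not; apply: zdef_ex_row.
have dR : zdmap F (fun u : 'rV[R]_(m + d) => rsubmx u) by apply: zdmap_rsubmx; exact: zdmap_id.
have dL : zdmap F (fun u : 'rV[R]_(m + d) => lsubmx u) by apply: zdmap_lsubmx; exact: zdmap_id.
apply: zdef_and.
  apply: (zdef_app _ dR (P := fun v => box (r i) v /\ A (\row_l H i l v))).
  by apply: zA => // l; have [] := HP i l.
apply: zdef_all_fin => l; apply: zdef_eq; first exact: dL.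
by apply: zdfun_app dR; apply: Csys_dfun => //; have [] := HP i l.
Qed.

(** The inverse images of the whole space are the boxes themselves. *)
Lemma compact_definable m (K : set 'rV[R]_m) : compact K -> zdef E K -> zdef F K.
Proof.
move=> cK zK; have [[p Kp]|nK] := pselect (exists p, K p); last first.
  apply: zdef_iff (zdef_not (zdef_true F m)) => v; split => [nT|Kv _]; first by exfalso; apply: nT.
  by apply: nK; exists v.
have [d dK] := has_dim_exists E Kp.
have := @compact_inter m d K setT cK zK dK; rewrite setIT; apply => r H r0 _.
by apply: zdef_iff (zdef_box F r) => v; split => // -[].
Qed.

Lemma zdef_closure n (A : set 'rV[R]_n) : zdef E A -> zdef E (closure A).
Proof.
move=> zA.
have zQ : zdef E (fun v : 'rV[R]_n => forall e : R, 0 < e -> exists y : 'rV[R]_n,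
    A y /\ forall i, `|y 0 i - v 0 i| < e).
  apply: zdef_all.
  have P1 : zdfun E (fun v : 'rV[R]_n.+1 => v 0 ord_max) by exact: zdfun_proj.
  apply: zdef_imp; first by apply: zdef_lt => //; exact: zdfun0.
  apply: zdef_ex_row.
  have dR : zdmap E (fun u : 'rV[R]_(n.+1 + n) => rsubmx u) by apply: zdmap_rsubmx; exact: zdmap_id.
  have dL : zdmap E (fun u : 'rV[R]_(n.+1 + n) => lsubmx u) by apply: zdmap_lsubmx; exact: zdmap_id.
  apply: zdef_and; first exact: zdef_app zA dR.
  apply: zdef_all_fin => i; apply: zdef_lt; last exact: dL.
  by apply/zdfun_norm/zdfun_sub; [exact: dR|exact: (zdmap_rinit dL)].
apply: zdef_iff zQ => v; split.
  by move=> H B /row_nbhsP[e e0 eB]; have [y [Ay ye]] := H e e0; exists y; split => //; exact: eB.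
move=> H e e0; have [|y [Ay ye]] := H (cube v e).
  by apply/row_nbhsP; exists e.
by exists y; split.
Qed.

Hypothesis omin : o_minimal E.

(** A is the union of closure A minus K and of A /\ K, where K is the boundary of
    A.  Since K contains no cube it has dimension d < m, and the inverse images
    of A in R^d are handled by the hypothesis. *)
Lemma bounded_definable m (A : set 'rV[R]_m) :
  (forall d, (d < m)%N -> forall B : 'rV[R]_d -> Prop, zdef E B -> zdef F B) ->
  zdef E A -> A `<=` box (const_mx 1) -> zdef F A.
Proof.
move=> IH zA Abox.
have cA : compact (closure A).
  apply: (subclosed_compact (@closed_closure _ A) (@box_compact R m (const_mx 1))).
  have cB : closed (box (const_mx 1) : set 'rV[R]_m).
    by apply: compact_closed; [exact: norm_hausdorff|exact: box_compact].
  by have /closure_id -> := cB; exact: closureS.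
pose K := closure A `&` closure (~` A).
have cK : compact K.
  apply: subclosed_compact cA _; first by apply: closedI; exact: closed_closure.
  by move=> x [].
have zK : zdef E K by apply: zdef_and; [exact: zdef_closure|apply: zdef_closure; exact: zdef_not].
have zKA : zdef F (K `&` A).
  have [[p Kp]|nK] := pselect (exists p, K p); last first.
    apply: zdef_iff (zdef_not (zdef_true F m)) => v; split => [nT|[Kv _]]; first by exfalso; apply: nT.
    by exfalso; apply: nK; exists v.
  have [d dK] := has_dim_exists E Kp.
  have dm : (d < m)%N.
    apply: (has_dim_lt dK) => x e e0 eK.
    have [y [r [r0 /(_ y (cube_center _ r0)) yx H]]] := zdef_subcube omin zA x e0.
    have [cAy cnAy] := eK y yx.
    have yr : nbhs y (cube y r) by apply/row_nbhsP; exists r.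
    case: H => H; first by have [z [nAz /H]] := cnAy _ yr.
    by have [z [Az /H]] := cAy _ yr.
  apply: (compact_inter cK zK dK) => r H r0 dH.
  apply: (IH d dm); apply: zdef_and; first exact: zdef_box.
  by apply: (zdef_app zA); exact: zdmap_row.
have zcA := compact_definable cA (zdef_closure zA).
have zcK := compact_definable cK zK.
apply: zdef_iff (zdef_or zKA (zdef_and zcA (zdef_not zcK))) => v; split.
  case=> [[]//|[cAv nKv]]; apply: contrapT => nAv; apply: nKv.
  by split => //; exact: subset_closure.
move=> Av; have [Kv|nKv] := pselect (K v); [by left|right].
by split => //; exact: subset_closure.
Qed.

(** Semialgebraic, hence 0-definable in every expansion, so that boundedness can
    be assumed. *)
Definition squash (t : R) : R := t / (1 + `|t|).
Definition unsquash (t : R) : R := t / (1 - `|t|).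

Lemma squash_lt1 t : `|squash t| < 1.
Proof.
have t0 : 0 < 1 + `|t| by rewrite ltr_wpDr.
by rewrite /squash normrM normfV (gtr0_norm t0) ltr_pdivrMr// mul1r ltrDr.
Qed.

Lemma squashK : cancel squash unsquash.
Proof.
move=> t; rewrite /unsquash /squash normrM normfV.
have t0 : 0 < 1 + `|t| by rewrite ltr_wpDr.
rewrite (gtr0_norm t0); field.
apply/andP; split; first by rewrite gt_eqF.
by rewrite addrK oner_eq0.
Qed.

Lemma definable_ifs m (A : 'rV[R]_m -> Prop) : zdef E A -> zdef F A.
Proof.
elim/ltn_ind: m A => m IH A zA.
pose B (y : 'rV[R]_m) := (forall i, `|y 0 i| < 1) /\ A (\row_i unsquash (y 0 i)).
have dun (E' : expansion R) i : zdfun E' (fun y : 'rV[R]_m => unsquash (y 0 i)).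
  apply: zdfun_mul; first exact: zdfun_proj.
  by apply/zdfun_inv/zdfun_sub; [exact: zdfun1|apply/zdfun_norm/zdfun_proj].
have dsq (E' : expansion R) i : zdfun E' (fun y : 'rV[R]_m => squash (y 0 i)).
  apply: zdfun_mul; first exact: zdfun_proj.
  by apply/zdfun_inv/zdfun_add; [exact: zdfun1|apply/zdfun_norm/zdfun_proj].
have zB : zdef E B.
  apply: zdef_and; last by apply: (zdef_app zA); apply: zdmap_row => i; exact: dun.
  by apply: zdef_all_fin => i; apply: zdef_lt; [apply/zdfun_norm/zdfun_proj|exact: zdfun1].
have zFB : zdef F B.
  apply: bounded_definable => // y [y1 _] i.
  by rewrite mxE rmorph1 ltW.
apply: zdef_iff (zdef_app zFB (zdmap_row (fun i => dsq F i))) => v; rewrite /B.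
have -> : \row_i unsquash ((\row_i squash (v 0 i)) 0 i) = v.
  by apply/rowP => i; rewrite !mxE squashK.
split=> [[]//|Av]; split => // i.
by rewrite mxE squash_lt1.
Qed.

End Equivalence.

Theorem theorem0p5 (R : realType) (E : expansion R) :
  o_minimal E -> polynomially_bounded E -> smooth_uniformization E ->
  exists C : fun_collection R,
    [/\ if_system C, quasianalytic C & definably_equivalent E (ifs_expansion C)].
Proof.
move=> omin pbnd unif; exists (Csys E); split.
- exact: Csys_if_system.
- exact: Csys_quasianalytic.
- move=> n A; split; first exact: definable_ifs.
  exact: ifs_definable.
Qed.
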